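(* Fix real numbers $0<b_1<b_2<1$ and $\lambda,\varepsilon>0$, and a measurable function $\Psi:\mathbb{T}\to[0,1]$, where $\mathbb{T}=\mathbb{R}/\mathbb{Z}$ (identified with $[0,1)$). Let $G_y(x)=G(x,y)$ be the entropy solution of $$\partial_y G(x,y)+\partial_x\big(\varphi(G(x,y))\big)=0$$ on $\mathbb{T}\times[0,\lambda]$ with initial data $G(x,0)=\Psi(x)$. For each integer $N\ge1$ let $\psi^{(N)}\in\{0,1\}^{\mathfrak{T}_N}$ be a boundary condition, and assume $$\lim_{N\to\infty}\sup_{0\le x_1\le x_2\le 1}\Big|\frac1N\sum_{j=\lfloor x_1N\rfloor}^{\lfloor x_2N\rfloor}\psi^{(N)}(j)-\int_{x_1}^{x_2}\Psi(x)\,dx\Big|=0$$ (indices of $\psi^{(N)}$ taken mod $N$). For each $N$ let $\eta=\eta^{(N)}=(\eta_y(x))$ be the particle configuration of a six-vertex ensemble sampled from $\mathcal{P}_N(b_1,b_2;\lambda;\psi^{(N)})$, and let $L=\lfloor\lambda N\rfloor$. Then $$\lim_{N\to\infty}\mathbb{P}\Big[\max_{\substack{0\le X_1\le X_2<N\\0\le Y_1\le Y_2\le L}}\Big|\frac1{N^2}\sum_{y=Y_1}^{Y_2}\sum_{x=X_1}^{X_2}\eta_y(x)-\int_{Y_1/N}^{Y_2/N}\int_{X_1/N}^{X_2/N}G_y(x)\,dx\,dy\Big|>\varepsilon\Big]=0.$$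
   Context: Let $\kappa=\frac{1-b_1}{1-b_2}>1$ and $\varphi(z)=\frac{\kappa z}{(\kappa-1)z+1}$ for $z\in[0,1]$. The entropy solution of $\partial_yG+\partial_x\varphi(G)=0$ with bounded measurable initial data is the unique bounded measurable weak solution (continuous in $y$ in $L^1$) satisfying the Kružkov entropy inequality $\int_0^\lambda\int_{\mathbb T}\big(\partial_yf\,|G-c|+\partial_xf\,|\varphi(G)-\varphi(c)|\big)\,ds\,dt+\int_{\mathbb T}|G(s,0)-c|f(s,0)\,ds\ge0$ for all nonnegative smooth $f$ and constants $c$. Model: $\mathfrak{T}_N=\mathbb{Z}/N\mathbb{Z}$, $L=\lfloor\lambda N\rfloor$, cylinder $\mathfrak{C}=\mathfrak{T}_N\times\{1,\dots,L\}$ with vertices adjacent when they differ by $(\pm1,0)$ or $(0,\pm1)$ (horizontally wrapping). An arrow configuration at a vertex is $(i_1,j_1;i_2,j_2)\in\{0,1\}^4$ with $i_1+j_1=i_2+j_2$, where $i_1,j_1$ are the numbers of arrows entering from below and from the left and $i_2,j_2$ the numbers exiting upward and to the right. A six-vertex ensemble on $\mathfrak{C}$ assigns arrow configurations to all vertices consistently along shared edges; arrows form up-right paths. The boundary condition $\psi\in\{0,1\}^{\mathfrak{T}_N}$ specifies that a vertical arrow enters $(x,1)$ from below iff $\psi(x)=1$; the top is free. Vertex weights: $w(1,0;1,0)=b_1$, $w(0,1;0,1)=b_2$, $w(1,0;0,1)=1-b_1$, $w(0,1;1,0)=1-b_2$, $w(0,0;0,0)=w(1,1;1,1)=1$. The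 measure $\mathcal{P}_N(b_1,b_2;\lambda;\psi)$ assigns to each ensemble the product of its vertex weights (these sum to 1). The particle configuration of an ensemble is $\eta_y(x)$, $x\in\mathfrak{T}_N$, $0\le y\le L$, the indicator that there is a vertical arrow from $(x,y)$ to $(x,y+1)$; so $\eta_0=\psi$.
   Formalization: The products of vertex weights on the cylinder do not sum to 1 (for N = L = 1 and ψ = 1 the total is 1 + b_1), so the measure P_N is taken to be the product of vertex weights divided by their total over all ensembles with boundary condition ψ. *)

(* Defs.v *)
From HB Require Import structures.
From mathcomp Require Import all_boot all_order all_algebra.
From mathcomp Require Import all_classical all_reals all_analysis.
Set Implicit Arguments. Unset Strict Implicit. Unset Printing Implicit Defensive.
Import Order.TTheory GRing.Theory Num.Theory numFieldNormedType.Exports.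
Local Open Scope classical_set_scope.
Local Open Scope ring_scope.

Definition kappa {R : realType} (b1 b2 : R) : R := (1 - b1) / (1 - b2).

Definition phi {R : realType} (b1 b2 : R) (z : R) : R :=
  kappa b1 b2 * z / ((kappa b1 b2 - 1) * z + 1).

(* Test functions on T x R, T = R/Z : functions R -> R -> R, 1-periodic *)
(* in the first variable, that are C^infinity.                          *)

Definition pdx {R : realType} (f : R -> R -> R) (x y : R) : R :=
  derive1 (fun s => f s y) x.
Definition pdy {R : realType} (f : R -> R -> R) (x y : R) : R :=
  derive1 (fun t => f x t) y.

Fixpoint Ck {R : realType} (n : nat) (f : R -> R -> R) : Prop :=
  match n with
  | 0 => continuous (fun p : R * R => f p.1 p.2)
  | n'.+1 =>
      [/\ continuous (fun p : R * R => f p.1 p.2),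
          (forall x y, derivable (fun s => f s y) x 1
                       /\ derivable (fun t => f x t) y 1),
          Ck n' (pdx f) & Ck n' (pdy f)]
  end.

Definition smooth2 {R : realType} (f : R -> R -> R) : Prop :=
  forall n, Ck n f.

Definition periodic_x {R : realType} (f : R -> R -> R) : Prop :=
  forall x y, f (x + 1) y = f x y.

Definition dint {R : realType} (lam : R) (F : R -> R -> R) : R :=
  \int[@lebesgue_measure R]_(t in `[0, lam])
     \int[@lebesgue_measure R]_(s in `[0, 1[) F s t.

Definition entropy_solution {R : realType} (b1 b2 lam : R)
    (Psi : R -> R) (G : R -> R -> R) : Prop :=
  (* bounded, with values in [0,1] = the domain of phi *)
      (forall x y, 0 <= x < 1 -> 0 <= y <= lam -> 0 <= G x y <= 1) /\
      measurable_fun ((`[0, 1[ : set R) `*` (`[0, lam] : set R))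
                     (fun p : R * R => G p.1 p.2) /\
      (forall x, 0 <= x < 1 -> G x 0 = Psi x) /\
      (forall y0 : R, 0 <= y0 <= lam -> forall e : R, 0 < e ->
         exists d : R, 0 < d /\ forall y : R, 0 <= y <= lam -> `|y - y0| < d ->
           (\int[@lebesgue_measure R]_(x in (`[0%R, 1%R[ : set R))
               (`|G x y - G x y0|)%:E <= e%:E)%E) /\
      (forall f, smooth2 f -> periodic_x f ->
         (exists d, 0 < d /\ forall x y, lam - d <= y -> f x y = 0) ->
         dint lam (fun s t => pdy f s t * G s t + pdx f s t * phi b1 b2 (G s t))
         + \int[@lebesgue_measure R]_(s in `[0, 1[) (G s 0 * f s 0) = 0) /\
      (forall f (c : R), smooth2 f -> periodic_x f ->
         (forall x y, 0 <= f x y) -> 0 <= c <= 1 ->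
         0 <= dint lam (fun s t => pdy f s t * `|G s t - c|
                                  + pdx f s t * `|phi b1 b2 (G s t) - phi b1 b2 c|)
              + \int[@lebesgue_measure R]_(s in `[0, 1[) (`|G s 0 - c| * f s 0)).

(* An arrow assignment: e.1 (x, y) (y = 0..L) is the vertical edge from
   (x,y) to (x,y+1), i.e. eta_y(x); e.2 (x, k) (k = 0..L-1) is the
   horizontal edge from (x, k+1) to (x+1 mod N, k+1). *)
Definition ens (N L : nat) : finType :=
  ({ffun 'I_N * 'I_L.+1 -> bool} * {ffun 'I_N * 'I_L -> bool})%type.

Definition vweight {R : realType} (b1 b2 : R) (i1 j1 i2 j2 : bool) : R :=
  match i1, j1, i2, j2 with
  | true,  false, true,  false => b1
  | false, true,  false, true  => b2
  | true,  false, false, true  => 1 - b1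
  | false, true,  true,  false => 1 - b2
  | false, false, false, false => 1
  | true,  true,  true,  true  => 1
  | _, _, _, _ => 0
  end.

Definition conserve (i1 j1 i2 j2 : bool) : bool := (i1 + j1 == i2 + j2)%N.

(* row index of the vertex row k (i.e. y = k+1): incoming vertical edge
   is eta_{k}, outgoing is eta_{k+1} *)
Definition row_in {L : nat} (k : 'I_L) : 'I_L.+1 := widen_ord (leqnSn L) k.
Definition row_out {L : nat} (k : 'I_L) : 'I_L.+1 := lift ord0 k.

Definition is_ensemble {N L : nat} (psi : nat -> bool) (e : ens N L) : bool :=
  [forall x : 'I_N, e.1 (x, ord0) == psi x] &&
  [forall x : 'I_N, forall k : 'I_L,
     conserve (e.1 (x, row_in k)) (e.2 (ord_pred x, k))
              (e.1 (x, row_out k)) (e.2 (x, k))].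

Definition ens_weight {R : realType} (b1 b2 : R) {N L : nat} (e : ens N L) : R :=
  \prod_(x : 'I_N) \prod_(k : 'I_L)
     vweight b1 b2 (e.1 (x, row_in k)) (e.2 (ord_pred x, k))
                   (e.1 (x, row_out k)) (e.2 (x, k)).

Definition sv_prob {R : realType} (b1 b2 : R) (N L : nat) (psi : nat -> bool)
    (E : pred (ens N L)) : R :=
  (\sum_(e : ens N L | is_ensemble psi e && E e) ens_weight b1 b2 e)
  / (\sum_(e : ens N L | is_ensemble psi e) ens_weight b1 b2 e).

Definition rect_dev {R : realType} {N L : nat} (G : R -> R -> R) (e : ens N L)
    (X1 X2 Y1 Y2 : nat) : R :=
  (N%:R ^+ 2)^-1 * (\sum_(y : 'I_L.+1 | (Y1 <= y <= Y2)%N)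
                      \sum_(x : 'I_N | (X1 <= x <= X2)%N) ((e.1 (x, y) : nat)%:R : R))
  - \int[@lebesgue_measure R]_(t in `[(Y1%:R / N%:R : R), Y2%:R / N%:R])
      \int[@lebesgue_measure R]_(s in `[(X1%:R / N%:R : R), X2%:R / N%:R]) G s t.

Definition dev_event {R : realType} (N L : nat) (G : R -> R -> R) (eps : R) :
    pred (ens N L) :=
  fun e => [exists X1 : 'I_N, exists X2 : 'I_N,
            exists Y1 : 'I_L.+1, exists Y2 : 'I_L.+1,
              [&& (X1 <= X2)%N, (Y1 <= Y2)%N & eps < `|rect_dev G e X1 X2 Y1 Y2|]].

Definition boundary_converges {R : realType} (Psi : R -> R)
    (psi : nat -> nat -> bool) : Prop :=
  forall delta : R, 0 < delta -> exists N0 : nat, forall N : nat, (N0 <= N)%N ->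
    forall x1 x2 : R, 0 <= x1 -> x1 <= x2 -> x2 <= 1 ->
      `| (N%:R)^-1 * (\sum_(Num.truncn (x1 * N%:R) <= j < (Num.truncn (x2 * N%:R)).+1)
                        ((psi N (j %% N)%N : nat)%:R : R))
         - \int[@lebesgue_measure R]_(x in `[x1, x2]) Psi x | <= delta.

Arguments sv_prob {R} b1 b2 N L psi E.
Arguments dev_event {R} N L G eps.

(* Main.v *)
Require Import Defs.
From HB Require Import structures.
From mathcomp Require Import all_boot all_order all_algebra.
From mathcomp Require Import all_classical all_reals all_analysis.
From mathcomp Require Import measurable_realfun.
From mathcomp Require Import ring lra zify.
Set Implicit Arguments. Unset Strict Implicit. Unset Printing Implicit Defensive.
Import Order.TTheory GRing.Theory Num.Theory numFieldNormedType.Exports.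
Local Open Scope classical_set_scope.
Local Open Scope ring_scope.

(* Every vertex carries two independent coins, which decide where a lone arrow
   goes; the ensemble is a deterministic function of the coins, up to an event
   whose probability is exponentially small in N.  The coupling of two boundary
   data through the same coins is attractive.  In a window of width W = M T above
   T consecutive rows, comparison with the stationary Bernoulli boundary data
   (density rho below, phi(rho) on the left, the same phi(rho) on the right)
   yields, for every rho and outside an exponentially small event, some r <= W
   such that the height function obeys
     h(t + T, X) <= h(t, X - r) + rho r - phi(rho) T + 3 a,
   and the reverse inequality for some other r: a discrete Hamilton-Jacobi
   equation in Lax-Oleinik form.

   Doubling the variables with a C^{1,1} penalty compares these heights with the
   monotone upwind scheme for G, with an error that vanishes as N, then the time
   step, then the mesh go to their limits.  Kuznetsov's argument compares the
   scheme with the entropy solution in L^1: the Kruzkov inequality is sliced in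
   time by logistic test functions and localised in space by the trigonometric
   mollifier c cos^(2 M)(pi x).  The heights at all times then converge
   uniformly, and the rectangle sums follow by a Riemann sum in time. *)

(** * Coins and currents in a rectangle *)

(** Local equilibrium is never established. Stationary Bernoulli data act only as a barrier, and
    above an arbitrary row all that survives is an inequality with an uncontrolled shift r. This is
    why variables are doubled: the density is taken to be the slope of the penalty at the pair of
    points considered, and then the first-order terms in r cancel whatever r is. Since that slope
    varies, the inequalities are needed for all densities at once, which exponential tails allow.
    Two obstacles shape the microscopic part. Discrepancies of opposite sign can pass through each
    other instead of annihilating, so currents above different rows are compared in exponential
    mean. And the horizontal arrows of a row close up around the ring: the coins need not determine
    the ensemble, and the left side of a window depends on the coins inside it, so it is replaced by
    the empty or the full column and shown not to be felt on the right. The upwind scheme is the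
    meeting point of two theories: its heights obey a monotone scheme for the Hamilton-Jacobi
    equation, its slopes a discrete Kruzkov inequality. *)

Record is_expect (R : realType) (X : Type) (ev : (X -> R) -> R) : Prop := {
  evD : forall f g, ev (fun x => f x + g x) = ev f + ev g;
  evZ : forall k f, ev (fun x => k * f x) = k * ev f;
  ev_le : forall f g, (forall x, f x <= g x) -> ev f <= ev g;
  ev1 : ev (fun=> 1) = 1 }.

Section Expectation.
Variables (R : realType) (X : Type) (ev : (X -> R) -> R).
Hypothesis evP : is_expect ev.

Lemma ev_cst k : ev (fun=> k) = k.
Proof.
by rewrite -[RHS]mulr1 -(ev1 evP) -(evZ evP); congr ev; apply/funext=> x; rewrite mulr1.
Qed.

Lemma ev_ge0 f : (forall x, 0 <= f x) -> 0 <= ev f.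
Proof. by move=> f0; rewrite -(ev_cst 0); exact: (ev_le evP). Qed.

End Expectation.

Fixpoint EL (R : realType) (X : Type) (ev : (X -> R) -> R) (n : nat)
    (F : seq X -> R) : R :=
  if n is n'.+1 then ev (fun x => EL ev n' (fun s => F (x :: s))) else F [::].

Section IidExpectation.
Variables (R : realType) (X : Type) (ev : (X -> R) -> R).
Hypothesis evP : is_expect ev.

Lemma EL_expect n : is_expect (EL ev n).
Proof.
elim: n => [|n IH]; first by split=> //= f g; apply.
split=> [f g|k f|f g fg|] /=.
- rewrite -(evD evP); congr ev; apply/funext=> x; exact: (evD IH).
- rewrite -(evZ evP); congr ev; apply/funext=> x; exact: (evZ IH).
- by apply: (ev_le evP) => x; apply: (ev_le IH).
- rewrite -[RHS](ev1 evP); congr ev; apply/funext=> x; exact: (ev1 IH).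
Qed.

Lemma EL_le_size n F G : (forall s, size s = n -> F s <= G s) ->
  EL ev n F <= EL ev n G.
Proof.
elim: n F G => [|n IH] F G FG /=; first exact: FG.
by apply: (ev_le evP) => x; apply: IH => s sn; apply: FG; rewrite /= sn.
Qed.

Lemma EL_le_size2 W T F G :
  (forall cs, size cs = T -> all (fun c => size c == W) cs -> F cs <= G cs) ->
  EL (EL ev W) T F <= EL (EL ev W) T G.
Proof.
elim: T F G => [|T IH] F G FG /=; first exact: FG.
apply: EL_le_size => c sc; apply: IH => cs scs acs.
by apply: FG; rewrite /= ?scs ?sc ?eqxx.
Qed.

End IidExpectation.

(** Fubini. Expectations are bare positive linear functionals here, so the exchange of two of them
    has to be proved; for coins it follows from linearity alone. *)
Definition ev_commute (R : realType) (X Y : Type) (ev : (X -> R) -> R)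
    (ev' : (Y -> R) -> R) :=
  forall F, ev (fun x => ev' (fun y => F x y)) = ev' (fun y => ev (fun x => F x y)).

Lemma EL_commute (R : realType) (X Y : Type) (ev : (X -> R) -> R)
    (ev' : (Y -> R) -> R) n :
  ev_commute ev ev' -> ev_commute (EL ev n) ev'.
Proof.
move=> C; elim: n => [//|n IH] F /=.
by rewrite -C; congr ev; apply/funext=> x; rewrite IH.
Qed.

Definition EB (R : realType) (p : R) (f : bool -> R) : R :=
  p * f true + (1 - p) * f false.

Lemma EB_expect (R : realType) (p : R) : 0 <= p <= 1 -> is_expect (EB p).
Proof.
move=> /andP[p0 p1]; rewrite /EB; split=> [f g|k f|f g fg|].
- by ring.
- by ring.
- by apply: lerD; apply: ler_wpM2l; rewrite ?subr_ge0.
- by ring.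
Qed.

Lemma EB_commute (R : realType) (p : R) (Y : Type) (ev : (Y -> R) -> R) :
  is_expect ev -> ev_commute (EB p) ev.
Proof. by move=> evP F; rewrite /EB (evD evP) !(evZ evP). Qed.

Definition coin := (bool * bool)%type.

Definition EC (R : realType) (b1 b2 : R) (f : coin -> R) : R :=
  EB b1 (fun a => EB b2 (fun b => f (a, b))).

(* The first component of a coin decides whether a lone vertical arrow
   continues upwards, the second whether a lone horizontal arrow continues to
   the right; the result is (vertical output, horizontal output). *)
Definition vout (c : coin) (i j : bool) : bool * bool :=
  if i then (if j then (true, true) else (c.1, ~~ c.1))
  else (if j then (~~ c.2, c.2) else (false, false)).

Lemma vout_conserve c i j :
  ((vout c i j).1 + (vout c i j).2 = i + j :> nat)%N.
Proof. by case: c i j => [[] []] [] []. Qed.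

(** Attractiveness at one vertex: a lone arrow can only go where the full vertex [(true, true)] has
    arrows anyway. *)
Lemma vout_mono c i j i' j' : (i ==> i') -> (j ==> j') ->
  ((vout c i j).1 ==> (vout c i' j').1) && ((vout c i j).2 ==> (vout c i' j').2).
Proof. by case: c i j i' j' => [[] []] [] [] [] []. Qed.

Section CoinExpectation.
Variables (R : realType) (b1 b2 : R).
Hypotheses (b1_01 : 0 <= b1 <= 1) (b2_01 : 0 <= b2 <= 1).

Lemma EC_expect : is_expect (EC b1 b2).
Proof.
have E1 := EB_expect b1_01; have E2 := EB_expect b2_01.
split=> [f g|k f|f g fg|]; rewrite /EC.
- by rewrite /EB; ring.
- by rewrite /EB; ring.
- by apply: (ev_le E1) => a; apply: (ev_le E2) => b.
- by rewrite /EB; ring.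
Qed.

Lemma EC_commute (Y : Type) (ev : (Y -> R) -> R) :
  is_expect ev -> ev_commute (EC b1 b2) ev.
Proof.
move=> evP F; rewrite /EC.
transitivity (EB b1 (fun a => ev (fun y => EB b2 (fun b => F (a, b) y)))).
  by congr (EB _ _); apply/funext => a; rewrite EB_commute.
by rewrite EB_commute.
Qed.

End CoinExpectation.

Fixpoint rowrun (c : seq coin) (bot : seq bool) (j : bool) : seq bool * bool :=
  match c, bot with
  | ab :: c', i :: bot' =>
      ((vout ab i j).1 :: (rowrun c' bot' (vout ab i j).2).1,
       (rowrun c' bot' (vout ab i j).2).2)
  | _, _ => ([::], j)
  end.

(** Rows are read from bottom to top. The results are the arrows leaving through the top and those
    leaving through the right side. *)
Fixpoint rect (cs : seq (seq coin)) (bot ls : seq bool) : seq bool * seq bool :=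
  match cs, ls with
  | c :: cs', l :: ls' =>
      ((rect cs' (rowrun c bot l).1 ls').1,
       (rowrun c bot l).2 :: (rect cs' (rowrun c bot l).1 ls').2)
  | _, _ => (bot, [::])
  end.

Definition lebs (s t : seq bool) := all2 implb s t.
Definition cnt (s : seq bool) := count id s.

Lemma lebs_refl s : lebs s s.
Proof. by elim: s => //= a s ->; rewrite implybb. Qed.

Lemma lebs_cnt s t : lebs s t -> (cnt s <= cnt t)%N.
Proof.
rewrite /cnt; elim: s t => [|a s IH] [|b t] //= /andP[ab /IH].
by apply: leq_add; case: a b ab => [] [].
Qed.

Lemma size_rowrun c bot j : size c = size bot -> size (rowrun c bot j).1 = size c.
Proof. by elim: c bot j => [|a c IH] [|i bot] j //= [/IH ->]. Qed.

Lemma cnt_rowrun c bot j : size c = size bot ->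
  (cnt (rowrun c bot j).1 + (rowrun c bot j).2 = cnt bot + j)%N.
Proof.
elim: c bot j => [|a c IH] [|i bot] j //= [sz]; have := IH bot (vout a i j).2 sz.
by have := vout_conserve a i j; rewrite /cnt /=; lia.
Qed.

Lemma rowrun_mono c bot bot' j j' : lebs bot bot' -> j ==> j' ->
  lebs (rowrun c bot j).1 (rowrun c bot' j').1 /\
  (rowrun c bot j).2 ==> (rowrun c bot' j').2.
Proof.
elim: c bot bot' j j' => [|a c IH] [|i bot] [|i' bot'] j j' //=.
rewrite /lebs /= => /andP[ii bb] jj.
have /andP[v1 v2] := vout_mono a ii jj.
by have [l1 l2] := IH _ _ _ _ bb v2; rewrite v1 l2; split.
Qed.

Lemma size_rect n cs bot ls : size cs = size ls ->
  size bot = n -> all (fun c => size c == n) cs ->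
  size (rect cs bot ls).1 = n.
Proof.
elim: cs bot ls => [|c cs IH] bot [|l ls] //= [sl] bn /andP[/eqP cn csn].
by apply: IH => //; rewrite size_rowrun // cn.
Qed.

Lemma cnt_rect n cs bot ls : size cs = size ls ->
  size bot = n -> all (fun c => size c == n) cs ->
  (cnt (rect cs bot ls).1 + cnt (rect cs bot ls).2 = cnt bot + cnt ls)%N.
Proof.
elim: cs bot ls => [|c cs IH] bot [|l ls] //=.
move=> [sl] bn /andP[/eqP cn csn].
have := IH (rowrun c bot l).1 ls sl _ csn; rewrite size_rowrun ?cn // => /(_ erefl).
by have := @cnt_rowrun c bot l; rewrite cn bn /cnt /= => /(_ erefl); lia.
Qed.

Lemma rect_mono cs bot bot' ls ls' : lebs bot bot' -> lebs ls ls' ->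
  lebs (rect cs bot ls).2 (rect cs bot' ls').2.
Proof.
elim: cs bot bot' ls ls' => [|c cs IH] bot bot' [|l ls] [|l' ls'] //=.
rewrite /lebs /= => bb /andP[ll lls].
by have [r1 r2] := rowrun_mono c bb ll; rewrite r2 /=; apply: IH.
Qed.

(** * An exponential functional of the discrepancies *)

Section Lyapunov.
Variables (R : realType) (b1 b2 : R).
Hypotheses (b1_gt0 : 0 < b1) (b1_lt1 : b1 < 1) (b2_gt0 : 0 < b2) (b2_lt1 : b2 < 1).

Let b1_01 : 0 <= b1 <= 1. Proof. by rewrite !ltW. Qed.
Let b2_01 : 0 <= b2 <= 1. Proof. by rewrite !ltW. Qed.
Let ECP := EC_expect b1_01 b2_01.
Let ELP n := EL_expect ECP n.
Let ELLP n m := EL_expect (ELP n) m.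

(* Two + and - discrepancies meeting at a vertex cross each other with
   probability at most b1 b2; this base makes the crossings harmless on average. *)
Definition Lbase : R := b1^-1 + b2^-1 - 1.

Lemma Lbase_gt1 : 1 < Lbase.
Proof.
have i1 : 1 < b1^-1 by rewrite invf_gt1.
have i2 : 1 < b2^-1 by rewrite invf_gt1.
by rewrite /Lbase; lra.
Qed.

Let E_gt0 : 0 < Lbase. Proof. exact: lt_trans ltr01 Lbase_gt1. Qed.

(** Each plus discrepancy (arrow in [eta], none in [xi]) is weighted by [w] times [Lbase] to the
    power of the height difference accumulated to its left. Minus discrepancies act only through
    that exponent. *)
Fixpoint Vp (w : R) (eta xi : seq bool) : R :=
  match eta, xi with
  | i :: eta', k :: xi' =>
      (if i && ~~ k then w else 0) + Vp (w * Lbase ^+ i / Lbase ^+ k) eta' xi'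
  | _, _ => 0
  end.

Lemma Vp_rcons w eta xi j k : size eta = size xi -> 0 <= w ->
  Vp w eta xi <= Vp w (rcons eta j) (rcons xi k).
Proof.
elim: eta xi w => [|i eta IH] [|l xi] w //= => [_ w0|[s] w0].
  by rewrite addr0; case: ifP.
by rewrite lerD2l; apply: IH => //; rewrite !mulr_ge0 ?invr_ge0 ?exprn_ge0 // ltW.
Qed.

(** Read from left to right, the exponential of the height difference is multiplied by [Lbase] at a
    plus discrepancy and divided by it at a minus one. The increments at plus discrepancies add up
    to [(Lbase - 1) * Vp]; the decreases are discarded. *)
Lemma Vp_end w eta xi : size eta = size xi -> 0 <= w ->
  w * Lbase ^+ cnt eta / Lbase ^+ cnt xi <= w + (Lbase - 1) * Vp w eta xi.
Proof.
rewrite /cnt; elim: eta xi w => [|i eta IH] [|k xi] w //=.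
  by move=> _ _; rewrite !expr0 mulr1 divr1 mulr0 addr0.
move=> [s] w0.
set w' := w * Lbase ^+ i / Lbase ^+ k.
have w'0 : 0 <= w' by rewrite !mulr_ge0 ?invr_ge0 ?exprn_ge0 // ltW.
have := IH xi w' s w'0.
have -> : w' * Lbase ^+ count id eta / Lbase ^+ count id xi =
  w * Lbase ^+ (i + count id eta) / Lbase ^+ (k + count id xi).
  rewrite /w' !exprD; field.
  by rewrite !expf_neq0 // gt_eqF.
move=> H; apply: (le_trans H).
rewrite mulrDr addrA lerD2r /w' => {H w'0 IH w'}.
case: i k => [] [] /=; rewrite ?expr1 ?expr0 ?mulr1 ?divr1 ?mulr0 ?addr0 ?mulfK ?gt_eqF //.
- by lra.
- by rewrite ler_pdivrMr // ler_peMr // ltW // Lbase_gt1.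
Qed.

(** Along a down-right lattice path the left edge precedes the bottom edge of a vertex, and after
    the path is pushed over the vertex the top edge precedes the right edge. Hence the orders
    [[:: j; i]] and output [.1], [.2]: the functional is a supermartingale under such pushes. *)
Lemma Vp_vertex w i i' j j' : 0 < w ->
  EC b1 b2 (fun c => Vp w [:: (vout c i j).1; (vout c i j).2]
                          [:: (vout c i' j').1; (vout c i' j').2])
  <= Vp w [:: j; i] [:: j'; i'].
Proof.
move=> w0; rewrite /EC /EB.
have p1 : w / Lbase <= w by rewrite ler_pdivrMr // ler_peMr ?ltW // Lbase_gt1.
have h1 : b1 * b2 * Lbase = b1 + b2 - b1 * b2.
  by rewrite /Lbase; field; rewrite !gt_eqF.
have wE : w = Lbase * (w / Lbase) by field; rewrite gt_eqF.
case: i i' j j' => [] [] [] [] /=;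
  rewrite ?expr1 ?expr0 ?mulr1 ?divr1 ?mulr0 ?addr0 ?add0r ?mulfK ?gt_eqF //; try by lra.
(* The case that dictates [Lbase]: a plus from below meets a minus from the left. Crossing, of
   probability b1 b2, raises the weight from [v] to [w]; keeping their order, of probability (1 -
   b1)(1 - b2), leaves it at [v]; otherwise they annihilate. By [h1] this balances with equality. *)
- set v := w / Lbase in wE p1 *.
  have v0 : 0 < v by rewrite divr_gt0.
  have : b1 * b2 * w = (b1 + b2 - b1 * b2) * v by rewrite {1}wE mulrA h1.
  by nra.
- set v := w / Lbase in wE p1 *.
  have v0 : 0 < v by rewrite divr_gt0.
  have : b1 * b2 * v <= b1 * b2 * w by apply: ler_wpM2l => //; rewrite mulr_ge0 // ltW.
  have : 0 <= b1 * (1 - b2) * w by rewrite !mulr_ge0 // ?subr_ge0 // ltW.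
  have : 0 <= (1 - b1) * b2 * w by rewrite !mulr_ge0 // ?subr_ge0 // ltW.
  by nra.
Qed.

Lemma Vp_cat2 w s s' t t' : size s = size s' -> 0 < w ->
  Vp w (s ++ t) (s' ++ t') =
  Vp w s s' + Vp (w * Lbase ^+ cnt s / Lbase ^+ cnt s') t t'.
Proof.
rewrite /cnt; elim: s s' w => [|i s IH] [|k s'] w //=.
  by move=> _ _; rewrite !expr0 mulr1 divr1 add0r.
move=> [ss] w0; rewrite IH //; last by rewrite divr_gt0 ?mulr_gt0 ?exprn_gt0.
rewrite addrA; congr (_ + Vp _ _ _).
by rewrite !exprD; field; rewrite !expf_neq0 // gt_eqF.
Qed.

Lemma Vp_row W w bot bot' j j' : size bot = W -> size bot' = W -> 0 < w ->
  EL (EC b1 b2) W (fun c =>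
    Vp w (rcons (rowrun c bot j).1 (rowrun c bot j).2)
         (rcons (rowrun c bot' j').1 (rowrun c bot' j').2))
  <= Vp w (j :: bot) (j' :: bot').
Proof.
elim: W bot bot' j j' w => [|W IH] [|i bot] [|i' bot'] j j' w //= [sb] [sb'] w0.
apply: (@le_trans _ _ (EC b1 b2 (fun c =>
   (if (vout c i j).1 && ~~ (vout c i' j').1 then w else 0) +
   Vp (w * Lbase ^+ (vout c i j).1 / Lbase ^+ (vout c i' j').1)
      ((vout c i j).2 :: bot) ((vout c i' j').2 :: bot')))).
  apply: (ev_le ECP) => c.
  rewrite (evD (ELP W)) (ev_cst (ELP W)) lerD2l.
  by apply: IH => //; rewrite divr_gt0 ?mulr_gt0 ?exprn_gt0.
have cat2 (a b : bool) s : a :: b :: s = [:: a; b] ++ s by [].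
rewrite -[X in _ <= X]/(Vp w ([:: j; i] ++ bot) ([:: j'; i'] ++ bot')).
rewrite Vp_cat2 //.
have -> : (fun c => (if (vout c i j).1 && ~~ (vout c i' j').1 then w else 0) +
   Vp (w * Lbase ^+ (vout c i j).1 / Lbase ^+ (vout c i' j').1)
      ((vout c i j).2 :: bot) ((vout c i' j').2 :: bot')) =
  (fun c => Vp w [:: (vout c i j).1; (vout c i j).2]
                 [:: (vout c i' j').1; (vout c i' j').2] +
     Vp (w * Lbase ^+ cnt [:: j; i] / Lbase ^+ cnt [:: j'; i']) bot bot').
  apply/funext => c.
  transitivity (Vp w ([:: (vout c i j).1; (vout c i j).2] ++ bot)
                     ([:: (vout c i' j').1; (vout c i' j').2] ++ bot')) => //.
  rewrite Vp_cat2 // /cnt /= !addn0 !vout_conserve.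
  by rewrite (addnC i) (addnC i').
by rewrite (evD ECP) (ev_cst ECP) lerD2r; exact: Vp_vertex.
Qed.

(** Both copies receive the same arrows on the left, so these contribute neither a discrepancy nor a
    change of exponent; forgetting the right outputs removes nonnegative terms. *)
Lemma Vp_rect W T w bot bot' ls : size bot = W -> size bot' = W ->
  size ls = T -> 0 < w ->
  EL (EL (EC b1 b2) W) T (fun cs => Vp w (rect cs bot ls).1 (rect cs bot' ls).1)
  <= Vp w bot bot'.
Proof.
move=> + + + w0; elim: T bot bot' ls => [|T IH] bot bot' [|l ls] //= sb sb' [sl].
apply: (@le_trans _ _ (EL (EC b1 b2) W (fun c =>
    Vp w (rowrun c bot l).1 (rowrun c bot' l).1))).
  by apply: (EL_le_size ECP) => c sc; apply: IH => //; rewrite size_rowrun ?sb ?sb'.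
apply: (@le_trans _ _ (EL (EC b1 b2) W (fun c =>
    Vp w (rcons (rowrun c bot l).1 (rowrun c bot l).2)
         (rcons (rowrun c bot' l).1 (rowrun c bot' l).2)))).
  apply: (EL_le_size ECP) => c sc; apply: Vp_rcons; last exact: ltW.
  by rewrite !size_rowrun ?sb ?sb'.
apply: (le_trans (Vp_row l l sb sb' w0)) => /=.
by rewrite andbN add0r mulfK // expf_neq0 // gt_eqF.
Qed.

Lemma Vp_le_level Q w s s' : size s = size s' ->
  (forall k, (k < size s)%N ->
     w * Lbase ^+ cnt (take k s) / Lbase ^+ cnt (take k s') <= Q) ->
  0 <= Q -> Vp w s s' <= (size s)%:R * Q.
Proof.
move=> + + Q0; rewrite /cnt.
elim: s s' w => [|i s IH] [|k s'] w //=; first by rewrite mul0r.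
move=> [ss] H; rewrite -natr1 addrC mulrDl mul1r.
apply: lerD; last first.
  by have := H 0 isT; rewrite /= !expr0 mulr1 divr1; case: ifP.
apply: IH => // n ns; apply: le_trans (H n.+1 ns); rewrite /= !exprD le_eqVlt.
apply/orP; left; apply/eqP; field.
by rewrite !expf_neq0 // gt_eqF.
Qed.

(** With common left data, conservation rewrites the difference of right currents as a difference of
    bottom counts minus one of top counts. Starting the functional at the weight [w] of the full
    bottom rows makes the left side of [Vp_end] at the top equal to this ratio, and [Q] bounds the
    weight of every initial discrepancy. *)
Lemma current_comparison W T bot bot' ls Q : size bot = W -> size bot' = W ->
  size ls = T ->
  (forall k, (k <= W)%N ->
     Lbase ^+ cnt (drop k bot') / Lbase ^+ cnt (drop k bot) <= Q) ->
  EL (EL (EC b1 b2) W) T (fun cs =>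
    Lbase ^+ cnt (rect cs bot' ls).2 / Lbase ^+ cnt (rect cs bot ls).2)
  <= Q * (1 + (Lbase - 1) * W%:R).
Proof.
move=> sb sb' sl HQ.
set w := Lbase ^+ cnt bot' / Lbase ^+ cnt bot.
have w0 : 0 < w by rewrite divr_gt0 ?exprn_gt0.
have wQ : w <= Q by have := HQ 0 isT; rewrite !drop0.
have Q0 : 0 <= Q by apply: le_trans (ltW w0) wQ.
have E10 : 0 <= Lbase - 1 by rewrite subr_ge0 ltW // Lbase_gt1.
apply: (@le_trans _ _ (EL (EL (EC b1 b2) W) T (fun cs =>
   w + (Lbase - 1) * Vp w (rect cs bot ls).1 (rect cs bot' ls).1))).
  apply: (EL_le_size2 ECP) => cs scs aW.
    have cc := cnt_rect (etrans scs (esym sl)) sb aW.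
    have cc' := cnt_rect (etrans scs (esym sl)) sb' aW.
    have sz := size_rect (etrans scs (esym sl)) sb aW.
    have sz' := size_rect (etrans scs (esym sl)) sb' aW.
    have := Vp_end (etrans sz (esym sz')) (ltW w0).
    apply: le_trans.
    rewrite le_eqVlt; apply/orP; left; apply/eqP.
    have EE n : Lbase ^+ n != 0 by rewrite expf_neq0 // gt_eqF.
    rewrite /w; apply: (mulIf (EE (cnt (rect cs bot ls).2))).
    apply: (mulIf (EE (cnt (rect cs bot' ls).1))).
    apply: (mulIf (EE (cnt bot))).
    rewrite divfK ?EE //.
    have -> : Lbase ^+ cnt bot' / Lbase ^+ cnt bot * Lbase ^+ cnt (rect cs bot ls).1 /
     Lbase ^+ cnt (rect cs bot' ls).1 * Lbase ^+ cnt (rect cs bot ls).2 *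
     Lbase ^+ cnt (rect cs bot' ls).1 * Lbase ^+ cnt bot = 
     Lbase ^+ cnt bot' * Lbase ^+ cnt (rect cs bot ls).1 * Lbase ^+ cnt (rect cs bot ls).2.
      by field; rewrite !EE.
    by rewrite -!exprD; congr (_ ^+ _); clear -cc cc'; lia.
rewrite (evD (ELLP W T)) (ev_cst (ELLP W T)) (evZ (ELLP W T)).
rewrite mulrDr mulr1; apply: lerD => //.
rewrite mulrCA; apply: ler_wpM2l => //.
apply: (le_trans (Vp_rect sb sb' sl w0)).
rewrite mulrC -sb; apply: Vp_le_level => //; first by rewrite sb.
move=> k ks; apply: le_trans (HQ k _); last by rewrite -sb ltnW.
have EE n : Lbase ^+ n != 0 by rewrite expf_neq0 // gt_eqF.
have dec (t : seq bool) : cnt t = (cnt (take k t) + cnt (drop k t))%N.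
  by rewrite /cnt -count_cat cat_take_drop.
rewrite /w (dec bot) (dec bot') !exprD le_eqVlt; apply/orP; left; apply/eqP.
by field; rewrite !EE.
Qed.

End Lyapunov.

(** * Finite speed of propagation *)

Section Speed.
Variables (R : realType) (b1 b2 : R).
Hypotheses (b1_gt0 : 0 < b1) (b1_lt1 : b1 < 1) (b2_gt0 : 0 < b2) (b2_lt1 : b2 < 1)
  (b1_lt_b2 : b1 < b2).

Let b1_01 : 0 <= b1 <= 1. Proof. by rewrite !ltW. Qed.
Let b2_01 : 0 <= b2 <= 1. Proof. by rewrite !ltW. Qed.
Let ECP := EC_expect b1_01 b2_01.
Let ELP n := EL_expect ECP n.
Let ELLP n m := EL_expect (ELP n) m.

(* Each site crossed by a discrepancy costs a factor at most b2, hence the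
   geometric weight Zsp ^ position of the discrepancies grows by at most the
   factor Lsp per row. *)
Definition Zsp : R := (1 + b2^-1) / 2.
Definition Csp : R := (1 - Zsp * b2)^-1.
Definition Lsp : R := 1 + Zsp * Csp.

Lemma Zsp_gt1 : 1 < Zsp.
Proof. by have : 1 < b2^-1; [rewrite invf_gt1|rewrite /Zsp; lra]. Qed.

Lemma Zsp_b2 : 1 - Zsp * b2 = (1 - b2) / 2.
Proof. by rewrite /Zsp; field; rewrite gt_eqF. Qed.

Lemma Csp_ge1 : 1 <= Csp.
Proof. have q : 0 < (1 - b2) / 2 by rewrite divr_gt0 // subr_gt0.
by rewrite /Csp Zsp_b2 invf_ge1 //; have := b2_gt0 => ?; lra. Qed.

(** [Csp] is the price of a discrepancy moving to the right: it turns upwards at cost at most 1, or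
    continues with probability at most b2 and is then charged [Zsp * Csp] at the next site. *)
Lemma CspE : 1 + Zsp * Csp * b2 = Csp.
Proof.
have q0 : 1 - Zsp * b2 != 0.
  by rewrite Zsp_b2 gt_eqF // divr_gt0 // subr_gt0.
have : Csp * (1 - Zsp * b2) = 1 by rewrite /Csp mulVf.
by move=> {1}<-; ring.
Qed.

Fixpoint Ub (s t : seq bool) : R :=
  match s, t with
  | i :: s', k :: t' => (i != k)%:R + Zsp * Ub s' t'
  | _, _ => 0
  end.

Lemma Ub_refl s : Ub s s = 0.
Proof. by elim: s => //= i s ->; rewrite eqxx mulr0 addr0. Qed.

Lemma Ub_ge0 s t : 0 <= Ub s t.
Proof.
have Z0 := ltW (lt_trans ltr01 Zsp_gt1).
by elim: s t => [|i s IH] [|k t] //=; rewrite addr_ge0 // mulr_ge0.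
Qed.

(** The copies are ordered, so all discrepancies have the same sign. One coming from below ends on
    top, at cost 1, or on the right, at cost [Zsp * Csp]; [Lsp] is the sum of both costs. *)
Lemma Ub_vertex i i' j j' : i ==> i' -> j ==> j' ->
  EC b1 b2 (fun c => ((vout c i j).1 != (vout c i' j').1)%:R
     + Zsp * Csp * ((vout c i j).2 != (vout c i' j').2)%:R)
  <= Lsp * (i != i')%:R + Csp * (j != j')%:R.
Proof.
have C1 := Csp_ge1; have Z1 := Zsp_gt1; have CE := CspE.
rewrite /EC /EB /Lsp => ii jj.
have ZC1 : 1 <= Zsp * Csp by rewrite mulr_ege1 // ltW.
have b1p := b1_gt0; have b1q := b1_lt1; have b2p := b2_gt0; have b2q := b2_lt1; have b12 := b1_lt_b2.
set q := Zsp * Csp in CE ZC1 *.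
case: i i' j j' ii jj => [] [] [] [] //= _ _;
  rewrite ?mulr1 ?mulr0 ?addr0 ?add0r; try by lra.
(* At a site occupied from below in both copies, the horizontal discrepancy continues with
   probability b1 instead of b2; here b1 < b2 enters. *)
- have : b1 * q <= b2 * q by rewrite ler_wpM2r ?ltW //; lra.
  by lra.
- have : 0 <= b1 * q by rewrite mulr_ge0 ?ltW //; lra.
  by lra.
Qed.

Lemma Ub_row W bot bot' j j' : size bot = W -> size bot' = W ->
  lebs bot bot' -> j ==> j' ->
  EL (EC b1 b2) W (fun c => Ub (rowrun c bot j).1 (rowrun c bot' j').1 +
    Csp * Zsp ^+ W * ((rowrun c bot j).2 != (rowrun c bot' j').2)%:R)
  <= Lsp * Ub bot bot' + Csp * (j != j')%:R.
Proof.
elim: W bot bot' j j' => [|W IH] [|i bot] [|i' bot'] j j' //=.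
  by move=> _ _ _ _; rewrite add0r mulr0 add0r expr0 mulr1.
move=> [sb] [sb']; rewrite /lebs /= => /andP[ii bb] jj.
have Z0 := ltW (lt_trans ltr01 Zsp_gt1).
apply: (@le_trans _ _ (EC b1 b2 (fun c =>
   ((vout c i j).1 != (vout c i' j').1)%:R + Zsp * (Lsp * Ub bot bot' +
     Csp * ((vout c i j).2 != (vout c i' j').2)%:R)))).
  apply: (ev_le ECP) => c.
  have /andP[v1 v2] := vout_mono c ii jj.
  have := IH bot bot' (vout c i j).2 (vout c i' j').2 sb sb' bb v2.
  move=> /(ler_wpM2l Z0); rewrite -(lerD2l ((vout c i j).1 != (vout c i' j').1)%:R).
  apply: le_trans; rewrite -(evZ (ELP W)).
  set h := _%:R.
  rewrite -[X in _ <= X + _](ev_cst (ELP W) h) -(evD (ELP W)).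
  by apply: (ev_le (ELP W)) => cs; rewrite exprS; lra.
have -> : (fun c => ((vout c i j).1 != (vout c i' j').1)%:R + Zsp * (Lsp * Ub bot bot' +
     Csp * ((vout c i j).2 != (vout c i' j').2)%:R)) = 
  (fun c => ((vout c i j).1 != (vout c i' j').1)%:R +
    Zsp * Csp * ((vout c i j).2 != (vout c i' j').2)%:R + Zsp * (Lsp * Ub bot bot')).
  by apply/funext=> c; ring.
rewrite (evD ECP) (ev_cst ECP).
by have := Ub_vertex ii jj; lra.
Qed.

(** Any difference in the right column weighs at least [Csp * Zsp ^+ W], each row adds at most [Csp]
    through its left input, and the weight grows at most by [Lsp] per row. For W a large multiple of
    T the left column is thus not felt on the right. *)
Lemma Ub_rect W T bot bot' ls ls' : size bot = W -> size bot' = W ->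
  size ls = T -> size ls' = T -> lebs bot bot' -> lebs ls ls' ->
  EL (EL (EC b1 b2) W) T (fun cs =>
    Csp * Zsp ^+ W * ((rect cs bot ls).2 != (rect cs bot' ls').2)%:R)
  <= Lsp ^+ T * (Ub bot bot' + T%:R * Csp).
Proof.
have C1 := Csp_ge1; have Z1 := Zsp_gt1.
have Z0 := ltW (lt_trans ltr01 Zsp_gt1).
have L1 : 1 <= Lsp by rewrite /Lsp lerDl mulr_ge0 //; lra.
elim: T bot bot' ls ls' => [|T IH] bot bot' [|l ls] [|l' ls'] //=.
  by move=> *; rewrite mulr0 expr0 mul1r mul0r addr0 Ub_ge0.
move=> sb sb' [sl] [sl'] bb; rewrite /lebs /= => /andP[ll lls].
set K := Csp * Zsp ^+ W.
have K0 : 0 <= K by rewrite mulr_ge0 ?exprn_ge0 //; lra.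
apply: (@le_trans _ _ (EL (EC b1 b2) W (fun c =>
   Lsp ^+ T * (Ub (rowrun c bot l).1 (rowrun c bot' l').1 +
     K * ((rowrun c bot l).2 != (rowrun c bot' l').2)%:R) + Lsp ^+ T * (T%:R * Csp)))).
  apply: (EL_le_size ECP) => c sc.
  have [r1 r2] := rowrun_mono c bb ll.
  have IHc := IH _ _ ls ls' (etrans (size_rowrun _ (etrans sc (esym sb))) sc)
            (etrans (size_rowrun _ (etrans sc (esym sb'))) sc) sl sl' r1 lls.
  apply: (@le_trans _ _ (EL (EL (EC b1 b2) W) T (fun cs =>
    K * ((rowrun c bot l).2 != (rowrun c bot' l').2)%:R +
    K * ((rect cs (rowrun c bot l).1 ls).2 != (rect cs (rowrun c bot' l').1 ls').2)%:R))).
    apply: (ev_le (ELLP W T)) => cs.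
    rewrite -mulrDr ler_wpM2l // eqseq_cons.
    by case: eqP; case: eqP => //=; lra.
  rewrite (evD (ELLP W T)) (ev_cst (ELLP W T)).
  have LT1 : 1 <= Lsp ^+ T by rewrite exprn_ege1.
  set x := K * _%:R.
  have x0 : 0 <= x by rewrite mulr_ge0.
  have : x <= Lsp ^+ T * x by rewrite ler_peMl.
  by move: IHc; rewrite !mulrDr; lra.
rewrite (evD (ELP W)) (ev_cst (ELP W)) (evZ (ELP W)).
have := Ub_row sb sb' bb ll; rewrite -/K => H.
have LT0 : 0 <= Lsp ^+ T by rewrite exprn_ge0 //; lra.
have := ler_wpM2l LT0 H.
rewrite -natr1 exprS.
have : Csp * (l != l')%:R <= Csp by case: (l != l'); rewrite ?mulr1 ?mulr0; lra.
move=> /(ler_wpM2l LT0).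
have : Lsp ^+ T * (T.+1%:R * Csp) <= Lsp * Lsp ^+ T * (T.+1%:R * Csp).
  by rewrite -mulrA ler_peMl // mulr_ge0 // mulr_ge0 //; lra.
by rewrite -natr1 !mulrDr !mulrDl; lra.
Qed.

End Speed.

(** * Stationary boundary data and concentration *)

Lemma lebs_false n s : size s = n -> lebs (nseq n false) s.
Proof. by elim: n s => [|n IH] [|b s] //= [/IH]. Qed.

Lemma lebs_true n s : size s = n -> lebs s (nseq n true).
Proof. by elim: n s => [|n IH] [|b s] //= [/IH]; rewrite /lebs /= implybT. Qed.

Section Stationarity.
Variables (R : realType) (b1 b2 rho sig : R).
Hypotheses (b1_gt0 : 0 < b1) (b1_lt1 : b1 < 1) (b2_gt0 : 0 < b2) (b2_lt1 : b2 < 1).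
Hypotheses (rho_01 : 0 <= rho <= 1) (sig_01 : 0 <= sig <= 1).
Hypothesis balance : sig * (1 - rho) * (1 - b2) = (1 - sig) * rho * (1 - b1).

Let b1_01 : 0 <= b1 <= 1. Proof. by rewrite !ltW. Qed.
Let b2_01 : 0 <= b2 <= 1. Proof. by rewrite !ltW. Qed.
Let ECP := EC_expect b1_01 b2_01.
Let ErP := EB_expect rho_01.
Let EsP := EB_expect sig_01.

(** Empty and full vertices are left unchanged. The two one-arrow states exchange mass, and the net
    exchange is the difference of the two sides of [balance]. *)
Lemma stationary_vertex (f : bool * bool -> R) :
  EB rho (fun i => EB sig (fun j => EC b1 b2 (fun c => f (vout c i j)))) =
  EB rho (fun i => EB sig (fun j => f (i, j))).
Proof.
rewrite /EC /EB /vout /=.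
set A := f (true, true); set B := f (true, false).
set C := f (false, true); set D := f (false, false).
have := congr1 (fun z => z * (B - C)) balance => bal.
by apply/eqP; rewrite -subr_eq0; apply/eqP; rewrite -[RHS](subrr (sig * (1 - rho) * (1 - b2) * (B - C))) {2}bal; ring.
Qed.

Lemma stationary_row W (F : seq bool * bool -> R) :
  EL (EB rho) W (fun bot => EB sig (fun j =>
    EL (EC b1 b2) W (fun c => F (rowrun c bot j)))) =
  EL (EB rho) W (fun bot => EB sig (fun j => F (bot, j))).
Proof.
elim: W F => [//|W IH] F.
pose f (o : bool * bool) := EL (EB rho) W (fun bot => EL (EC b1 b2) W (fun c =>
   F (o.1 :: (rowrun c bot o.2).1, (rowrun c bot o.2).2))).
transitivity (EB rho (fun i => EB sig (fun j => EC b1 b2 (fun c => f (vout c i j))))).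
  rewrite /f /=; congr (EB _ _); apply/funext => i.
  rewrite -EB_commute; last exact: EL_expect.
  congr (EB _ _); apply/funext => j.
  by rewrite EC_commute //; exact: EL_expect.
rewrite stationary_vertex /f /=; congr (EB _ _); apply/funext => i.
rewrite EB_commute; last exact: EL_expect.
by rewrite -(IH (fun o => F (i :: o.1, o.2))).
Qed.

(** A Burke property: in a stationary rectangle the arrows leaving on the right are again
    independent Bernoulli variables, so their number obeys exponential tail bounds. *)
Lemma stationary_current W T (F : seq bool -> R) :
  EL (EB rho) W (fun bot => EL (EB sig) T (fun ls =>
    EL (EL (EC b1 b2) W) T (fun cs => F (rect cs bot ls).2))) = EL (EB sig) T F.
Proof.
have EsT n : is_expect (EL (EB sig) n) by exact: EL_expect.
have ErW n : is_expect (EL (EB rho) n) by exact: EL_expect.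
elim: T F => [|T IH] F /=; first by rewrite (ev_cst (ErW W)).
pose G (o : seq bool * bool) := EL (EB sig) T (fun ls =>
    EL (EL (EC b1 b2) W) T (fun cs => F (o.2 :: (rect cs o.1 ls).2))).
transitivity (EL (EB rho) W (fun bot => EB sig (fun j =>
    EL (EC b1 b2) W (fun c => G (rowrun c bot j))))).
  congr (EL _ _ _); apply/funext => bot; congr (EB _ _); apply/funext => l.
  by rewrite /G; apply: EL_commute; apply: EB_commute; exact: EL_expect.
rewrite stationary_row -EB_commute //; congr (EB _ _); apply/funext => l.
by rewrite /G /= (IH (fun s => F (l :: s))).
Qed.

End Stationarity.

Definition ind (R : realType) (b : bool) : R := b%:R.

(** * Exponential tails of Bernoulli counts *)

Section Chernoff.
Variable R : realType.

Lemma expR_le_quadratic (x : R) : `|x| <= 1 / 2 -> expR x <= 1 + x + 2 * x ^+ 2.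
Proof.
move=> xh.
have := xh; rewrite ler_norml => /andP[x1 x2].
have h : 0 < 1 - x by lra.
have : expR (- x) >= 1 - x by exact: expR_ge1Dx.
rewrite expRN => H.
have e0 := expR_gt0 x.
have : expR x * (1 - x) <= 1.
  by rewrite -[X in _ <= X](mulfV (lt0r_neq0 e0)) ler_wpM2l // ltW.
move=> H2; rewrite -(ler_pM2r h); apply: (le_trans H2).
have : 0 <= x ^+ 2 * (1 - 2 * x) by rewrite mulr_ge0 ?sqr_ge0 //; lra.
by rewrite !exprS expr0; lra.
Qed.

Lemma EL_mgf (p x : R) n : 0 <= p <= 1 ->
  EL (EB p) n (fun s => x ^+ cnt s) = (p * x + (1 - p)) ^+ n.
Proof.
move=> /EB_expect /EL_expect EP; elim: n => [//|n IH] /=.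
have -> : (fun b : bool => EL (EB p) n (fun s => x ^+ cnt (b :: s))) =
    (fun b : bool => x ^+ b * EL (EB p) n (fun s => x ^+ cnt s)).
  apply/funext=> b; rewrite -(evZ (EP n)); congr (EL _ _ _).
  by apply/funext=> s; rewrite /cnt /= exprD.
by rewrite IH /EB exprS; ring.
Qed.

Lemma EL_mgf_le (p x : R) n : 0 <= p <= 1 -> `|x| <= 1 / 2 ->
  EL (EB p) n (fun s => expR (x * ((cnt s)%:R - p * n%:R))) <= expR (2 * x ^+ 2 * n%:R).
Proof.
move=> p01 xh; have /andP[p0 p1] := p01.
have EP : is_expect (EL (EB p) n) by apply: EL_expect; apply: EB_expect.
have -> : (fun s => expR (x * ((cnt s)%:R - p * n%:R))) =
  (fun s => expR (- (x * p)) ^+ n * expR x ^+ cnt s).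
  apply/funext => s; rewrite -!expRM_natl -expRD; congr expR.
  by ring.
rewrite (evZ EP) EL_mgf // -exprMn [in X in _ <= X]mulrC expRM_natl.
apply: lerXn2r; rewrite ?nnegrE ?expR_ge0 //.
  by rewrite mulr_ge0 ?expR_ge0 // addr_ge0 ?mulr_ge0 ?expR_ge0 // subr_ge0.
have H : p * expR x + (1 - p) <= expR (p * (x + 2 * x ^+ 2)).
  apply: le_trans (expR_ge1Dx _).
  by have := ler_wpM2l p0 (expR_le_quadratic xh); lra.
have := ler_wpM2l (expR_ge0 (- (x * p))) H.
move/le_trans; apply; rewrite -expRD ler_expR.
have : p * x ^+ 2 <= x ^+ 2 by rewrite ler_piMl // sqr_ge0.
by lra.
Qed.

(** The exponent [s] is left free; it is fixed in [rect_error_decay], when [n] and [a] are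
    proportional. *)
Lemma EL_tail_ge (p s a : R) n : 0 <= p <= 1 -> 0 <= s <= 1 / 2 ->
  EL (EB p) n (fun t => ind R (p * n%:R + a <= (cnt t)%:R)) <=
  expR (2 * s ^+ 2 * n%:R - s * a).
Proof.
move=> p01 /andP[s0 s1].
have EP : is_expect (EL (EB p) n) by apply: EL_expect; apply: EB_expect.
apply: (@le_trans _ _ (EL (EB p) n (fun t =>
   expR (- (s * a)) * expR (s * ((cnt t)%:R - p * n%:R))))).
  apply: (ev_le EP) => t; rewrite /ind; case: (leP (p * n%:R + a) (cnt t)%:R) => H; last first.
    by rewrite mulr_ge0 ?expR_ge0.
  rewrite -expRD -[X in X <= _]expR0 ler_expR.
  have : 0 <= s * ((cnt t)%:R - p * n%:R - a) by rewrite mulr_ge0 //; lra.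
  by lra.
rewrite (evZ EP) addrC expRD ler_wpM2l ?expR_ge0 //.
by apply: EL_mgf_le => //; rewrite ger0_norm.
Qed.

Lemma EL_tail_le (p s a : R) n : 0 <= p <= 1 -> 0 <= s <= 1 / 2 ->
  EL (EB p) n (fun t => ind R ((cnt t)%:R <= p * n%:R - a)) <=
  expR (2 * s ^+ 2 * n%:R - s * a).
Proof.
move=> p01 /andP[s0 s1].
have EP : is_expect (EL (EB p) n) by apply: EL_expect; apply: EB_expect.
apply: (@le_trans _ _ (EL (EB p) n (fun t =>
   expR (- (s * a)) * expR ((- s) * ((cnt t)%:R - p * n%:R))))).
  apply: (ev_le EP) => t; rewrite /ind; case: (leP (cnt t)%:R (p * n%:R - a)) => H; last first.
    by rewrite mulr_ge0 ?expR_ge0.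
  rewrite -expRD -[X in X <= _]expR0 ler_expR.
  have : 0 <= s * (p * n%:R - a - (cnt t)%:R) by rewrite mulr_ge0 //; lra.
  by lra.
rewrite (evZ EP) addrC expRD ler_wpM2l ?expR_ge0 // -sqrrN.
by apply: EL_mgf_le => //; rewrite normrN ger0_norm.
Qed.

Lemma EL_drop (X : Type) (ev : (X -> R) -> R) k n (F : seq X -> R) :
  is_expect ev -> (k <= n)%N ->
  EL ev n (fun t => F (drop k t)) = EL ev (n - k) F.
Proof.
move=> evP; elim: k n => [|k IH] [|n] //= kn.
by rewrite IH // (ev_cst evP) subSS.
Qed.

End Chernoff.

(** * Current above an arbitrary row *)

Section CurrentBounds.
Variables (R : realType) (b1 b2 rho sig : R).
Hypotheses (b1_gt0 : 0 < b1) (b1_lt_b2 : b1 < b2) (b2_lt1 : b2 < 1).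
Hypotheses (rho_01 : 0 <= rho <= 1) (sig_01 : 0 <= sig <= 1).
Hypothesis balance : sig * (1 - rho) * (1 - b2) = (1 - sig) * rho * (1 - b1).

Let b1_lt1 : b1 < 1. Proof. exact: lt_trans b1_lt_b2 b2_lt1. Qed.
Let b2_gt0 : 0 < b2. Proof. exact: lt_trans b1_gt0 b1_lt_b2. Qed.
Let b1_01 : 0 <= b1 <= 1. Proof. by rewrite !ltW. Qed.
Let b2_01 : 0 <= b2 <= 1. Proof. by rewrite !ltW. Qed.
Let ECP := EC_expect b1_01 b2_01.
Let ErP := EB_expect rho_01.
Let EsP := EB_expect sig_01.
Let E_gt0 : 0 < Lbase b1 b2.
Proof. exact: lt_trans ltr01 (Lbase_gt1 b1_gt0 b1_lt1 b2_gt0 b2_lt1). Qed.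

(** Four failure probabilities, in order: some suffix of a stationary row has an atypical count; the
    stationary current is atypical; the left column is felt on the right side; the comparison of
    currents fails by Markov's inequality. *)
Definition rect_error (W T a : nat) (s : R) : R :=
  W.+1%:R * expR (2 * s ^+ 2 * W%:R - s * a%:R)
  + expR (2 * s ^+ 2 * T%:R - s * a%:R)
  + T%:R * Lsp b2 ^+ T / Zsp b2 ^+ W
  + (1 + (Lbase b1 b2 - 1) * W%:R) / Lbase b1 b2 ^+ a.

(** The best constant [Q] in [current_comparison]. It is random through the stationary row, so the
    Markov bound is applied relative to it. *)
Definition worst_ratio (bot bot' : seq bool) : R :=
  \big[Num.max/0]_(k < (size bot).+1)
     (Lbase b1 b2 ^+ cnt (drop k bot') / Lbase b1 b2 ^+ cnt (drop k bot)).

Lemma worst_ratioP bot bot' : exists2 k, (k <= size bot)%N &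
  worst_ratio bot bot' = Lbase b1 b2 ^+ cnt (drop k bot') / Lbase b1 b2 ^+ cnt (drop k bot).
Proof.
have [k _ kE] := @eq_bigmax _ R 'I_(size bot).+1 0 ord0 predT
  (fun k : 'I_(size bot).+1 => Lbase b1 b2 ^+ cnt (drop k bot') / Lbase b1 b2 ^+ cnt (drop k bot)) isT
  (fun k _ => ltW (divr_gt0 (exprn_gt0 _ E_gt0) (exprn_gt0 _ E_gt0))).
by exists k => //; rewrite -ltnS.
Qed.

Lemma le_worst_ratio bot bot' k : (k <= size bot)%N ->
  Lbase b1 b2 ^+ cnt (drop k bot') / Lbase b1 b2 ^+ cnt (drop k bot) <= worst_ratio bot bot'.
Proof.
move=> kW; exact: (@le_bigmax _ R 'I_(size bot).+1 0
  (fun k => Lbase b1 b2 ^+ cnt (drop k bot') / Lbase b1 b2 ^+ cnt (drop k bot))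
  (Ordinal (kW : (k < (size bot).+1)%N))).
Qed.

Lemma worst_ratio_gt0 bot bot' : 0 < worst_ratio bot bot'.
Proof. by have [k _ ->] := worst_ratioP bot bot'; rewrite divr_gt0 ?exprn_gt0. Qed.

(** The empty left column is the worst case for a lower bound. The current above [bot] is compared
    with that above a stationary row [xi] with the same empty column, the latter with the current of
    [xi] beside a stationary column, and this with its mean. The three terms [a] pay for the counts
    of [xi], for the stationary current and for Markov's inequality. *)
Lemma current_lower W T a s bot : size bot = W -> 0 <= s <= 1 / 2 ->
  EL (EL (EC b1 b2) W) T (fun cs => ind R [forall k : 'I_W.+1,
     (cnt (rect cs bot (nseq T false)).2)%:R + 3 * a%:R
       < sig * T%:R - (rho * (W - k)%:R - (cnt (drop k bot))%:R)])
  <= rect_error W T a s.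
Proof.
move=> sb s01.
have ECW : is_expect (EL (EC b1 b2) W) by exact: EL_expect.
have ECT : is_expect (EL (EL (EC b1 b2) W) T) by exact: EL_expect.
have EsT : is_expect (EL (EB sig) T) by exact: EL_expect.
have ErW : is_expect (EL (EB rho) W) by exact: EL_expect.
set f := fun cs => ind R _.
pose ls0 := nseq T false.
pose EE F := EL (EB rho) W (fun xi => EL (EB sig) T (fun ls =>
  EL (EL (EC b1 b2) W) T (fun cs => F xi ls cs))).
have EED F G : EE (fun xi ls cs => F xi ls cs + G xi ls cs) = EE F + EE G.
  rewrite /EE -(evD ErW); congr (EL _ _ _); apply/funext=> xi.
  rewrite -(evD EsT); congr (EL _ _ _); apply/funext=> ls.
  by rewrite (evD ECT).
have -> : EL (EL (EC b1 b2) W) T f = EE (fun _ _ cs => f cs).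
  by rewrite /EE (ev_cst EsT) (ev_cst ErW).
(* Union bound written pointwise: on the bad event at least one of the four summands is at least
   1. *)
apply: (@le_trans _ _ (EE (fun xi ls cs =>
   (\sum_(k < W.+1) ind R (rho * (W - k)%:R + a%:R <= (cnt (drop k xi))%:R))
   + ind R ((cnt (rect cs xi ls).2)%:R <= sig * T%:R - a%:R)
   + ((rect cs xi ls0).2 != (rect cs xi ls).2)%:R
   + (worst_ratio bot xi * Lbase b1 b2 ^+ a)^-1 *
     (Lbase b1 b2 ^+ cnt (rect cs xi ls0).2 / Lbase b1 b2 ^+ cnt (rect cs bot ls0).2)))).
  apply: (EL_le_size ErP) => xi sxi; apply: (EL_le_size EsP) => ls sls.
  apply: (ev_le ECT) => cs.
  rewrite {}/f /ind; case: forallP => [bad|_]; last first.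
    apply: addr_ge0; last first.
      by rewrite mulr_ge0 ?invr_ge0 ?divr_ge0 ?mulr_ge0 ?exprn_ge0 ?(ltW E_gt0) ?(ltW (worst_ratio_gt0 _ _)).
    by rewrite !addr_ge0 // sumr_ge0.
  rewrite [X in X <= _](_ : _ = 1) //.
  set S1 := \sum_(k < _) _; set t2 := _%:R; set t3 := _%:R; set t4 := _ * _.
  have S10 : 0 <= S1 by rewrite sumr_ge0.
  have t20 : 0 <= t2 by []. have t30 : 0 <= t3 by [].
  have t40 : 0 <= t4.
    by rewrite mulr_ge0 ?invr_ge0 ?divr_ge0 ?mulr_ge0 ?exprn_ge0 ?(ltW E_gt0) ?(ltW (worst_ratio_gt0 _ _)).
  case: (boolP [exists k : 'I_W.+1, rho * (W - k)%:R + a%:R <= (cnt (drop k xi))%:R]) => [/existsP[k Hk]|/existsPn N1].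
    have : 1 <= S1 by rewrite /S1 (bigD1 k) //= Hk lerDl sumr_ge0.
    by lra.
  case: (boolP ((cnt (rect cs xi ls).2)%:R <= sig * T%:R - a%:R)) => N2.
    have : 1 = t2 by rewrite /t2 N2. 
    by lra.
  case: (boolP ((rect cs xi ls0).2 != (rect cs xi ls).2)) => N3.
    have : 1 = t3 by rewrite /t3 N3.
    by lra.
  suff : 1 <= t4 by lra.
  rewrite /t4 mulrC ler_pdivlMr ?mul1r; last by rewrite mulr_gt0 ?exprn_gt0 ?worst_ratio_gt0.
  (* The bad event is used at the suffix that attains the maximum. With typical counts and currents
     of [xi] it forces the ratio of currents beyond [Lbase ^+ a] times the maximum. *)
  have [k kW ->] := worst_ratioP bot xi.
  rewrite sb in kW.
  rewrite ler_pdivlMr ?exprn_gt0 // mulrAC mulrAC -mulrA mulrAC ler_pdivrMr ?exprn_gt0 //.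
  rewrite -!exprD ler_weXn2l //; first by rewrite ltW // Lbase_gt1.
  have /(_ (Ordinal (kW : (k < W.+1)%N))) /= := bad.
  have /(_ (Ordinal (kW : (k < W.+1)%N))) /= := N1.
  rewrite -ltNge => n1 b; move: N2; rewrite -ltNge => n2.
  move: N3; rewrite negbK => /eqP n3; rewrite -n3 in n2.
  rewrite -(ler_nat R) !natrD.
  move: n1 b n2; rewrite -/ls0; lra.
rewrite !EED /rect_error.
apply: lerD; [apply: lerD; [apply: lerD|]|].
- rewrite /EE.
  apply: (@le_trans _ _ (EL (EB rho) W (fun xi => \sum_(k < W.+1) ind R (rho * (W - k)%:R + a%:R <= (cnt (drop k xi))%:R)))).
    by apply: (ev_le ErW) => xi; rewrite (ev_cst ECT) (ev_cst EsT).
  have -> : EL (EB rho) W (fun xi => \sum_(k < W.+1) ind R (rho * (W - k)%:R + a%:R <= (cnt (drop k xi))%:R))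
     = \sum_(k < W.+1) EL (EB rho) W (fun xi => ind R (rho * (W - k)%:R + a%:R <= (cnt (drop k xi))%:R)).
    elim: (index_enum _) => [|k r IH].
      by rewrite big_nil -[RHS](ev_cst ErW 0); congr (EL _ _ _); apply/funext => xi; rewrite big_nil.
    rewrite big_cons -IH -(evD ErW); congr (EL _ _ _).
    by apply/funext => xi; rewrite big_cons.
  rewrite mulr_natl -[W.+1 in X in _ <= X]card_ord -sumr_const; apply: ler_sum => k _.
  have kW : (k <= W)%N by rewrite -ltnS.
  rewrite (EL_drop (fun t => ind R (rho * (W - k)%:R + a%:R <= (cnt t)%:R))) //.
  apply: (le_trans (EL_tail_ge _ _ rho_01 s01)); rewrite ler_expR lerD2r.
  by apply: ler_wpM2l; [rewrite mulr_ge0 ?sqr_ge0|rewrite ler_nat leq_subr].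
- rewrite /EE (stationary_current b1_gt0 b1_lt1 b2_gt0 b2_lt1 rho_01 sig_01 balance W T
    (fun o => ind R ((cnt o)%:R <= sig * T%:R - a%:R))).
  exact: EL_tail_le.
- have Z0 := lt_trans ltr01 (Zsp_gt1 b2_gt0 b2_lt1).
  have C0 := lt_le_trans ltr01 (Csp_ge1 b2_gt0 b2_lt1).
  set B := T%:R * _ / _.
  rewrite /EE -(ev_cst ErW B); apply: (EL_le_size ErP) => xi sxi.
  rewrite -(ev_cst EsT B); apply: (EL_le_size EsP) => ls sls.
  have lle : lebs ls0 ls by apply: lebs_false.
  have := Ub_rect b1_gt0 b1_lt1 b2_gt0 b2_lt1 b1_lt_b2 sxi sxi (size_nseq T false) sls (lebs_refl xi) lle.
  rewrite (evZ ECT) Ub_refl add0r /B => H.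
  rewrite ler_pdivlMr ?exprn_gt0 //.
  rewrite -(ler_pM2l C0); move: H; lra.
- set B := _ / _.
  rewrite /EE -(ev_cst ErW B); apply: (EL_le_size ErP) => xi sxi.
  rewrite -(ev_cst EsT B); apply: (EL_le_size EsP) => ls sls.
  rewrite (evZ ECT).
  have Q0 := worst_ratio_gt0 bot xi.
  have HQ k : (k <= W)%N -> Lbase b1 b2 ^+ cnt (drop k xi) / Lbase b1 b2 ^+ cnt (drop k bot) <= worst_ratio bot xi.
    by move=> kW; apply: le_worst_ratio; rewrite sb.
  have := current_comparison b1_gt0 b1_lt1 b2_gt0 b2_lt1 sb sxi (size_nseq T false) HQ.
  rewrite -/ls0 => H.
  rewrite mulrC ler_pdivrMr ?mulr_gt0 ?exprn_gt0 // /B.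
  apply: (le_trans H); rewrite [X in _ <= X]mulrC -!mulrA [X in _ <= _ * X]mulrC.
  by rewrite divfK // expf_neq0 // gt_eqF.
Qed.

(** The mirror image of [current_lower]: full left column, and the roles of [bot] and [xi] exchanged
    in the comparison. *)
Lemma current_upper W T a s bot : size bot = W -> 0 <= s <= 1 / 2 ->
  EL (EL (EC b1 b2) W) T (fun cs => ind R [forall k : 'I_W.+1,
     sig * T%:R + ((cnt (drop k bot))%:R - rho * (W - k)%:R) + 3 * a%:R
       < (cnt (rect cs bot (nseq T true)).2)%:R])
  <= rect_error W T a s.
Proof.
move=> sb s01.
have ECW : is_expect (EL (EC b1 b2) W) by exact: EL_expect.
have ECT : is_expect (EL (EL (EC b1 b2) W) T) by exact: EL_expect.
have EsT : is_expect (EL (EB sig) T) by exact: EL_expect.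
have ErW : is_expect (EL (EB rho) W) by exact: EL_expect.
set f := fun cs => ind R _.
pose ls0 := nseq T true.
pose EE F := EL (EB rho) W (fun xi => EL (EB sig) T (fun ls =>
  EL (EL (EC b1 b2) W) T (fun cs => F xi ls cs))).
have EED F G : EE (fun xi ls cs => F xi ls cs + G xi ls cs) = EE F + EE G.
  rewrite /EE -(evD ErW); congr (EL _ _ _); apply/funext=> xi.
  rewrite -(evD EsT); congr (EL _ _ _); apply/funext=> ls.
  by rewrite (evD ECT).
have -> : EL (EL (EC b1 b2) W) T f = EE (fun _ _ cs => f cs).
  by rewrite /EE (ev_cst EsT) (ev_cst ErW).
apply: (@le_trans _ _ (EE (fun xi ls cs =>
   (\sum_(k < W.+1) ind R ((cnt (drop k xi))%:R <= rho * (W - k)%:R - a%:R))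
   + ind R (sig * T%:R + a%:R <= (cnt (rect cs xi ls).2)%:R)
   + ((rect cs xi ls).2 != (rect cs xi ls0).2)%:R
   + (worst_ratio xi bot * Lbase b1 b2 ^+ a)^-1 *
     (Lbase b1 b2 ^+ cnt (rect cs bot ls0).2 / Lbase b1 b2 ^+ cnt (rect cs xi ls0).2)))).
  apply: (EL_le_size ErP) => xi sxi; apply: (EL_le_size EsP) => ls sls.
  apply: (ev_le ECT) => cs.
  rewrite {}/f /ind; case: forallP => [bad|_]; last first.
    apply: addr_ge0; last first.
      by rewrite mulr_ge0 ?invr_ge0 ?divr_ge0 ?mulr_ge0 ?exprn_ge0 ?(ltW E_gt0) ?(ltW (worst_ratio_gt0 _ _)).
    by rewrite !addr_ge0 // sumr_ge0.
  rewrite [X in X <= _](_ : _ = 1) //.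
  set S1 := \sum_(k < _) _; set t2 := _%:R; set t3 := _%:R; set t4 := _ * _.
  have S10 : 0 <= S1 by rewrite sumr_ge0.
  have t20 : 0 <= t2 by []. have t30 : 0 <= t3 by [].
  have t40 : 0 <= t4.
    by rewrite mulr_ge0 ?invr_ge0 ?divr_ge0 ?mulr_ge0 ?exprn_ge0 ?(ltW E_gt0) ?(ltW (worst_ratio_gt0 _ _)).
  case: (boolP [exists k : 'I_W.+1, (cnt (drop k xi))%:R <= rho * (W - k)%:R - a%:R]) => [/existsP[k Hk]|/existsPn N1].
    have : 1 <= S1 by rewrite /S1 (bigD1 k) //= Hk lerDl sumr_ge0.
    by lra.
  case: (boolP (sig * T%:R + a%:R <= (cnt (rect cs xi ls).2)%:R)) => N2.
    have : 1 = t2 by rewrite /t2 N2. 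
    by lra.
  case: (boolP ((rect cs xi ls).2 != (rect cs xi ls0).2)) => N3.
    have : 1 = t3 by rewrite /t3 N3.
    by lra.
  suff : 1 <= t4 by lra.
  rewrite /t4 mulrC ler_pdivlMr ?mul1r; last by rewrite mulr_gt0 ?exprn_gt0 ?worst_ratio_gt0.
  have [k kW ->] := worst_ratioP xi bot.
  rewrite sxi in kW.
  rewrite ler_pdivlMr ?exprn_gt0 // mulrAC mulrAC -mulrA mulrAC ler_pdivrMr ?exprn_gt0 //.
  rewrite -!exprD ler_weXn2l //; first by rewrite ltW // Lbase_gt1.
  have /(_ (Ordinal (kW : (k < W.+1)%N))) /= := bad.
  have /(_ (Ordinal (kW : (k < W.+1)%N))) /= := N1.
  rewrite -ltNge => n1 b; move: N2; rewrite -ltNge => n2.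
  move: N3; rewrite negbK => /eqP n3; rewrite n3 in n2.
  rewrite -(ler_nat R) !natrD.
  move: n1 b n2; rewrite -/ls0; lra.
rewrite !EED /rect_error.
apply: lerD; [apply: lerD; [apply: lerD|]|].
- rewrite /EE.
  apply: (@le_trans _ _ (EL (EB rho) W (fun xi => \sum_(k < W.+1) ind R ((cnt (drop k xi))%:R <= rho * (W - k)%:R - a%:R)))).
    by apply: (ev_le ErW) => xi; rewrite (ev_cst ECT) (ev_cst EsT).
  have -> : EL (EB rho) W (fun xi => \sum_(k < W.+1) ind R ((cnt (drop k xi))%:R <= rho * (W - k)%:R - a%:R))
     = \sum_(k < W.+1) EL (EB rho) W (fun xi => ind R ((cnt (drop k xi))%:R <= rho * (W - k)%:R - a%:R)).
    elim: (index_enum _) => [|k r IH].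
      by rewrite big_nil -[RHS](ev_cst ErW 0); congr (EL _ _ _); apply/funext => xi; rewrite big_nil.
    rewrite big_cons -IH -(evD ErW); congr (EL _ _ _).
    by apply/funext => xi; rewrite big_cons.
  rewrite mulr_natl -[W.+1 in X in _ <= X]card_ord -sumr_const; apply: ler_sum => k _.
  have kW : (k <= W)%N by rewrite -ltnS.
  rewrite (EL_drop (fun t => ind R ((cnt t)%:R <= rho * (W - k)%:R - a%:R))) //.
  apply: (le_trans (EL_tail_le _ _ rho_01 s01)); rewrite ler_expR lerD2r.
  by apply: ler_wpM2l; [rewrite mulr_ge0 ?sqr_ge0|rewrite ler_nat leq_subr].
- rewrite /EE (stationary_current b1_gt0 b1_lt1 b2_gt0 b2_lt1 rho_01 sig_01 balance W T
    (fun o => ind R (sig * T%:R + a%:R <= (cnt o)%:R))).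
  exact: EL_tail_ge.
- have Z0 := lt_trans ltr01 (Zsp_gt1 b2_gt0 b2_lt1).
  have C0 := lt_le_trans ltr01 (Csp_ge1 b2_gt0 b2_lt1).
  set B := T%:R * _ / _.
  rewrite /EE -(ev_cst ErW B); apply: (EL_le_size ErP) => xi sxi.
  rewrite -(ev_cst EsT B); apply: (EL_le_size EsP) => ls sls.
  have lle : lebs ls ls0 by apply: lebs_true.
  have := Ub_rect b1_gt0 b1_lt1 b2_gt0 b2_lt1 b1_lt_b2 sxi sxi sls (size_nseq T true) (lebs_refl xi) lle.
  rewrite (evZ ECT) Ub_refl add0r /B => H.
  rewrite ler_pdivlMr ?exprn_gt0 //.
  rewrite -(ler_pM2l C0); move: H; lra.
- set B := _ / _.
  rewrite /EE -(ev_cst ErW B); apply: (EL_le_size ErP) => xi sxi.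
  rewrite -(ev_cst EsT B); apply: (EL_le_size EsP) => ls sls.
  rewrite (evZ ECT).
  have Q0 := worst_ratio_gt0 xi bot.
  have HQ k : (k <= W)%N -> Lbase b1 b2 ^+ cnt (drop k bot) / Lbase b1 b2 ^+ cnt (drop k xi) <= worst_ratio xi bot.
    by move=> kW; apply: le_worst_ratio; rewrite sxi.
  have := current_comparison b1_gt0 b1_lt1 b2_gt0 b2_lt1 sxi sb (size_nseq T true) HQ.
  rewrite -/ls0 => H.
  rewrite mulrC ler_pdivrMr ?mulr_gt0 ?exprn_gt0 // /B.
  apply: (le_trans H); rewrite [X in _ <= X]mulrC -!mulrA [X in _ <= _ * X]mulrC.
  by rewrite divfK // expf_neq0 // gt_eqF.
Qed.

End CurrentBounds.

(** * The ring *)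

Section ProductCoins.
Variables (R : realType) (b1 b2 : R) (I : finType).
Hypotheses (b1_01 : 0 <= b1 <= 1) (b2_01 : 0 <= b2 <= 1).
Let ECP := EC_expect b1_01 b2_01.

Definition pcoin (c : coin) : R :=
  (if c.1 then b1 else 1 - b1) * (if c.2 then b2 else 1 - b2).

Lemma ECE f : EC b1 b2 f = \sum_c pcoin c * f c.
Proof.
rewrite (eq_bigr (fun c => pcoin (c.1, c.2) * f (c.1, c.2))); last by case.
rewrite -(pair_big predT predT (fun a b => pcoin (a, b) * f (a, b))) /= !big_bool /=.
by rewrite /EC /EB /pcoin /=; ring.
Qed.

Lemma sum_pcoin : \sum_c pcoin c = 1.
Proof.
have := ev1 ECP; rewrite ECE => <-.
by apply: eq_bigr => c _; rewrite mulr1.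
Qed.

Lemma pcoin_ge0 c : 0 <= pcoin c.
Proof.
case/andP: b1_01 => ? ?; case/andP: b2_01 => ? ?.
by rewrite /pcoin; case: c => [[] []] /=; apply: mulr_ge0; rewrite ?subr_ge0.
Qed.

Definition pcoins (c : {ffun I -> coin}) : R := \prod_i pcoin (c i).
Definition EF (F : {ffun I -> coin} -> R) : R := \sum_c pcoins c * F c.

Lemma EF_prod (f : I -> coin -> R) :
  EF (fun c => \prod_i f i (c i)) = \prod_i EC b1 b2 (f i).
Proof.
rewrite /EF (eq_bigr (fun c : {ffun I -> coin} => \prod_i (pcoin (c i) * f i (c i)))); last first.
  by move=> c _; rewrite big_split.
rewrite -(bigA_distr_bigA (fun i x => pcoin x * f i x)) /=.
by apply: eq_bigr => i _; rewrite ECE.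
Qed.

Lemma EF_expect : is_expect EF.
Proof.
split=> [f g|k f|f g fg|]; rewrite /EF.
- by rewrite -big_split; apply: eq_bigr => c _; rewrite mulrDr.
- by rewrite mulr_sumr; apply: eq_bigr => c _; rewrite mulrCA.
- apply: ler_sum => c _; apply: ler_wpM2l => //.
  by apply: prodr_ge0 => i _; exact: pcoin_ge0.
- transitivity (EF (fun c => \prod_(i : I) 1)).
    by apply: eq_bigr => c _; rewrite big1_eq.
  by rewrite (EF_prod (fun _ _ => 1)) big1 // => i _; rewrite (ev1 ECP).
Qed.

Definition upd (c : {ffun I -> coin}) (i : I) (x : coin) : {ffun I -> coin} :=
  [ffun k => if k == i then x else c k].

(** Exchanging the coin stored at [i] with the fresh one is an involution that preserves the product
    weight. *)
Lemma EF_resample F i : EF F = EF (fun c => EC b1 b2 (fun x => F (upd c i x))).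
Proof.
have -> : EF F = \sum_(cx : {ffun I -> coin} * coin) pcoins cx.1 * pcoin cx.2 * F cx.1.
  rewrite -(pair_big predT predT (fun c x => pcoins c * pcoin x * F c)) /=.
  apply: eq_bigr => c _; rewrite -[LHS]mulr1 -sum_pcoin mulr_sumr.
  by apply: eq_bigr => x _; ring.
have -> : EF (fun c => EC b1 b2 (fun x => F (upd c i x))) =
    \sum_(cx : {ffun I -> coin} * coin) pcoins cx.1 * pcoin cx.2 * F (upd cx.1 i cx.2).
  rewrite -(pair_big predT predT (fun c x => pcoins c * pcoin x * F (upd c i x))) /=.
  apply: eq_bigr => c _; rewrite ECE mulr_sumr.
  by apply: eq_bigr => x _; ring.
pose h (cx : {ffun I -> coin} * coin) := (upd cx.1 i cx.2, cx.1 i).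
have hK : involutive h.
  move=> [c x]; rewrite /h /=; congr pair; last by rewrite ffunE eqxx.
  by apply/ffunP => k; rewrite !ffunE; case: eqP => // ->.
rewrite (reindex_inj (inv_inj hK)); apply: eq_bigr => -[c x] _ /=.
congr (_ * _); rewrite /pcoins (bigD1 i) //= [in RHS](bigD1 i) //= ffunE eqxx.
rewrite (eq_bigr (fun k => pcoin (c k))); first by ring.
by move=> k /negPf ki; rewrite ffunE ki.
Qed.

(** The hypothesis says that [F] sees the coins on [s] only through the list, so these can be
    replaced by fresh ones one at a time. *)
Lemma EF_list (s : seq I) (F : {ffun I -> coin} -> seq coin -> R) : uniq s ->
  (forall c i x l, i \in s -> F (upd c i x) l = F c l) ->
  EF (fun c => F c [seq c i | i <- s]) = EF (fun c => EL (EC b1 b2) (size s) (F c)).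
Proof.
elim: s F => [//|i s IH] F /= /andP[nis us] ins.
rewrite (IH (fun c l => F c (c i :: l))) //; last first.
  move=> c k x l ks; rewrite ffunE; have [ik|_] := eqVneq i k.
    by move: nis; rewrite ik ks.
  by apply: ins; rewrite inE ks orbT.
rewrite (EF_resample _ i); congr EF; apply/funext => c.
congr (EC _ _ _); apply/funext => x; congr (EL _ _ _); apply/funext => l.
by rewrite ffunE eqxx ins // mem_head.
Qed.

End ProductCoins.

Section ProductCoins2.
Variables (R : realType) (b1 b2 : R) (I K : finType).
Hypotheses (b1_01 : 0 <= b1 <= 1) (b2_01 : 0 <= b2 <= 1).

Lemma EF_rows (xs : seq I) (ts : seq K)
    (F : {ffun I * K -> coin} -> seq (seq coin) -> R) : uniq xs -> uniq ts ->
  (forall c i k x l, i \in xs -> k \in ts -> F (upd c (i, k) x) l = F c l) ->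
  EF b1 b2 (fun c => F c [seq [seq c (i, k) | i <- xs] | k <- ts]) =
  EF b1 b2 (fun c => EL (EL (EC b1 b2) (size xs)) (size ts) (F c)).
Proof.
move=> uxs; elim: ts F => [//|k ts IH] F /= /andP[kts uts] ins.
rewrite (IH (fun c l => F c ([seq c (i, k) | i <- xs] :: l))) //; last first.
  move=> c i k' x l ixs k'ts; rewrite ins ?inE ?k'ts ?orbT //; congr (F c (_ :: l)).
  apply: eq_map => i'; rewrite ffunE xpair_eqE.
  have [kk|_] := eqVneq k k'; last by rewrite andbF.
  by move: kts; rewrite kk k'ts.
pose F' c r := EL (EL (EC b1 b2) (size xs)) (size ts) (fun l => F c (r :: l)).
have := @EF_list R b1 b2 _ b1_01 b2_01 [seq (i, k) | i <- xs] F'.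
rewrite size_map /F' => <-.
- by congr EF; apply/funext => c; rewrite -map_comp.
- by rewrite map_inj_uniq // => i i' [].
- move=> c [i k'] x l /mapP[i' i'xs [-> ->]].
  by congr (EL _ _ _); apply/funext => l'; rewrite ins ?mem_head.
Qed.

End ProductCoins2.

(** * Rows that close up around the ring *)

Fixpoint hrun (cr : nat -> coin) (eta : nat -> bool) (j : bool) (x : nat) : bool :=
  if x is x'.+1 then (vout (cr x') (eta x') (hrun cr eta j x')).2 else j.

Lemma hrun_mono cr eta j j' x : j ==> j' -> hrun cr eta j x ==> hrun cr eta j' x.
Proof.
move=> jj; elim: x => //= x IH.
by have /andP[_ ->] := vout_mono (cr x) (implybb (eta x)) IH.
Qed.

(** The coin [(false, false)] makes every lone arrow turn, so the arrow leaving to the right is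
    present exactly if one comes from below: the past of the row is erased. *)
Lemma hrun_forget cr eta j j' x y : (y < x)%N -> cr y = (false, false) ->
  hrun cr eta j x = hrun cr eta j' x.
Proof.
move=> yx cy; elim: x yx => // x IH; rewrite ltnS leq_eqVlt => /orP[/eqP<-|yx] /=.
  by rewrite cy; case: (eta y); case: hrun; case: hrun.
by rewrite (IH yx).
Qed.

Section Ring.
Variable n : nat.
Let N := n.+1.

Definition jcut cr eta := hrun cr eta false N.

(** The run started without an arrow across the cut either closes at once, or ends with an arrow; in
    the latter case monotonicity makes the run started with an arrow close. *)
Lemma jcut_fix cr eta : hrun cr eta (jcut cr eta) N = jcut cr eta.
Proof.
have := @hrun_mono cr eta false true N isT.
by rewrite /jcut; case E : (hrun cr eta false N) => // /implyP ->.
Qed.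

Definition rowH cr eta x := hrun cr eta (jcut cr eta) (x %% N).
Definition rowV cr eta x := (vout (cr (x %% N)%N) (eta (x %% N)%N) (rowH cr eta x)).1.

Lemma rowHS cr eta x : rowH cr eta x.+1 =
  (vout (cr (x %% N)%N) (eta (x %% N)%N) (rowH cr eta x)).2.
Proof.
rewrite /rowH; have xN : (x %% N < N)%N by rewrite ltn_mod.
have [E|E] := eqVneq (x %% N)%N n.
  have -> : (x.+1 %% N = 0)%N by rewrite -addn1 -modnDml E addn1 modnn.
  by rewrite /= -{1}jcut_fix /N /= E.
have -> : (x.+1 %% N = (x %% N).+1)%N; last by [].
rewrite -addn1 -modnDml addn1 modn_small // /N ltnS.
by move: xN E; rewrite /N; lia.
Qed.

Variable L : nat.
Implicit Type c : {ffun 'I_N * 'I_L -> coin}.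

(** Sites are reduced mod N so that rows can be read periodically on all naturals. The coin
    [(false, false)] is a default for row numbers beyond L. *)
Definition crow c (t x : nat) : coin :=
  if insub t is Some k then c (inord (x %% N), k) else (false, false).

Fixpoint Vt c (psi : nat -> bool) (t : nat) : nat -> bool :=
  if t is t'.+1 then rowV (crow c t') (Vt c psi t') else fun x => psi (x %% N)%N.

Definition Ht c psi t := rowH (crow c t) (Vt c psi t).

Lemma Vt_mod c psi t x : Vt c psi t (x %% N) = Vt c psi t x.
Proof. by case: t => [|t] /=; rewrite /rowV /rowH modn_mod. Qed.

Lemma Ht_mod c psi t x : Ht c psi t (x %% N) = Ht c psi t x.
Proof. by rewrite /Ht /rowH modn_mod. Qed.

Lemma crow_mod c t x : crow c t (x %% N) = crow c t x.
Proof. by rewrite /crow modn_mod. Qed.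

Lemma Vt_vertex c psi t x : (Vt c psi t.+1 x, Ht c psi t x.+1) =
  vout (crow c t x) (Vt c psi t x) (Ht c psi t x).
Proof.
rewrite /Ht rowHS /= /rowV crow_mod -/(Ht c psi t x) Vt_mod.
by case: vout.
Qed.

(** Vertical arrows entering a row depend only on the coins strictly below it; this makes the bottom
    of a window independent of the coins in the window. *)
Lemma Vt_insensitive c psi t i (k : 'I_L) z : (t <= k)%N ->
  Vt (upd c (i, k) z) psi t = Vt c psi t.
Proof.
elim: t => //= t IH tk; rewrite IH ?(ltnW tk) //.
suff -> : crow (upd c (i, k) z) t = crow c t by [].
apply/funext => x; rewrite /crow; case: insubP => // k' _ k't.
by rewrite ffunE xpair_eqE -[k' == k]/(val k' == val k) k't ltn_eqF // andbF.
Qed.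

Lemma rowrun_window c psi t X W :
  rowrun [seq crow c t x | x <- iota X W] [seq Vt c psi t x | x <- iota X W]
    (Ht c psi t X) =
  ([seq Vt c psi t.+1 x | x <- iota X W], Ht c psi t (X + W)).
Proof.
elim: W X => [|W IH] X; first by rewrite addn0.
rewrite [iota _ _]/= !map_cons [LHS]/= -Vt_vertex [(_, _).1]/= [(_, _).2]/= IH /=.
by rewrite ?addSn ?addnS.
Qed.

Lemma rect_window c psi t X W T :
  rect [seq [seq crow c s x | x <- iota X W] | s <- iota t T]
    [seq Vt c psi t x | x <- iota X W] [seq Ht c psi s X | s <- iota t T] =
  ([seq Vt c psi (t + T) x | x <- iota X W],
   [seq Ht c psi s (X + W) | s <- iota t T]).
Proof.
elim: T t => [|T IH] t; first by rewrite addn0.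
rewrite [iota t _]/= !map_cons [LHS]/= rowrun_window [(_, _).1]/= [(_, _).2]/= IH /=.
by rewrite ?addSn ?addnS.
Qed.

(** A window no wider than the ring meets each site at most once, so its coins are distinct and
    hence independent. *)
Lemma iota_mod_uniq X W : (W <= N)%N ->
  uniq [seq (inord (x %% N) : 'I_N) | x <- iota X W].
Proof.
move=> WN; rewrite map_inj_in_uniq ?iota_uniq // => x y.
rewrite !mem_iota => /andP[x1 x2] /andP[y1 y2] /(congr1 val) /=.
rewrite !inordK ?ltn_mod // => E.
wlog xy : x y x1 x2 y1 y2 E / (x <= y)%N.
  by move=> H; case: (leqP x y) => [|/ltnW] xy; [apply: H|apply/esym/H].
have : (N %| y - x)%N by rewrite -eqn_mod_dvd // E.
have d : (y - x < N)%N by lia.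
case: (posnP (y - x)%N) => [|p]; first by lia.
by move=> /(dvdn_leq p); lia.
Qed.

Lemma window_coins c X W t T : (t + T <= L)%N ->
  [seq [seq crow c s x | x <- iota X W] | s <- iota t T] =
  [seq [seq c (i, k) | i <- [seq inord (x %% N) | x <- iota X W]]
     | k <- pmap insub (iota t T)].
Proof.
move=> tT.
have vE : [seq val k | k <- pmap (insub : nat -> option 'I_L) (iota t T)] = iota t T.
  rewrite pmap_filter ?(all_filterP _) //; last exact: insubK.
  by apply/allP => s; rewrite mem_iota => /andP[_ st]; rewrite /= insubT //; lia.
rewrite -{1}vE -map_comp; apply: eq_map => k /=; rewrite -map_comp.
by apply: eq_map => x /=; rewrite /crow valK.
Qed.

End Ring.

(** * Windows on the ring *)

Section WindowCurrent.
Variables (R : realType) (b1 b2 rho sig : R).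
Hypotheses (b1_gt0 : 0 < b1) (b1_lt_b2 : b1 < b2) (b2_lt1 : b2 < 1).
Hypotheses (rho_01 : 0 <= rho <= 1) (sig_01 : 0 <= sig <= 1).
Hypothesis balance : sig * (1 - rho) * (1 - b2) = (1 - sig) * rho * (1 - b1).
Variables (n L : nat) (psi : nat -> bool) (X W t T a : nat) (s : R).
Hypotheses (WN : (W <= n.+1)%N) (tT : (t + T <= L)%N) (s01 : 0 <= s <= 1 / 2).

Let b1_01 : 0 <= b1 <= 1.
Proof. by rewrite !ltW // (lt_trans b1_lt_b2 b2_lt1). Qed.
Let b2_01 : 0 <= b2 <= 1.
Proof. by rewrite !ltW // (lt_trans b1_gt0 b1_lt_b2). Qed.

Let ts := pmap (insub : nat -> option 'I_L) (iota t T).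
Let xs := [seq (inord (x %% n.+1) : 'I_n.+1) | x <- iota X W].

Let uts : uniq ts.
Proof. by apply: (pmap_uniq (insubK _)); exact: iota_uniq. Qed.

Let sts : size ts = T.
Proof.
rewrite size_pmap -[RHS](size_iota t); apply/eqP; rewrite -all_count.
apply/allP => r; rewrite mem_iota => /andP[_ st].
by rewrite /= insubT //; exact: leq_trans tT.
Qed.

Let window_bot (c : {ffun 'I_n.+1 * 'I_L -> coin}) := [seq Vt c psi t x | x <- iota X W].

Let window_out (c : {ffun 'I_n.+1 * 'I_L -> coin}) := [seq Ht c psi r (X + W) | r <- iota t T].

Let window_bot_upd c (i : 'I_n.+1) k z : k \in ts -> window_bot (upd c (i, k) z) = window_bot c.
Proof.
rewrite mem_pmap => /mapP[r]; rewrite mem_iota => /andP[tr _] /esym.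
case: insubP => // k' _ k'r [<-]; rewrite /window_bot Vt_insensitive //.
by rewrite -[nat_of_ord k']/(val k') k'r.
Qed.

(** The bottom of the window is fixed by the coins below, so the coins inside can be integrated out
    first. This would fail with the true left column, which sees the window around the ring; [P]
    therefore involves only the bottom and the coins, the column being replaced by an extreme
    one. *)
Let bridge (P : seq bool -> seq (seq coin) -> bool) B :
  (forall bot, size bot = W -> EL (EL (EC b1 b2) W) T (fun cs => ind R (P bot cs)) <= B) ->
  EF b1 b2 (fun c => ind R (P (window_bot c)
      [seq [seq crow c r x | x <- iota X W] | r <- iota t T])) <= B.
Proof.
move=> H.
have EFP := EF_expect ('I_n.+1 * 'I_L)%type b1_01 b2_01.
have -> : (fun c => ind R (P (window_bot c)
      [seq [seq crow c r x | x <- iota X W] | r <- iota t T])) =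
  (fun c : {ffun 'I_n.+1 * 'I_L -> coin} => ind R (P (window_bot c)
      [seq [seq c (i, k) | i <- xs] | k <- ts])).
  by apply/funext => c; rewrite window_coins.
rewrite (@EF_rows R b1 b2 'I_n.+1 'I_L b1_01 b2_01 xs ts (fun c cs => ind R (P (window_bot c) cs))) //.
- rewrite -(ev_cst EFP B); apply: (ev_le EFP) => c; rewrite sts size_map size_iota.
  by apply: H; rewrite size_map size_iota.
- exact: iota_mod_uniq.
- by move=> c i k x l _ kts; rewrite window_bot_upd.
Qed.

Lemma window_current_lower :
  EF b1 b2 (fun c => ind R [forall k : 'I_W.+1,
     (cnt (window_out c))%:R + 3 * a%:R
       < sig * T%:R - (rho * (W - k)%:R - (cnt (drop k (window_bot c)))%:R)])
  <= rect_error b1 b2 W T a s.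
Proof.
have EFP := EF_expect ('I_n.+1 * 'I_L)%type b1_01 b2_01.
apply: le_trans (bridge (fun bot sb => current_lower b1_gt0 b1_lt_b2 b2_lt1 rho_01 sig_01 balance T a sb s01)).
apply: (ev_le EFP) => c; rewrite /ind ler_nat.
case: forallP => // H; rewrite lt0b; apply/forallP => k; apply: le_lt_trans (H k).
rewrite lerD2r ler_nat.
have := rect_window c psi t X W T => /(congr1 snd) /= E.
rewrite /window_out -E; apply: lebs_cnt; apply: rect_mono; first exact: lebs_refl.
by apply: lebs_false; rewrite size_map size_iota.
Qed.

Lemma window_current_upper :
  EF b1 b2 (fun c => ind R [forall k : 'I_W.+1,
     sig * T%:R + ((cnt (drop k (window_bot c)))%:R - rho * (W - k)%:R) + 3 * a%:R
       < (cnt (window_out c))%:R])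
  <= rect_error b1 b2 W T a s.
Proof.
have EFP := EF_expect ('I_n.+1 * 'I_L)%type b1_01 b2_01.
apply: le_trans (bridge (fun bot sb => current_upper b1_gt0 b1_lt_b2 b2_lt1 rho_01 sig_01 balance T a sb s01)).
apply: (ev_le EFP) => c; rewrite /ind ler_nat.
case: forallP => // H; rewrite lt0b; apply/forallP => k; apply: lt_le_trans (H k) _.
rewrite ler_nat.
have := rect_window c psi t X W T => /(congr1 snd) /= E.
rewrite /window_out -E; apply: lebs_cnt; apply: rect_mono; first exact: lebs_refl.
by apply: lebs_true; rewrite size_map size_iota.
Qed.

End WindowCurrent.

(** * From the weighted measure to independent coins *)

Section Reduction.
Variables (R : realType) (b1 b2 : R).
Hypotheses (b1_01 : 0 <= b1 <= 1) (b2_01 : 0 <= b2 <= 1).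
Variables (n L : nat) (psi : nat -> bool).
Let N := n.+1.
Let EFP := EF_expect ('I_N * 'I_L)%type b1_01 b2_01.
Implicit Type (c : {ffun 'I_N * 'I_L -> coin}) (e : ens N L).

Definition cons_ens c e := [forall p : 'I_N * 'I_L,
  vout (c p) (e.1 (p.1, row_in p.2)) (e.2 (ord_pred p.1, p.2))
    == (e.1 (p.1, row_out p.2), e.2 p)].

Definition bd_ens e := [forall x : 'I_N, e.1 (x, ord0) == psi x].

(** The ensemble in which each row is closed by [jcut]. It is the one among the ensembles compatible
    with the coins whose heights are analysed. *)
Definition emin c : ens N L :=
  ([ffun p : 'I_N * 'I_L.+1 => Vt c psi p.2 p.1],
   [ffun p : 'I_N * 'I_L => Ht c psi p.2 p.1.+1]).

Lemma bd_emin c : bd_ens (emin c).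
Proof. by apply/forallP => x; rewrite ffunE /= modn_small. Qed.

Lemma cons_emin c : cons_ens c (emin c).
Proof.
apply/forallP => -[x k] /=; rewrite !ffunE /= !add0n.
have -> : Ht c psi k ((x + N).-1 %% N).+1 = Ht c psi k x.
  rewrite -Ht_mod -[RHS]Ht_mod; congr (Ht _ _ _ _).
  by rewrite /N addnS /= -addn1 modnDml addn1 -addnS modnDr.
have -> : c (x, k) = crow c k x.
  by rewrite /crow valK modn_small // inord_val.
by rewrite -Vt_vertex.
Qed.

Lemma nat_forall (I : finType) (P : pred I) : ([forall i, P i] : nat)%:R = \prod_i (P i : nat)%:R :> R.
Proof.
case: forallP => [H|/forallP]; first by rewrite big1 // => i _; rewrite H.
by rewrite negb_forall => /existsP[i /negPf Pi]; rewrite (bigD1 i) //= Pi mul0r.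
Qed.

Lemma EC_vweight i1 j1 i2 j2 :
  EC b1 b2 (fun z => ((vout z i1 j1 == (i2, j2)) : nat)%:R) = vweight b1 b2 i1 j1 i2 j2.
Proof.
by rewrite /EC /EB; case: i1 j1 i2 j2 => [] [] [] [] /=; ring.
Qed.

(** A vertex weight is the probability that the coin sends the given input to the given output, so
    by independence an ensemble weighs as much as the event that the coins are compatible with
    it. *)
Lemma ens_weightE e : ens_weight b1 b2 e = EF b1 b2 (fun c => (cons_ens c e : nat)%:R).
Proof.
rewrite /cons_ens; under eq_fun do rewrite nat_forall.
rewrite (EF_prod b1 b2 (fun p z => ((vout z (e.1 (p.1, row_in p.2)) (e.2 (ord_pred p.1, p.2))
    == (e.1 (p.1, row_out p.2), e.2 p)) : nat)%:R)).
rewrite /ens_weight pair_big /=; apply: eq_bigr => -[x k] _ /=.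
by rewrite EC_vweight.
Qed.

Lemma cons_conserve c e (x : 'I_N) k : cons_ens c e ->
  conserve (e.1 (x, row_in k)) (e.2 (ord_pred x, k)) (e.1 (x, row_out k)) (e.2 (x, k)).
Proof.
move=> /forallP /(_ (x, k)) /eqP /= E.
by rewrite /conserve -(vout_conserve (c (x, k))) E.
Qed.

Lemma sum_weight (E : pred (ens N L)) :
  \sum_(e : ens N L | is_ensemble psi e && E e) ens_weight b1 b2 e =
  EF b1 b2 (fun c => \sum_(e : ens N L | bd_ens e && E e) (cons_ens c e : nat)%:R).
Proof.
have -> : EF b1 b2 (fun c => \sum_(e : ens N L | bd_ens e && E e) (cons_ens c e : nat)%:R)
  = \sum_(e : ens N L | bd_ens e && E e) ens_weight b1 b2 e.
  rewrite /EF; under eq_bigr do rewrite mulr_sumr.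
  by rewrite exchange_big; apply: eq_bigr => e _; rewrite ens_weightE.
rewrite big_mkcond [RHS]big_mkcond; apply: eq_bigr => e _.
rewrite /is_ensemble -/(bd_ens e).
case: (bd_ens e) => //=; case: (E e); rewrite ?andbF // andbT.
case: ifP => // /negbT; rewrite negb_forall => /existsP[x].
rewrite negb_forall => /existsP[k nc].
rewrite ens_weightE -[LHS](ev_cst EFP 0); congr EF; apply/funext => c.
by case: (boolP (cons_ens c e)) => // /(cons_conserve x k); rewrite (negPf nc).
Qed.

(** Rows without a coin that erases the past: only in these can the arrow across the cut be
    ambiguous. *)
Definition rr c (k : 'I_L) := [forall x : 'I_N, c (x, k) != (false, false)].

Lemma cons_hrun c e k : cons_ens c e -> forall x, (x <= N)%N ->
  e.2 (inord ((x + n) %% N), k) = hrun (fun x => c (inord x, k))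
    (fun x => e.1 (inord x, row_in k)) (e.2 (ord_max, k)) x.
Proof.
move=> /forallP H; elim => [|x IH] xN.
  by rewrite add0n modn_small //=; congr (e.2 (_, k)); apply/val_inj; rewrite /= inordK.
have /eqP := H (inord x, k).
have -> : ord_pred (inord x : 'I_N) = inord ((x + n) %% N).
  by apply/val_inj; rewrite /= !inordK ?ltn_mod // /N addnS.
rewrite IH ?(ltnW xN) // => /(congr1 snd) /= ->.
by rewrite addSnnS modnDr modn_small.
Qed.

(** Induction over rows. By [hrun_forget] a coin [(false, false)] determines the arrow across the
    cut, and in the remaining rows this arrow is prescribed; with the row below it then determines
    the whole row. *)
Lemma cons_unique c e e' : bd_ens e -> bd_ens e' -> cons_ens c e -> cons_ens c e' ->
  (forall k, rr c k -> e.2 (ord_max, k) = e'.2 (ord_max, k)) -> e = e'.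
Proof.
move=> /forallP b /forallP b' ce ce' rrE.
have row (k : 'I_L) : (forall x, e.1 (x, row_in k) = e'.1 (x, row_in k)) ->
    forall x, e.2 (x, k) = e'.2 (x, k) /\ e.1 (x, row_out k) = e'.1 (x, row_out k).
  move=> inE.
  have etaE : (fun x => e.1 (inord x, row_in k)) = (fun x => e'.1 (inord x, row_in k)).
    by apply/funext => x; rewrite inE.
  have jE : e.2 (ord_max, k) = e'.2 (ord_max, k).
    case: (boolP (rr c k)) => [/rrE //|]; rewrite negb_forall => /existsP[y].
    rewrite negbK => /eqP cy.
    have om : inord ((N + n) %% N) = ord_max :> 'I_N.
      by apply/val_inj; rewrite addnC modnDr modn_small //= inordK.
    have := cons_hrun k ce (leqnn N); rewrite om {1}etaE => {1}->.
    have := cons_hrun k ce' (leqnn N); rewrite om => {1}->.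
    apply: (hrun_forget _ _ _ (ltn_ord y)); by rewrite inord_val.
  have hE x : e.2 (x, k) = e'.2 (x, k).
    have := cons_hrun k ce (ltn_ord x); have := cons_hrun k ce' (ltn_ord x).
    by rewrite addSnnS modnDr modn_small // inord_val etaE jE => -> ->.
  move=> x; split; first exact: hE.
  move/forallP : ce => /(_ (x, k)) /eqP /= E; move/forallP : ce' => /(_ (x, k)) /eqP /= E'.
  by move: E E'; rewrite inE hE => -> [].
have V t (tL : (t < L.+1)%N) x : e.1 (x, Ordinal tL) = e'.1 (x, Ordinal tL).
  elim: t tL x => [|t IH] tL x.
    have -> : Ordinal tL = ord0 by apply/val_inj.
    by rewrite (eqP (b x)) (eqP (b' x)).
  have tL' : (t < L)%N by [].
  have := row (Ordinal tL'); have -> : row_in (Ordinal tL') = Ordinal (ltnW tL) by apply/val_inj.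
  have -> : row_out (Ordinal tL') = Ordinal tL by apply/val_inj.
  by move=> H; have [] := H (IH _) x.
have V' x t : e.1 (x, t) = e'.1 (x, t) by case: t => t tL; exact: V.
have E1 : e.1 = e'.1 by apply/ffunP => -[x t].
have E2 : e.2 = e'.2 by apply/ffunP => -[x k]; have [] := row k (fun x => V' x _) x.
by case: e e' E1 E2 {b b' ce ce' rrE row V V'} => [u v] [u' v'] /= -> ->.
Qed.

(** Recording the arrow across the cut in the ambiguous rows alone is injective by [cons_unique]. *)
Lemma ens_count_le c :
  \sum_(e : ens N L | bd_ens e) (cons_ens c e : nat)%:R
  <= \sum_(ka : {ffun 'I_L -> bool}) \prod_k ((ka k ==> rr c k) : nat)%:R :> R.
Proof.
pose A := [set e : ens N L | bd_ens e && cons_ens c e]%SET.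
pose B := [set ka : {ffun 'I_L -> bool} | [forall k, ka k ==> rr c k]]%SET.
pose f (e : ens N L) : {ffun 'I_L -> bool} := [ffun k => rr c k && e.2 (ord_max, k)].
have -> : \sum_(e : ens N L | bd_ens e) (cons_ens c e : nat)%:R = #|A|%:R :> R.
  rewrite -sum1_card natr_sum big_mkcond [RHS]big_mkcond; apply: eq_bigr => e _.
  by rewrite inE; case: bd_ens; case: cons_ens.
have -> : \sum_(ka : {ffun 'I_L -> bool}) \prod_k ((ka k ==> rr c k) : nat)%:R = #|B|%:R :> R.
  rewrite -sum1_card natr_sum [RHS]big_mkcond; apply: eq_bigr => ka _.
  by rewrite inE -nat_forall; case: forallP.
rewrite ler_nat.
have <- : #|f @: A| = #|A|.
  apply: card_in_imset => e e'; rewrite !inE => /andP[b ce] /andP[b' ce'] /ffunP fE.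
  apply: (cons_unique b b' ce ce') => k rk.
  by have := fE k; rewrite !ffunE rk.
apply: subset_leq_card; apply/fintype.subsetP => ka /imsetP[e _ ->].
by rewrite inE; apply/forallP => k; rewrite ffunE; apply/implyP => /andP[].
Qed.

Definition beta : R := 1 - (1 - b1) * (1 - b2).

(** Rows are independent, and a row is ambiguous with probability [beta ^+ N]; expanding the product
    over rows gives one factor per row. *)
Lemma partition_le : EF b1 b2 (fun c => \sum_(e : ens N L | bd_ens e) (cons_ens c e : nat)%:R)
  <= (1 + beta ^+ N) ^+ L.
Proof.
apply: (le_trans (ev_le EFP ens_count_le)).
have -> : EF b1 b2 (fun c => \sum_(ka : {ffun 'I_L -> bool}) \prod_k ((ka k ==> rr c k) : nat)%:R)
   = \sum_(ka : {ffun 'I_L -> bool}) \prod_k (if ka k then beta ^+ N else 1).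
  rewrite /EF; under eq_bigr do rewrite mulr_sumr.
  rewrite exchange_big; apply: eq_bigr => ka _.
  have -> : \prod_k (if ka k then beta ^+ N else 1) =
     \prod_(p : 'I_N * 'I_L) EC b1 b2 (fun z => ((ka p.2 ==> (z != (false, false))) : nat)%:R).
    rewrite -(pair_big predT predT (fun x k => EC b1 b2 (fun z => ((ka k ==> (z != (false, false))) : nat)%:R))) /=.
    rewrite exchange_big; apply: eq_bigr => k _.
    rewrite prodr_const card_ord; case: (ka k) => /=.
      by congr (_ ^+ _); rewrite /EC /EB /beta /=; ring.
    by rewrite (ev_cst (EC_expect b1_01 b2_01)) expr1n.
  rewrite -EF_prod /EF; apply: eq_bigr => c _; congr (_ * _).
  rewrite [RHS](eq_bigr (fun p : 'I_N * 'I_L => ((ka p.2 ==> (c (p.1, p.2) != (false, false))) : nat)%:R)); last by case.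
  rewrite -(pair_big predT predT (fun x k => ((ka k ==> (c (x, k) != (false, false))) : nat)%:R)) /=.
  rewrite exchange_big; apply: eq_bigr => k _; rewrite -nat_forall /rr.
  by case: (ka k) => //=; case: forallP => // -[].
rewrite -(bigA_distr_bigA (fun (k : 'I_L) (b : bool) => if b then beta ^+ N else 1)) /=.
by rewrite (eq_bigr (fun=> 1 + beta ^+ N)) ?prodr_const ?card_ord // => k _; rewrite big_bool addrC.
Qed.

(** The numerator counts [emin] on the event, plus other compatible ensembles, whose mean number is
    at most the normalising sum minus 1. Since [emin] always exists that sum is at least 1, and
    dividing by it only lowers the bound. *)
Lemma sv_prob_le (E : pred (ens N L)) :
  sv_prob b1 b2 N L psi E <= EF b1 b2 (fun c => ind R (E (emin c))) + ((1 + beta ^+ N) ^+ L - 1).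
Proof.
rewrite /sv_prob; set den := \sum_(e | is_ensemble _ _) _; set num := \sum_(e | _) _.
pose nn c : R := \sum_(e : ens N L | bd_ens e) (cons_ens c e : nat)%:R.
have denE : den = EF b1 b2 nn.
  rewrite /den (eq_bigl (fun e => is_ensemble psi e && true)); last by move=> e; rewrite andbT.
  rewrite (sum_weight xpredT); congr EF; apply/funext => c.
  by apply: eq_bigl => e; rewrite andbT.
have numE : num = EF b1 b2 (fun c => \sum_(e : ens N L | bd_ens e && E e) (cons_ens c e : nat)%:R).
  exact: sum_weight.
have nnE c : nn c = 1 + \sum_(e : ens N L | bd_ens e && (e != emin c)) (cons_ens c e : nat)%:R.
  by rewrite /nn (bigD1 (emin c)) ?bd_emin //= cons_emin.
have den1 : 1 <= den.
  by rewrite denE -(ev1 EFP); apply: (ev_le EFP) => c; rewrite nnE lerDl sumr_ge0.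
have num_le : num <= EF b1 b2 (fun c => ind R (E (emin c))) + (den - 1).
  rewrite denE numE.
  have -> : EF b1 b2 nn - 1 = EF b1 b2 (fun c => nn c - 1).
    have -> : (fun c => nn c - 1) = (fun c => nn c + (-1) * 1) by apply/funext => c; rewrite mulr1.
    by rewrite (evD EFP) (evZ EFP) mulN1r (ev1 EFP).
  rewrite -(evD EFP); apply: (ev_le EFP) => c.
  rewrite nnE [1 + _]addrC addrK.
  rewrite (bigID (fun e => e == emin c)) /=; apply: lerD.
    rewrite (eq_bigl (fun e => (e == emin c) && E (emin c))); last first.
      by move=> e; case: eqP => [->|]; rewrite ?bd_emin ?andbF ?andbT.
    by rewrite big_mkcondr big_pred1_eq /ind cons_emin; case: ifP.
  rewrite big_mkcond [X in _ <= X]big_mkcond; apply: ler_sum => e _.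
  by case: bd_ens => //=; case: (E e) => //=; case: ifP.
have den0 : 0 < den by apply: lt_le_trans ltr01 den1.
have P0 : 0 <= EF b1 b2 (fun c => ind R (E (emin c))) by apply: (ev_ge0 EFP).
apply: (@le_trans _ _ (EF b1 b2 (fun c => ind R (E (emin c))) + (den - 1))).
  rewrite ler_pdivrMr //; apply: (le_trans num_le).
  by rewrite ler_peMr // addr_ge0 // subr_ge0.
by rewrite lerD2l lerD2r denE; exact: partition_le.
Qed.

Lemma sv_prob_ge0 (E : pred (ens N L)) : 0 <= sv_prob b1 b2 N L psi E.
Proof.
have w0 e : 0 <= ens_weight b1 b2 e.
  by rewrite ens_weightE; apply: (ev_ge0 EFP).
by rewrite /sv_prob divr_ge0 // sumr_ge0.
Qed.

End Reduction.

(** * The upwind scheme and doubling of variables *)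

Section Flux.
Variables (R : realType) (b1 b2 : R).
Hypotheses (b1_gt0 : 0 < b1) (b1_lt_b2 : b1 < b2) (b2_lt1 : b2 < 1).
Let ka := kappa b1 b2.

Lemma kappa_gt1 : 1 < kappa b1 b2.
Proof.
have h1 := b1_lt_b2; have h2 := b2_lt1.
by rewrite /kappa ltr_pdivlMr; lra.
Qed.

Let den_ge1 z : 0 <= z -> 1 <= (ka - 1) * z + 1.
Proof. by move=> z0; rewrite lerDr mulr_ge0 // subr_ge0 ltW // kappa_gt1. Qed.

Lemma phi_sub x y : 0 <= x -> 0 <= y -> phi b1 b2 y - phi b1 b2 x =
  ka * (y - x) / (((ka - 1) * x + 1) * ((ka - 1) * y + 1)).
Proof.
move=> x0 y0; rewrite /phi -/ka; field.
by rewrite !gt_eqF // (lt_le_trans ltr01 (den_ge1 _)).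
Qed.

Lemma phi_le x y : 0 <= x -> x <= y -> phi b1 b2 x <= phi b1 b2 y.
Proof.
move=> x0 xy; have y0 := le_trans x0 xy.
have k0 := lt_trans ltr01 kappa_gt1.
have dx := le_trans ler01 (den_ge1 x0); have dy := le_trans ler01 (den_ge1 y0).
rewrite -subr_ge0 phi_sub //; apply: divr_ge0; apply: mulr_ge0 => //.
  exact: ltW.
by rewrite subr_ge0.
Qed.

Lemma phi_lip x y : 0 <= x -> x <= y -> phi b1 b2 y - phi b1 b2 x <= ka * (y - x).
Proof.
move=> x0 xy; have y0 := le_trans x0 xy.
have k0 := lt_trans ltr01 kappa_gt1.
rewrite phi_sub // ler_pdivrMr; last first.
  by rewrite mulr_gt0 // (lt_le_trans ltr01 (den_ge1 _)).
rewrite ler_peMr //; first by rewrite mulr_ge0 ?subr_ge0 ?(ltW k0).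
by rewrite mulr_ege1 ?den_ge1.
Qed.

Lemma phi_lip_norm x y : 0 <= x -> 0 <= y ->
  `|phi b1 b2 y - phi b1 b2 x| <= ka * `|y - x|.
Proof.
move=> x0 y0; have [xy|/ltW yx] := leP x y.
  rewrite ger0_norm ?subr_ge0 ?phi_le // ger0_norm ?subr_ge0 //; exact: phi_lip.
rewrite distrC (distrC y) ger0_norm ?subr_ge0 ?phi_le // ger0_norm ?subr_ge0 //; exact: phi_lip.
Qed.

Lemma phi0 : phi b1 b2 0 = 0.
Proof. by rewrite /phi mulr0 mul0r. Qed.

Lemma phi1 : phi b1 b2 1 = 1.
Proof.
rewrite /phi !mulr1 subrK divff // gt_eqF //.
exact: lt_trans ltr01 kappa_gt1.
Qed.

Lemma phi_01 x : 0 <= x <= 1 -> 0 <= phi b1 b2 x <= 1.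
Proof.
move=> /andP[x0 x1]; apply/andP; split; first by rewrite -phi0 phi_le.
by rewrite -[X in _ <= X]phi1 phi_le.
Qed.

(** The flux [phi] is the horizontal density in equilibrium with a given vertical density, which
    ties the microscopic model to the conservation law. *)
Lemma phi_balance x : 0 <= x -> phi b1 b2 x * (1 - x) * (1 - b2) =
  (1 - phi b1 b2 x) * x * (1 - b1).
Proof.
move=> x0; have d := lt_le_trans ltr01 (den_ge1 x0).
have b21 : 1 - b2 != 0 by rewrite gt_eqF // subr_gt0.
have -> : 1 - b1 = ka * (1 - b2) by rewrite /ka /kappa divfK.
rewrite /phi -/ka; field.
by rewrite gt_eqF.
Qed.

End Flux.

(** * The penalty and the monotone scheme *)

Section Penalty.
Variable R : realType.
Implicit Types s t : R.

Definition pen0 s : R := if s < 0 then 0 else if s < 1 then s ^+ 2 / 2 else s - 1 / 2.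
Definition dpen0 s : R := if s < 0 then 0 else if s < 1 then s else 1.

Lemma pen0_le s t : pen0 t <= pen0 s + dpen0 s * (t - s) + (t - s) ^+ 2 / 2.
Proof.
rewrite /pen0 /dpen0.
have h1 := sqr_ge0 (t - 1); have h2 := sqr_ge0 t; have h3 := sqr_ge0 (t - s).
have [s0|s0] := ltP s 0; last have [s1|s1] := ltP s 1; (have [t0|t0] := ltP t 0; last have [t1|t1] := ltP t 1).
- by lra.
- have : 0 <= (0 - s) * ((t - s) + t) by apply: mulr_ge0; lra.
  by lra.
- have : 0 <= (0 - s) * ((t - s) + t) by apply: mulr_ge0; lra.
  by lra.
- by lra.
- by lra.
- by lra.
- have : 0 <= (s - 1) * ((s - t) + (1 - t)) by apply: mulr_ge0; lra.
  by lra.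
- have : 0 <= (s - 1) * ((s - t) + (1 - t)) by apply: mulr_ge0; lra.
  by lra.
- by lra.
Qed.

Lemma pen0_incr s t : s <= t -> 0 <= pen0 t - pen0 s <= t - s.
Proof.
move=> st; rewrite /pen0.
have h1 := sqr_ge0 (t - 1); have h2 := sqr_ge0 t; have h4 := sqr_ge0 s; have h5 := sqr_ge0 (s - 1).
have [s0|s0] := ltP s 0; last have [s1|s1] := ltP s 1; (have [t0|t0] := ltP t 0; last have [t1|t1] := ltP t 1);
  try by apply/andP; split; lra.
- have : 0 <= t * (1 - t) by apply: mulr_ge0; lra.
  by move=> ?; apply/andP; split; lra.
- have : 0 <= (t - s) * (t + s) by apply: mulr_ge0; lra.
  have : 0 <= (t - s) * (1 - t + (1 - s)) by apply: mulr_ge0; lra.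
  by move=> ? ?; apply/andP; split; lra.
- have : 0 <= (1 - s) * (1 + s) by apply: mulr_ge0; lra.
  by move=> ?; apply/andP; split; lra.
Qed.

Lemma dpen0_01 s : 0 <= dpen0 s <= 1.
Proof. by rewrite /dpen0; have [s0|s0] := ltP s 0; last have [s1|s1] := ltP s 1; apply/andP; split; lra. Qed.

Lemma dpen0_le s t : s <= t -> dpen0 s <= dpen0 t.
Proof.
move=> st; rewrite /dpen0.
by have [s0|s0] := ltP s 0; last have [s1|s1] := ltP s 1; (have [t0|t0] := ltP t 0; last have [t1|t1] := ltP t 1); lra.
Qed.

Lemma pen0_pos s : s <= pen0 s + 1 / 2.
Proof.
rewrite /pen0; have h := sqr_ge0 (s - 1).
by have [s0|s0] := ltP s 0; last have [s1|s1] := ltP s 1; lra.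
Qed.

(* A C^{1,1} penalty with slopes in [0, 1], the range of densities. *)
Definition pen (al s : R) := al * pen0 (s / al).
Definition dpen (al s : R) := dpen0 (s / al).
Variable al : R.
Hypothesis al0 : 0 < al.
Let alN0 : al != 0. Proof. by rewrite gt_eqF. Qed.

(** A one-sided Taylor bound. It controls both the difference quotient taken by the scheme and the
    displacement by the unknown shift. *)
Lemma pen_le s t : pen al t <= pen al s + dpen al s * (t - s) + (t - s) ^+ 2 / (2 * al).
Proof.
have := pen0_le (s / al) (t / al); rewrite -(ler_pM2l al0) /pen /dpen => /le_trans; apply.
rewrite le_eqVlt; apply/orP; left; apply/eqP; rewrite !exprS expr0; field.
by rewrite alN0.
Qed.

Lemma pen_incr s t : s <= t -> 0 <= pen al t - pen al s <= t - s.
Proof.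
move=> st; have st' : s / al <= t / al by rewrite ler_pM2r ?invr_gt0.
have /andP[h1 h2] := pen0_incr st'.
rewrite /pen -mulrBr mulr_ge0 ?(ltW al0) //=.
move: h2; rewrite -(ler_pM2l al0) => /le_trans; apply.
by rewrite -mulrBl mulrC divfK.
Qed.

Lemma dpen_01 s : 0 <= dpen al s <= 1. Proof. exact: dpen0_01. Qed.

Lemma dpen_le s t : s <= t -> dpen al s <= dpen al t.
Proof. by move=> st; apply: dpen0_le; rewrite ler_pM2r ?invr_gt0. Qed.

Lemma pen_ge s : Num.max 0 s <= pen al s + al / 2.
Proof.
have p0 : 0 <= pen al s.
  rewrite /pen mulr_ge0 ?(ltW al0) // /pen0.
  by case: (ltP (s / al) 0) => ?; case: (ltP (s / al) 1) => ?; rewrite ?divr_ge0 ?sqr_ge0 //; lra.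
rewrite ge_max; apply/andP; split; first by rewrite addr_ge0 // divr_ge0 // ltW.
have := pen0_pos (s / al); rewrite -(ler_pM2l al0) mulrCA divff // mulr1 /pen.
by rewrite mulrDr mul1r.
Qed.

Lemma pen_0 : pen al 0 = 0.
Proof. by rewrite /pen /pen0 mul0r ltxx ltr01 expr0n /= mul0r mulr0. Qed.

End Penalty.

(** The index [(j + m).-1] is the left neighbour of j moved up by one period, which keeps it a
    natural number; heights are periodic up to a constant, so the slope is the same. *)
Fixpoint scheme (R : realType) (b1 b2 : R) (m : nat) (dt : R) (v0 : nat -> R)
    (n j : nat) : R :=
  if n is n'.+1 then
    scheme b1 b2 m dt v0 n' j - dt * phi b1 b2
      (m%:R * (scheme b1 b2 m dt v0 n' (j + m) - scheme b1 b2 m dt v0 n' (j + m).-1))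
  else v0 j.

Section Scheme.
Variables (R : realType) (b1 b2 : R) (m : nat) (dt K : R) (v0 : nat -> R).
Hypotheses (b1_gt0 : 0 < b1) (b1_lt_b2 : b1 < b2) (b2_lt1 : b2 < 1).
Hypotheses (m_gt0 : (0 < m)%N) (dt_ge0 : 0 <= dt) (cfl : kappa b1 b2 * dt * m%:R <= 1).
Hypothesis v0_slope : forall j, 0 <= m%:R * (v0 j.+1 - v0 j) <= 1.
Hypothesis v0_per : forall j, v0 (j + m)%N = v0 j + K.

Let v := scheme b1 b2 m dt v0.
Let ph := phi b1 b2.
Definition gsch n j := m%:R * (scheme b1 b2 m dt v0 n j.+1 - scheme b1 b2 m dt v0 n j).
Let g := gsch.

Lemma scheme_per n j : scheme b1 b2 m dt v0 n (j + m) = scheme b1 b2 m dt v0 n j + K.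
Proof.
elim: n j => [|n IH] j /=; first exact: v0_per.
have -> : ((j + m + m).-1 = (j + m).-1 + m)%N by rewrite -!subn1 addnBAC // addn_gt0 m_gt0 orbT.
rewrite !IH; set x := scheme _ _ _ _ _ n j; set y := scheme _ _ _ _ _ n _.
have -> : x + K + K - (y + K) = x + K - y by ring.
by ring.
Qed.

Lemma gsch_per n j : gsch n (j + m) = gsch n j.
Proof. by rewrite /gsch -addSn !scheme_per; ring. Qed.

Lemma schemeS n j : scheme b1 b2 m dt v0 n.+1 j =
  scheme b1 b2 m dt v0 n j - dt * phi b1 b2 (gsch n (j + m).-1).
Proof. by rewrite /= /gsch prednK // addn_gt0 m_gt0 orbT. Qed.

Lemma gschS n j : gsch n.+1 j =
  gsch n j - dt * m%:R * (phi b1 b2 (gsch n j) - phi b1 b2 (gsch n (j + m).-1)).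
Proof.
rewrite {1}/gsch !schemeS addSn /= gsch_per /gsch; ring.
Qed.

(** The flux entering a cell lies in [0, 1], and the CFL condition bounds the outflow by the content
    x of the cell and, symmetrically, the gain by its vacancy 1 - x. *)
Lemma gsch_01 n j : 0 <= gsch n j <= 1.
Proof.
elim: n j => [|n IH] j; first exact: v0_slope.
rewrite gschS; set x := gsch n j; set y := gsch n _.
have /andP[x0 x1] : 0 <= x <= 1 by exact: IH.
have /andP[y0 y1] := phi_01 b1_lt_b2 b2_lt1 (IH (j + m).-1).
have l1 := phi_lip b1_lt_b2 b2_lt1 (lexx 0) x0; rewrite phi0 !subr0 in l1.
have l2 := phi_lip b1_lt_b2 b2_lt1 x0 x1; rewrite phi1 // in l2.
have mu0 : 0 <= dt * m%:R by rewrite mulr_ge0.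
have k1 := ler_wpM2l mu0 l1; have k2 := ler_wpM2l mu0 l2.
have c1 := ler_wpM2r x0 cfl.
have x1' : 0 <= 1 - x by rewrite subr_ge0.
have c2 := ler_wpM2r x1' cfl.
have k3 := mulr_ge0 mu0 y0.
have y1' : 0 <= 1 - phi b1 b2 y by rewrite subr_ge0.
have k4 := mulr_ge0 mu0 y1'.
by apply/andP; split; nra.
Qed.

(** If the slope decreases, the flux does too. If it increases, it does so by at most m times the
    increase of the right node, and the CFL condition makes the extra flux smaller than that
    increase. *)
Lemma update_mono (x y x' y' : R) : x <= x' -> y <= y' ->
  0 <= m%:R * (x - y) <= 1 -> 0 <= m%:R * (x' - y') <= 1 ->
  x - dt * phi b1 b2 (m%:R * (x - y)) <= x' - dt * phi b1 b2 (m%:R * (x' - y')).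
Proof.
move=> xx yy /andP[s0 _] /andP[s0' _].
have mr : 0 < m%:R :> R by rewrite ltr0n.
have [le|/ltW le] := leP (m%:R * (x' - y')) (m%:R * (x - y)).
  by apply: lerB => //; apply: ler_wpM2l => //; exact: phi_le.
have l := ler_wpM2l dt_ge0 (phi_lip b1_lt_b2 b2_lt1 s0 le).
have d0 : 0 <= (x' - y') - (x - y) by move: le; rewrite ler_pM2l // subr_ge0.
have c := ler_wpM2r d0 cfl.
by nra.
Qed.

End Scheme.

(** * Doubling of variables *)

Section Doubling.
Variables (R : realType) (b1 b2 : R) (m N W S : nat) (dt K tau al : R) (v0 : nat -> R)
  (u : nat -> nat -> R).
Hypotheses (b1_gt0 : 0 < b1) (b1_lt_b2 : b1 < b2) (b2_lt1 : b2 < 1).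
Hypotheses (m_gt0 : (0 < m)%N) (dt_ge0 : 0 <= dt) (cfl : kappa b1 b2 * dt * m%:R <= 1).
Hypothesis v0_slope : forall j, 0 <= m%:R * (v0 j.+1 - v0 j) <= 1.
Hypothesis v0_per : forall j, v0 (j + m)%N = v0 j + K.
Hypotheses (al_gt0 : 0 < al) (N_gt0 : (0 < N)%N) (WN : (W <= N)%N).
Hypothesis u_per : forall n X, u n (X + N)%N = u n X + K.

Let v := scheme b1 b2 m dt v0.
Let Nr0 : 0 < N%:R :> R. Proof. by rewrite ltr0n. Qed.
Let mr0 : 0 < m%:R :> R. Proof. by rewrite ltr0n. Qed.
Let w : R := W%:R / N%:R.

(** Error per time step, in order: the difference quotient of the penalty in place of its slope; the
    second-order term of the shift; the rounding of the density, once against the shift and once in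
    the flux; the error of the microscopic inequalities. *)
Definition doubling_error : R :=
  kappa b1 b2 * dt / (2 * al * m%:R) + w ^+ 2 / (2 * al) + w / N%:R
  + kappa b1 b2 * dt / N%:R + tau.

(** The slope of the penalty rounded down to a multiple of 1/N, since the inequalities for [u] hold
    only for finitely many densities. *)
Let grid s := Num.truncn (dpen al s * N%:R).

Let grid_le s : (grid s <= N)%N.
Proof.
have /andP[d0 d1] := dpen_01 al s.
rewrite -(@ler_nat R); apply: (@le_trans _ _ (dpen al s * N%:R)).
  by rewrite truncn_le mulr_ge0 // ltW.
by rewrite ler_piMl // ltW.
Qed.

Let grid_bounds s : (grid s)%:R / N%:R <= dpen al s <= (grid s)%:R / N%:R + N%:R^-1.
Proof.
have /andP[d0 d1] := dpen_01 al s.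
have /andP[h1 h2] := truncn_itv (mulr_ge0 d0 (ltW Nr0)).
apply/andP; split; first by rewrite ler_pdivrMr.
rewrite -[X in _ + X]mul1r -mulrDl ler_pdivlMr // natr1; exact: ltW.
Qed.

Hypothesis u_lower : forall n X k, (n < S)%N -> (W <= X)%N -> (k <= N)%N ->
  exists2 r, (r <= W)%N &
    u n (X - r)%N + k%:R / N%:R * (r%:R / N%:R) - dt * phi b1 b2 (k%:R / N%:R) - tau
    <= u n.+1 X.
Hypothesis u_upper : forall n X k, (n < S)%N -> (W <= X)%N -> (k <= N)%N ->
  exists2 r, (r <= W)%N & u n.+1 X <=
    u n (X - r)%N + k%:R / N%:R * (r%:R / N%:R) - dt * phi b1 b2 (k%:R / N%:R) + tau.
Hypothesis u_init_lower : forall j X,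
  v0 j <= u 0 X + Num.max 0 (j%:R / m%:R - X%:R / N%:R).
Hypothesis u_init_upper : forall j X,
  u 0 X <= v0 j + Num.max 0 (X%:R / N%:R - j%:R / m%:R).

Let ratio_shift j X : (j + m)%:R / m%:R - (X + N)%:R / N%:R = j%:R / m%:R - X%:R / N%:R :> R.
Proof. by rewrite !natrD; field; rewrite !gt_eqF. Qed.

Let k0 : 0 <= kappa b1 b2.
Proof. exact: ltW (lt_trans ltr01 (kappa_gt1 b1_lt_b2 b2_lt1)). Qed.

Let phi_diff x y d : 0 <= x -> 0 <= y -> 0 <= d -> y - x <= d ->
  dt * phi b1 b2 y - dt * phi b1 b2 x <= kappa b1 b2 * dt * d.
Proof.
move=> x0 y0 d0 yxd; have -> : kappa b1 b2 * dt * d = dt * (kappa b1 b2 * d) by ring.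
rewrite -mulrBr; apply: ler_wpM2l => //.
have [xy|/ltW yx] := leP x y.
  by apply: (le_trans (phi_lip b1_lt_b2 b2_lt1 x0 xy)); rewrite ler_wpM2l.
apply: (@le_trans _ _ 0); last by rewrite mulr_ge0.
by rewrite subr_le0 phi_le.
Qed.

(** Induction in time. The scheme is moved first, by monotonicity against the barrier u + pen; then
    u is moved by its inequality at the density equal to the penalty slope, where the gain [rho * q]
    of the shift matches the first-order growth of the penalty. The initial [al / 2] is the gap
    between the penalty and the positive part. *)
Lemma doubling_lower n : (n <= S)%N -> forall j X,
  v n j <= u n X + pen al (j%:R / m%:R - X%:R / N%:R) + (al / 2 + n%:R * doubling_error).
Proof.
elim: n => [|n IH] nS j X.
  rewrite mul0r addr0; apply: (le_trans (u_init_lower j X)).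
  by rewrite -addrA lerD2l pen_ge.
set Th := al / 2 + n%:R * doubling_error.
pose e1 : R := kappa b1 b2 * dt / (2 * al * m%:R).
(* The half step in which only the scheme moves. [Q] lies above the scheme and has slopes in [0, 1],
   so [update_mono] applies. *)
have stepA i Y : (0 < i)%N -> v n.+1 i <= u n Y + pen al (i%:R / m%:R - Y%:R / N%:R)
      + Th - dt * phi b1 b2 (dpen al (i%:R / m%:R - Y%:R / N%:R)) + e1.
  move=> i0; set s := i%:R / m%:R - Y%:R / N%:R.
  pose Q k := u n Y + pen al (k%:R / m%:R - Y%:R / N%:R) + Th.
  have Qv k : v n k <= Q k by exact: (IH (ltnW nS)).
  have iE : i%:R / m%:R = i.-1%:R / m%:R + m%:R^-1 :> R.
    by rewrite -[X in _ + X]mul1r -mulrDl natr1 prednK.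
  have mi0 : 0 <= m%:R^-1 :> R by rewrite invr_ge0 ltW.
  have /andP[q0 q1] : 0 <= m%:R * (Q i - Q i.-1) <= 1.
    have le : i.-1%:R / m%:R - Y%:R / N%:R <= s by rewrite lerD2r iE lerDl.
    have /andP[p0 p1] := pen_incr al_gt0 le.
    have -> : Q i - Q i.-1 = pen al s - pen al (i.-1%:R / m%:R - Y%:R / N%:R) by rewrite /Q /s; ring.
    rewrite mulr_ge0 ?(ltW mr0) //=.
    rewrite -[X in _ <= X](@divff _ (m%:R : R)) ?gt_eqF // ler_pM2l //; apply: (le_trans p1); rewrite /s iE; lra.
  have vE : v n.+1 i = v n i - dt * phi b1 b2 (m%:R * (v n i - v n i.-1)).
    rewrite /v (schemeS _ _ _ _ m_gt0) /gsch.
    have -> : (i + m).-1 = (i.-1 + m)%N by rewrite -{1}(prednK i0).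
    by rewrite -addSn (prednK i0) !(scheme_per _ _ _ m_gt0 v0_per); congr (_ - _ * phi _ _ _); ring.
  have gi : 0 <= m%:R * (v n i - v n i.-1) <= 1.
    have := gsch_01 b1_lt_b2 b2_lt1 m_gt0 dt_ge0 cfl v0_slope v0_per n i.-1.
    by rewrite /gsch (prednK i0).
  have := update_mono b1_lt_b2 b2_lt1 m_gt0 dt_ge0 cfl (Qv i) (Qv i.-1) gi.
  rewrite q0 q1 -vE => /(_ isT) /le_trans; apply.
  have /andP[d0 _] := dpen_01 al s.
  have := @phi_diff (m%:R * (Q i - Q i.-1)) (dpen al s) (2 * al * m%:R)^-1 q0 d0.
  rewrite invr_ge0 !mulr_ge0 ?(ltW al_gt0) ?(ltW mr0) // -/e1 => /(_ isT).
  move=> H; suff /H : dpen al s - m%:R * (Q i - Q i.-1) <= (2 * al * m%:R)^-1.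
    by rewrite /Q -/s -/e1; lra.
  have := pen_le al_gt0 s (s - m%:R^-1).
  have -> : Q i - Q i.-1 = pen al s - pen al (s - m%:R^-1).
    by rewrite /Q /s iE [_ + m%:R^-1 - _]addrAC addrK; ring.
  rewrite -(ler_pM2l mr0) => P.
  have E : m%:R * (pen al s + dpen al s * (s - m%:R^-1 - s) + (s - m%:R^-1 - s) ^+ 2 / (2 * al)) =
     m%:R * pen al s - dpen al s + (2 * al * m%:R)^-1.
    by field; rewrite !gt_eqF.
  by rewrite E in P; lra.
(* Both points are moved up by one period, so that [j'.-1] and [X' - r] are true predecessors. *)
pose j' := (j + m)%N; pose X' := (X + N)%N.
pose s : R := j%:R / m%:R - X%:R / N%:R.
suff : v n.+1 j' <= u n.+1 X' + pen al s + (Th + doubling_error).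
  rewrite /v /j' (scheme_per _ _ _ m_gt0 v0_per) u_per /Th -[n.+1%:R]natr1 mulrDl mul1r.
  by rewrite -/s -/v; lra.
have [r rW Hr] := @u_lower n X' (grid s) nS (leq_trans WN (leq_addl _ _)) (grid_le s).
have j'0 : (0 < j')%N by rewrite addn_gt0 m_gt0 orbT.
have := stepA j' (X' - r)%N j'0.
pose q : R := r%:R / N%:R.
have rX : (r <= X')%N by rewrite (leq_trans rW) // (leq_trans WN) // leq_addl.
have -> : j'%:R / m%:R - (X' - r)%N%:R / N%:R = s + q :> R.
  by rewrite natrB // mulrBl /s -ratio_shift /q /j' /X'; ring.
move=> HA.
have q0 : 0 <= q by rewrite divr_ge0.
have qw : q <= w by rewrite ler_pM2r ?invr_gt0 // ler_nat.
have P := pen_le al_gt0 s (s + q).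
rewrite [s + q - s]addrAC subrr add0r in P.
have /andP[g1 g2] := grid_bounds s.
have D := dpen_le al_gt0 (_ : s <= s + q); rewrite lerDl in D; have {}D := D q0.
have G0 : 0 <= (grid s)%:R / N%:R :> R by rewrite divr_ge0.
(* The rounded density is below the slope at s, which is below the slope at s + q: the flux terms
   compare by monotonicity, without a Lipschitz loss. *)
have F := phi_le b1_lt_b2 b2_lt1 G0 (le_trans g1 D).
have {}F := ler_wpM2l dt_ge0 F.
have E1 : (dpen al s - (grid s)%:R / N%:R) * q <= w / N%:R.
  rewrite [X in _ <= X]mulrC; apply: ler_pM => //; first by rewrite subr_ge0.
  by rewrite lerBlDl.
have E2 : q ^+ 2 / (2 * al) <= w ^+ 2 / (2 * al).
  rewrite ler_pM2r ?invr_gt0 ?mulr_gt0 // ler_sqr ?nnegrE //.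
  exact: le_trans q0 qw.
have E3 : 0 <= kappa b1 b2 * dt / N%:R.
  by apply: divr_ge0; [exact: mulr_ge0|exact: ltW].
by move: Hr HA P E1 E2 E3 F; rewrite -/q /doubling_error -/e1 !mulrBl; lra.
Qed.

(** The same argument with the roles of scheme and particles exchanged. Rounding the density down
    now helps in the shift term and costs [kappa * dt / N] in the flux. *)
Lemma doubling_upper n : (n <= S)%N -> forall j X,
  u n X <= v n j + pen al (X%:R / N%:R - j%:R / m%:R) + (al / 2 + n%:R * doubling_error).
Proof.
elim: n => [|n IH] nS j X.
  rewrite mul0r addr0; apply: (le_trans (u_init_upper j X)).
  by rewrite -addrA lerD2l pen_ge.
set Th := al / 2 + n%:R * doubling_error.
pose e1 : R := kappa b1 b2 * dt / (2 * al * m%:R).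
have stepA i Y : (0 < i)%N -> u n Y <= v n.+1 i + pen al (Y%:R / N%:R - i%:R / m%:R)
      + Th + dt * phi b1 b2 (dpen al (Y%:R / N%:R - i%:R / m%:R)) + e1.
  move=> i0; set s := Y%:R / N%:R - i%:R / m%:R.
  pose Q k := u n Y - pen al (Y%:R / N%:R - k%:R / m%:R) - Th.
  have Qv k : Q k <= v n k by have := IH (ltnW nS) k Y; rewrite /Q -/Th; lra.
  have iE : i%:R / m%:R = i.-1%:R / m%:R + m%:R^-1 :> R.
    by rewrite -[X in _ + X]mul1r -mulrDl natr1 prednK.
  have mi0 : 0 <= m%:R^-1 :> R by rewrite invr_ge0 ltW.
  have QE : Q i - Q i.-1 = pen al (s + m%:R^-1) - pen al s.
    have -> : s + m%:R^-1 = Y%:R / N%:R - i.-1%:R / m%:R by rewrite /s iE; ring.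
    by rewrite /Q -/s; ring.
  have /andP[q0 q1] : 0 <= m%:R * (Q i - Q i.-1) <= 1.
    have le : s <= s + m%:R^-1 by rewrite lerDl.
    have /andP[p0 p1] := pen_incr al_gt0 le.
    rewrite QE mulr_ge0 ?(ltW mr0) //=.
    rewrite -[X in _ <= X](@divff _ (m%:R : R)) ?gt_eqF // ler_pM2l //.
    by apply: (le_trans p1); lra.
  have vE : v n.+1 i = v n i - dt * phi b1 b2 (m%:R * (v n i - v n i.-1)).
    rewrite /v (schemeS _ _ _ _ m_gt0) /gsch.
    have -> : (i + m).-1 = (i.-1 + m)%N by rewrite -{1}(prednK i0).
    by rewrite -addSn (prednK i0) !(scheme_per _ _ _ m_gt0 v0_per); congr (_ - _ * phi _ _ _); ring.
  have gi : 0 <= m%:R * (v n i - v n i.-1) <= 1.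
    have := gsch_01 b1_lt_b2 b2_lt1 m_gt0 dt_ge0 cfl v0_slope v0_per n i.-1.
    by rewrite /gsch (prednK i0).
  have M := update_mono b1_lt_b2 b2_lt1 m_gt0 dt_ge0 cfl (Qv i) (Qv i.-1) _ gi.
  rewrite q0 q1 -vE in M; have {}M := M isT.
  have /andP[d0 _] := dpen_01 al s.
  have := @phi_diff (dpen al s) (m%:R * (Q i - Q i.-1)) (2 * al * m%:R)^-1 d0 q0.
  rewrite invr_ge0 !mulr_ge0 ?(ltW al_gt0) ?(ltW mr0) // -/e1 => /(_ isT).
  move=> H; suff /H : m%:R * (Q i - Q i.-1) - dpen al s <= (2 * al * m%:R)^-1.
    by move: M; rewrite {1}/Q -/s -/e1; lra.
  have := pen_le al_gt0 s (s + m%:R^-1).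
  rewrite QE -(ler_pM2l mr0) => P.
  have E : m%:R * (pen al s + dpen al s * (s + m%:R^-1 - s) + (s + m%:R^-1 - s) ^+ 2 / (2 * al)) =
     m%:R * pen al s + dpen al s + (2 * al * m%:R)^-1.
    by field; rewrite !gt_eqF.
  by rewrite E in P; lra.
pose j' := (j + m)%N; pose X' := (X + N)%N.
pose s : R := X%:R / N%:R - j%:R / m%:R.
suff : u n.+1 X' <= v n.+1 j' + pen al s + (Th + doubling_error).
  rewrite /v /j' (scheme_per _ _ _ m_gt0 v0_per) u_per /Th -[n.+1%:R]natr1 mulrDl mul1r.
  by rewrite -/s -/v; lra.
have [r rW Hr] := @u_upper n X' (grid s) nS (leq_trans WN (leq_addl _ _)) (grid_le s).
have j'0 : (0 < j')%N by rewrite addn_gt0 m_gt0 orbT.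
have := stepA j' (X' - r)%N j'0.
pose q : R := r%:R / N%:R.
have rX : (r <= X')%N by rewrite (leq_trans rW) // (leq_trans WN) // leq_addl.
have -> : (X' - r)%N%:R / N%:R - j'%:R / m%:R = s - q :> R.
  have sh := ratio_shift j X; rewrite natrB // mulrBl /s /q /j' /X'; move: sh; lra.
move=> HA.
have q0 : 0 <= q by rewrite divr_ge0.
have qw : q <= w by rewrite ler_pM2r ?invr_gt0 // ler_nat.
have P := pen_le al_gt0 s (s - q).
rewrite [s - q - s]addrAC subrr add0r sqrrN in P.
have /andP[g1 g2] := grid_bounds s.
have D := dpen_le al_gt0 (_ : s - q <= s); rewrite gerBl in D; have {}D := D q0.
have G0 : 0 <= (grid s)%:R / N%:R :> R by rewrite divr_ge0.
have /andP[d0 _] := dpen_01 al (s - q).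
have F := phi_le b1_lt_b2 b2_lt1 d0 D.
have {}F := ler_wpM2l dt_ge0 F.
have Ni0 : 0 <= N%:R^-1 :> R by rewrite invr_ge0 ltW.
have /andP[d0' _] := dpen_01 al s.
have F' := @phi_diff _ _ N%:R^-1 G0 d0' Ni0.
rewrite lerBlDl in F'; have {}F' := F' g2.
have E1 : (grid s)%:R / N%:R * q <= dpen al s * q by rewrite ler_wpM2r.
have E2 : q ^+ 2 / (2 * al) <= w ^+ 2 / (2 * al).
  rewrite ler_pM2r ?invr_gt0 ?mulr_gt0 // ler_sqr ?nnegrE //.
  exact: le_trans q0 qw.
have E3 : 0 <= w / N%:R.
  by apply: divr_ge0; [exact: le_trans q0 qw|exact: ltW].
by move: Hr HA P E1 E2 E3 F F'; rewrite -/q /doubling_error -/e1 mulrN; lra.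
Qed.

End Doubling.

(** * Smooth test functions and mollifiers *)

Section SmoothAlgebra.
Variable R : realType.

(** Smoothness is obtained algebraically: if the derivatives of the generators lie in the algebra,
    the algebra is stable under differentiation. Logistic functions, and cosine with sine, generate
    such algebras. *)
Inductive falg (B : (R -> R) -> Prop) : (R -> R) -> Prop :=
| falg_base f : B f -> falg B f
| falg_cst c : falg B (fun=> c)
| falg_add f g : falg B f -> falg B g -> falg B (fun x => f x + g x)
| falg_mul f g : falg B f -> falg B g -> falg B (fun x => f x * g x).

Definition falg_closed (B : (R -> R) -> Prop) :=
  forall f, B f -> exists2 df, falg B df & forall x : R, is_derive x 1 f (df x).

Lemma is_derive_mul (f g : R -> R) (x df dg : R) : is_derive x 1 f df -> is_derive x 1 g dg ->
  is_derive x 1 (fun x => f x * g x) (df * g x + f x * dg).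
Proof.
move=> Hf Hg; have := is_deriveM Hf Hg.
by rewrite /GRing.scale /= addrC [g x * _]mulrC.
Qed.

Lemma is_derive_mulr (f : R -> R) (r x df : R) : is_derive x 1 f df ->
  is_derive x 1 (fun x => f x * r) (df * r).
Proof.
by move=> Hf; have := is_derive_mul Hf (is_derive_cst r x 1); rewrite mulr0 addr0.
Qed.

Lemma is_derive_mull (f : R -> R) (r x df : R) : is_derive x 1 f df ->
  is_derive x 1 (fun x => r * f x) (r * df).
Proof.
by move=> Hf; have := is_derive_mul (is_derive_cst r x 1) Hf; rewrite mul0r add0r.
Qed.

Lemma falg_derive B : falg_closed B -> forall f, falg B f ->
  exists2 df, falg B df & forall x : R, is_derive x 1 f (df x).
Proof.
move=> clB f; elim=> {f} [f /clB//|c|f g Hf [df df1 df2] Hg [dg dg1 dg2]|f g Hf [df df1 df2] Hg [dg dg1 dg2]].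
- by exists (fun=> 0); [exact: falg_cst|move=> x; exact: is_derive_cst].
- by exists (fun x => df x + dg x); [exact: falg_add|move=> x; exact: is_deriveD].
- exists (fun x => df x * g x + f x * dg x).
    by apply: falg_add; apply: falg_mul.
  by move=> x; exact: is_derive_mul.
Qed.

Definition smooth1 (f : R -> R) := exists2 B, falg_closed B & falg B f.

Lemma smooth1_derive f : smooth1 f ->
  exists2 df, smooth1 df & forall x : R, is_derive x 1 f (df x).
Proof.
move=> [B clB Bf]; have [df d1 d2] := falg_derive clB Bf.
by exists df => //; exists B.
Qed.

Lemma is_derive_cont (f : R -> R) (x df : R) : is_derive x 1 f df -> {for x, continuous f}.
Proof. by move=> [d _]; apply/differentiable_continuous/derivable1_diffP. Qed.

Lemma smooth1_continuous f : smooth1 f -> continuous f.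
Proof. by move=> /smooth1_derive[df _ H] x; exact: is_derive_cont (H x). Qed.

Lemma is_derive_derive1 (f : R -> R) (x df : R) : is_derive x 1 f df -> derive1 f x = df.
Proof. by move=> H; rewrite derive1E; exact: derive_val. Qed.

Lemma smooth2_prod a g : smooth1 a -> smooth1 g -> smooth2 (fun x y => a x * g y).
Proof.
move=> + + n; elim: n a g => [|n IH] a g sa sg /=.
  move=> p; apply: cvgM.
    by apply: (continuous_comp (@cvg_fst _ _ _ _ _)); exact: smooth1_continuous.
  by apply: (continuous_comp (@cvg_snd _ _ _ _ _)); exact: smooth1_continuous.
have [da sda Ha] := smooth1_derive sa; have [dg sdg Hg] := smooth1_derive sg.
have -> : pdx (fun x y => a x * g y) = (fun x y => da x * g y).
  apply/funext=> x; apply/funext => y; exact: (is_derive_derive1 (is_derive_mulr (g y) (Ha x))).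
have -> : pdy (fun x y => a x * g y) = (fun x y => a x * dg y).
  apply/funext=> x; apply/funext => y; exact: (is_derive_derive1 (is_derive_mull (a x) (Hg y))).
split.
- move=> p; apply: cvgM.
    by apply: (continuous_comp (@cvg_fst _ _ _ _ _)); exact: smooth1_continuous.
  by apply: (continuous_comp (@cvg_snd _ _ _ _ _)); exact: smooth1_continuous.
- move=> x y; split.
    by have [] := is_derive_mulr (g y) (Ha x).
  by have [] := is_derive_mull (a x) (Hg y).
- exact: IH.
- exact: IH.
Qed.

Lemma falg_bounded B : (forall f, B f -> exists b : R, forall x, `|f x| <= b) ->
  forall f, falg B f -> exists b : R, forall x, `|f x| <= b.
Proof.
move=> bB f; elim=> {f} [f /bB//|c|f g _ [b1 h1] _ [b2 h2]|f g _ [b1 h1] _ [b2 h2]].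
- by exists `|c|.
- by exists (b1 + b2) => x; rewrite (le_trans (ler_normD _ _)) // lerD.
- by exists (b1 * b2) => x; rewrite normrM ler_pM.
Qed.

Lemma falg_exp B f n : falg B f -> falg B (fun x => f x ^+ n).
Proof.
move=> Bf; elim: n => [|n IH]; first exact: falg_cst.
have -> : (fun x => f x ^+ n.+1) = (fun x => f x * f x ^+ n) by apply/funext=> x; rewrite exprS.
exact: falg_mul.
Qed.

Lemma lip_of_derive (f df : R -> R) (b : R) : (forall x : R, is_derive x 1 f (df x)) ->
  (forall x, `|df x| <= b) -> forall x y, `|f x - f y| <= b * `|x - y|.
Proof.
move=> Hf Hb.
have H x y : x <= y -> `|f x - f y| <= b * `|x - y|.
  move=> xy; have cf : {within `[x, y], continuous f}.
    by apply: continuous_subspaceT => z; exact: is_derive_cont (Hf z).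
  have [c _ E] := MVT_segment xy (fun z _ => Hf z) cf.
  by rewrite distrC E normrM (distrC x) ler_wpM2r.
by move=> x y; case: (leP x y) => [/H//|/ltW /H]; rewrite distrC (distrC y).
Qed.

(* Logistic steps: smooth non-negative approximations of indicators of
   intervals, needed since test functions must be C^infinity. *)
Definition lgs (k a y : R) : R := (1 + expR (- (k * (y - a))))^-1.

Lemma lgs_gt0 k a y : 0 < lgs k a y.
Proof. by rewrite invr_gt0 addr_gt0 // expR_gt0. Qed.

Lemma lgs_lt1 k a y : lgs k a y < 1.
Proof. by rewrite invf_lt1 ?ltrDl ?expR_gt0 // addr_gt0 // expR_gt0. Qed.

Lemma is_derive_lgs k a (y : R) :
  is_derive y 1 (lgs k a) (k * lgs k a y * (1 - lgs k a y)).
Proof.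
pose f y := 1 + expR (- (k * (y - a))).
have f0 z : f z != 0 by rewrite gt_eqF // addr_gt0 // expR_gt0.
have df : is_derive y 1 f (- k * expR (- (k * (y - a)))).
  apply: is_derive_eq.
  by rewrite /GRing.scale /=; ring.
have -> : k * lgs k a y * (1 - lgs k a y) = - (f y) ^- 2 *: (- k * expR (- (k * (y - a)))).
  rewrite /GRing.scale /= /lgs -/(f y).
  have -> : expR (- (k * (y - a))) = f y - 1 by rewrite /f; ring.
  by field; rewrite f0.
exact: is_deriveV.
Qed.

Lemma smooth1_lgs2 k a b : smooth1 (fun y => lgs k a y - lgs k b y).
Proof.
exists (fun f => f = lgs k a \/ f = lgs k b).
  have clo c : (c = a \/ c = b) -> falg (fun f => f = lgs k a \/ f = lgs k b) (fun y => k * lgs k c y * (1 - lgs k c y)).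
    move=> ab; have Bc : falg (fun f => f = lgs k a \/ f = lgs k b) (lgs k c).
      by apply: falg_base; case: ab => ->; [left|right].
    have -> : (fun y => k * lgs k c y * (1 - lgs k c y)) =
      (fun y => (k * lgs k c y) * (1 + (-1) * lgs k c y)).
      by apply/funext => y; rewrite mulN1r.
    apply: falg_mul; first by apply: falg_mul => //; exact: falg_cst.
    by apply: falg_add; [exact: falg_cst|apply: falg_mul => //; exact: falg_cst].
  move=> f [->|->].
    by exists (fun y => k * lgs k a y * (1 - lgs k a y)); [apply: clo; left|move=> x; exact: is_derive_lgs].
  by exists (fun y => k * lgs k b y * (1 - lgs k b y)); [apply: clo; right|move=> x; exact: is_derive_lgs].
have -> : (fun y => lgs k a y - lgs k b y) = (fun y => lgs k a y + (-1) * lgs k b y).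
  by apply/funext => y; rewrite mulN1r.
apply: falg_add; first by apply: falg_base; left.
by apply: falg_mul; [exact: falg_cst|apply: falg_base; right].
Qed.

End SmoothAlgebra.

(** * Trigonometric mollifiers *)

Section Kernel.
Variable R : realType.
Notation mu := (@lebesgue_measure R).

(** Equal to sin(pi s) squared, a smooth substitute for the squared distance of s to the integers;
    the concentration of a kernel is measured by its moment against it. *)
Definition pdist (s : R) : R := (1 - cos (2 * pi * s)) / 2.

(** [B1] and [B2] may be very large compared with 1/eta: the mesh and the time step are chosen after
    the kernel. *)
Record mollifier (om dom : R -> R) (B1 B2 eta : R) : Prop := {
  ker_ge0 : forall x, 0 <= om x;
  ker_per : forall x, om (x + 1) = om x;
  ker_even : forall x, om (- x) = om x;
  ker_smooth : forall z, smooth1 (fun x => om (x - z));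
  ker_derive : forall x : R, is_derive x 1 om (dom x);
  ker_B1 : forall x, `|dom x| <= B1;
  ker_B2 : forall x y, `|dom x - dom y| <= B2 * `|x - y|;
  ker_mass : forall z, \int[mu]_(x in `[0, 1[) om (x - z) = 1;
  ker_conc : forall z, \int[mu]_(x in `[0, 1[) (om (x - z) * pdist (x - z)) <= eta }.

Let C (s : R) : R := (1 + cos (2 * pi * s)) / 2.
Let S (s : R) : R := sin (2 * pi * s).
Let B z (f : R -> R) := f = (fun x => C (x - z)) \/ f = (fun x => S (x - z)).

Let C_01 s : 0 <= C s <= 1.
Proof.
have := cos_geN1 (2 * pi * s); have := cos_le1 (2 * pi * s) => ? ?.
by rewrite /C; apply/andP; split; lra.
Qed.

Let dC z (x : R) : is_derive x 1 (fun x => C (x - z)) (- pi * S (x - z)).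
Proof.
by apply: is_derive_eq; rewrite /GRing.scale /= /S; field.
Qed.

Let dS z (x : R) : is_derive x 1 (fun x => S (x - z)) (2 * pi * (2 * C (x - z) - 1)).
Proof.
by apply: is_derive_eq; rewrite /GRing.scale /= /C; field.
Qed.

Let SC s : S s ^+ 2 = 4 * C s * (1 - C s).
Proof.
rewrite /S /C; have := cos2Dsin2 (2 * pi * s).
set c := cos _; set t := sin _ => H.
have -> : t ^+ 2 = 1 - c ^+ 2 by rewrite -H; ring.
by field.
Qed.

Let B_closed z : falg_closed (B z).
Proof.
have BC : falg (B z) (fun x => C (x - z)) by apply: falg_base; left.
have BS : falg (B z) (fun x => S (x - z)) by apply: falg_base; right.
move=> f [->|->].
  exists (fun x => - pi * S (x - z)); first by apply: falg_mul => //; exact: falg_cst.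
  exact: dC.
exists (fun x => 2 * pi * (2 * C (x - z) - 1)); last exact: dS.
apply: (@falg_mul _ _ (fun=> 2 * pi) (fun x => 2 * C (x - z) - 1)); first exact: falg_cst.
apply: (@falg_add _ _ (fun x => 2 * C (x - z)) (fun=> -1)); last exact: falg_cst.
by apply: falg_mul => //; exact: falg_cst.
Qed.

Let B_bounded z f : B z f -> exists b : R, forall x, `|f x| <= b.
Proof.
move=> [->|->]; exists 1 => x.
  by have /andP[h0 h1] := C_01 (x - z); rewrite ger0_norm.
by rewrite ler_norml; apply/andP; split; [exact: sin_geN1|exact: sin_le1].
Qed.

Let per_cos s : cos (2 * pi * (s + 1)) = cos (2 * pi * s) :> R.
Proof. by rewrite -[RHS]cosD2pi; congr cos; ring. Qed.

Let per_sin s : sin (2 * pi * (s + 1)) = sin (2 * pi * s) :> R.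
Proof. by rewrite -[RHS]sinD2pi; congr sin; ring. Qed.

Lemma continuous_integrable01 (f : R -> R) : continuous f ->
  mu.-integrable `[0, 1[ (EFin \o f).
Proof.
move=> cf; apply: (@integrableS _ _ _ mu (`[0, 1]%classic : set R)) => //.
  by move=> x /=; rewrite !in_itv /= => /andP[-> /ltW ->].
apply: continuous_compact_integrable; first exact: segment_compact.
exact: continuous_subspaceT.
Qed.

Lemma FTC01 (F f : R -> R) : (forall x : R, is_derive x 1 F (f x)) -> continuous f ->
  \int[mu]_(x in `[0, 1[) f x = F 1 - F 0.
Proof.
move=> HF cf; rewrite Rintegral_itv_bndo_bndc; last exact: continuous_integrable01.
rewrite /Rintegral (@continuous_FTC2 _ f F) //.
- exact: continuous_subspaceT.
- split.
  + by move=> x _; have [] := HF x.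
  + by apply: cvg_at_right_filter; exact: is_derive_cont (HF 0).
  + by apply: cvg_at_left_filter; exact: is_derive_cont (HF 1).
- by move=> x _; exact: is_derive_derive1 (HF x).
Qed.

Let I (M : nat) : R := \prod_(i < M) ((2 * i%:R + 1) / (2 * i%:R + 2)).

Let I_gt0 M : 0 < I M.
Proof. by apply: prodr_gt0 => i _; rewrite divr_gt0 // ltr_wpDl // mulr_ge0. Qed.

Let cC z : continuous (fun x => C (x - z)).
Proof. by move=> x; exact: is_derive_cont (dC z x). Qed.

Let cCM z M : continuous (fun x => C (x - z) ^+ M).
Proof.
apply: smooth1_continuous; exists (B z) => //.
by apply: falg_exp; apply: falg_base; left.
Qed.

Let dCM z M (x : R) : is_derive x 1 (fun x => C (x - z) ^+ M.+1)
  (M.+1%:R * C (x - z) ^+ M * (- pi * S (x - z))).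
Proof.
elim: M => [|M IH].
  have -> : (fun x => C (x - z) ^+ 1) = (fun x => C (x - z)) by apply/funext=> y; rewrite expr1.
  by rewrite expr0 !mul1r; exact: dC.
have -> : (fun x => C (x - z) ^+ M.+2) = (fun x => C (x - z) * C (x - z) ^+ M.+1).
  by apply/funext=> y; rewrite exprS.
apply: (@is_derive_eq _ _ _ _ _ _ _ _ (is_derive_mul (dC z x) IH)).
by rewrite -[M.+2%:R]natr1 exprS; ring.
Qed.

(* sin(2 pi s) C(s)^M is periodic with derivative
   2 pi ((2M+2) C^(M+1) - (2M+1) C^M): the Wallis recursion. *)
Let wallis z M : \int[mu]_(x in `[0, 1[) (C (x - z) ^+ M) = I M.
Proof.
elim: M => [|M IH].
  rewrite /I big_ord0; under eq_Rintegral do rewrite expr0.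
  by rewrite Rintegral_cst //= lebesgue_measure_itv /= lte_fin ltr01 oppr0 adde0 /= mul1r.
pose f x := 2 * pi * ((2 * M%:R + 2) * C (x - z) ^+ M.+1 - (2 * M%:R + 1) * C (x - z) ^+ M).
have dF (x : R) : is_derive x 1 (fun x => S (x - z) * C (x - z) ^+ M) (f x).
  case: M @f {IH} => [|M] f.
    have -> : (fun x => S (x - z) * C (x - z) ^+ 0) = (fun x => S (x - z)).
      by apply/funext => y; rewrite expr0 mulr1.
    apply: (@is_derive_eq _ _ _ _ _ _ _ _ (dS z x)).
    by rewrite /f expr0 expr1; ring.
  apply: (@is_derive_eq _ _ _ _ _ _ _ _ (is_derive_mul (dS z x) (dCM z M x))).
  have := SC (x - z); set s := S _; set c := C _ => H.
  have -> : s * (M.+1%:R * c ^+ M * (- pi * s)) = - pi * M.+1%:R * c ^+ M * s ^+ 2 by ring.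
  by rewrite H /f -/c !exprS; ring.
have cf : continuous f.
  move=> x; apply: cvgM; first exact: cvg_cst.
  by apply: cvgB; apply: cvgM; (exact: cvg_cst || exact: cCM).
have := FTC01 dF cf.
have -> : S (1 - z) * C (1 - z) ^+ M - S (0 - z) * C (0 - z) ^+ M = 0.
  have e : 1 - z = (0 - z) + 1 by ring.
  by rewrite /S /C e per_cos per_sin subrr.
have i1 := continuous_integrable01 (@cCM z M.+1); have i0 := continuous_integrable01 (@cCM z M).
rewrite /f RintegralZl //; last first.
  apply: (continuous_integrable01 (f := fun x => (2 * M%:R + 2) * C (x - z) ^+ M.+1 - (2 * M%:R + 1) * C (x - z) ^+ M)).
  by move=> x; apply: cvgB; apply: cvgM; (exact: cvg_cst || exact: cCM).
rewrite RintegralB //; first last.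
- by apply: (continuous_integrable01 (f := fun x => (2 * M%:R + 1) * C (x - z) ^+ M)) => x; apply: cvgM; (exact: cvg_cst || exact: cCM).
- by apply: (continuous_integrable01 (f := fun x => (2 * M%:R + 2) * C (x - z) ^+ M.+1)) => x; apply: cvgM; (exact: cvg_cst || exact: cCM).
rewrite !RintegralZl // IH => /eqP; rewrite mulf_eq0 => /orP[/eqP|/eqP H].
  by have := pi_gt0 R; lra.
rewrite /I big_ord_recr /= -/(I M).
have d0 : 2 * M%:R + 2 != 0 :> R by rewrite gt_eqF // ltr_wpDl // mulr_ge0.
apply: (mulfI d0).
have -> : (2 * M%:R + 2) * (I M * ((2 * M%:R + 1) / (2 * M%:R + 2))) = (2 * M%:R + 1) * I M.
  by field.
by move/eqP: H; rewrite subr_eq0 => /eqP.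
Qed.

(** With C = cos(pi x) squared one has [pdist] = 1 - C, so the moment of the normalised power of C
    is one minus a quotient of consecutive Wallis integrals, here 1/(2M + 4). *)
Lemma mollifier_exists (eta : R) : 0 < eta -> exists om dom B1 B2, mollifier om dom B1 B2 eta.
Proof.
move=> eta0.
have [M Meta] : exists M : nat, (2 * M%:R + 2)^-1 <= eta.
  exists (Num.truncn eta^-1).+1.
  have d0 : 0 < 2 * (Num.truncn eta^-1).+1%:R + 2 :> R by rewrite ltr_wpDl // mulr_ge0.
  rewrite -[X in _ <= X]invrK lef_pV2 ?posrE ?invr_gt0 //.
  have := truncnS_gt eta^-1; set t := _.+1%:R => h.
  have t0 : 0 <= t by [].
  by lra.
pose om x := (I M.+1)^-1 * C x ^+ M.+1.
pose dom x := (I M.+1)^-1 * (M.+1%:R * C x ^+ M * (- pi * S x)).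
have sub0 (f : R -> R) : (fun x => f (x - 0)) = f by apply/funext=> x; rewrite subr0.
have dom1 (x : R) : is_derive x 1 om (dom x).
  have := is_derive_mull (I M.+1)^-1 (dCM 0 M x); rewrite subr0.
  by have -> : (fun x => (I M.+1)^-1 * C (x - 0) ^+ M.+1) = om by apply/funext => y; rewrite subr0.
have Bdom : falg (B 0) dom.
  have BC : falg (B 0) C by apply: falg_base; left; rewrite sub0.
  have BS : falg (B 0) S by apply: falg_base; right; rewrite sub0.
  apply: falg_mul; first exact: falg_cst.
  apply: falg_mul; last by apply: falg_mul => //; exact: falg_cst.
  by apply: falg_mul; [exact: falg_cst|exact: falg_exp].
have [B1 HB1] := falg_bounded (@B_bounded 0) Bdom.
have [ddom Bddom Hddom] := falg_derive (@B_closed 0) Bdom.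
have [B2 HB2] := falg_bounded (@B_bounded 0) Bddom.
have Ii0 : 0 <= (I M.+1)^-1 by rewrite invr_ge0 ltW.
exists om, dom, B1, B2; split.
- by move=> x; have /andP[h _] := C_01 x; rewrite mulr_ge0 // exprn_ge0.
- by move=> x; rewrite /om /C per_cos.
- by move=> x; rewrite /om /C mulrN cosN.
- move=> z; exists (B z) => //; apply: falg_mul; first exact: falg_cst.
  by apply: falg_exp; apply: falg_base; left.
- exact: dom1.
- exact: HB1.
- exact: lip_of_derive Hddom HB2.
- move=> z; rewrite RintegralZl // ?wallis; last exact: continuous_integrable01 (@cCM z M.+1).
  by rewrite mulVf // gt_eqF.
- move=> z.
  have -> : \int[mu]_(x in `[0, 1[) (om (x - z) * pdist (x - z)) =
      \int[mu]_(x in `[0, 1[) ((I M.+1)^-1 * (C (x - z) ^+ M.+1 - C (x - z) ^+ M.+2)).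
    apply: eq_Rintegral => x _; rewrite /om [in C _ ^+ M.+2]exprS -mulrA; congr (_ * _).
    have -> : pdist (x - z) = 1 - C (x - z) by rewrite /pdist /C; field.
    by ring.
  rewrite RintegralZl //; last first.
    apply: (continuous_integrable01 (f := fun x => C (x - z) ^+ M.+1 - C (x - z) ^+ M.+2)).
    by move=> x; apply: cvgB; exact: cCM.
  rewrite RintegralB //; [|exact: continuous_integrable01 (@cCM z M.+1)|exact: continuous_integrable01 (@cCM z M.+2)].
  rewrite !wallis [I M.+2]/I big_ord_recr /= -/(I M.+1).
  have -> (q : R) : (I M.+1)^-1 * (I M.+1 - I M.+1 * q) = 1 - q by field; rewrite gt_eqF.
  apply: le_trans Meta.
  have M0 : 0 <= M%:R :> R by [].
  have k1 : M%:R <= M.+1%:R :> R by rewrite ler_nat.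
  set k := M.+1%:R in k1 *.
  have d0 : 0 < 2 * k + 2 by lra.
  have -> : 1 - (2 * k + 1) / (2 * k + 2) = (2 * k + 2)^-1 by field; rewrite gt_eqF.
  by rewrite lef_pV2 ?posrE //; lra.
Qed.

End Kernel.

(** * Slicing the entropy inequality in time *)

Section Slicing.
Variable R : realType.
Notation mu := (@lebesgue_measure R).

Lemma lgs_tail (k a y : R) : 0 < k -> a < y -> 1 - lgs k a y <= (k * (y - a))^-1.
Proof.
move=> k0 ay; set z := k * (y - a).
have z0 : 0 < z by rewrite mulr_gt0 // subr_gt0.
have e0 := expR_gt0 (- z).
have -> : 1 - lgs k a y = (1 + expR z)^-1.
  rewrite /lgs -/z expRN; field.
  by rewrite !gt_eqF ?addr_gt0 ?expR_gt0.
rewrite lef_pV2 ?posrE ?addr_gt0 ?expR_gt0 //.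
by have := expR_ge1Dx z; lra.
Qed.

Lemma lgs_tail_neg (k a y : R) : 0 < k -> y < a -> lgs k a y <= (k * (a - y))^-1.
Proof.
move=> k0 ay; set z := k * (a - y).
have z0 : 0 < z by rewrite mulr_gt0 // subr_gt0.
have -> : lgs k a y = (1 + expR z)^-1 by rewrite /lgs; congr (1 + expR _)^-1; rewrite /z; ring.
rewrite lef_pV2 ?posrE ?addr_gt0 ?expR_gt0 //.
by have := expR_ge1Dx z; lra.
Qed.

Definition dlgs (k a y : R) := k * lgs k a y * (1 - lgs k a y).

Lemma dlgs_ge0 k a y : 0 < k -> 0 <= dlgs k a y.
Proof.
by move=> k0; rewrite /dlgs !mulr_ge0 ?ltW // ?lgs_gt0 // subr_gt0 lgs_lt1.
Qed.

(* S(1-S) <= 4 / z^2 from exp z >= (1 + z/2)^2. *)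
Lemma dlgs_far (k a y d : R) : 0 < k -> 0 < d -> d <= `|y - a| -> dlgs k a y <= 4 / (k * d ^+ 2).
Proof.
move=> k0 d0 dy; set z := k * `|y - a|.
have z0 : 0 < z by rewrite mulr_gt0 // (lt_le_trans d0).
have -> : dlgs k a y = k * ((1 + expR z)^-1 * (1 - (1 + expR z)^-1)).
  rewrite /dlgs -mulrA; congr (_ * _).
  have e0 := expR_gt0 z.
  have [ya|ya] := leP 0 (y - a).
    rewrite /lgs (_ : k * (y - a) = z) ?expRN; last by rewrite /z ger0_norm.
    by field; rewrite !gt_eqF ?addr_gt0 ?expR_gt0.
  rewrite /lgs (_ : - (k * (y - a)) = z) //.
  by rewrite /z ltr0_norm // mulrN.
have e0 := expR_gt0 z.
have ez : z ^+ 2 / 4 <= expR z.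
  have -> : z = z / 2 + z / 2 by field.
  rewrite expRD; have h := expR_ge1Dx (z / 2).
  have : (1 + z / 2) * (1 + z / 2) <= expR (z / 2) * expR (z / 2) by rewrite ler_pM //; lra.
  by apply: le_trans; rewrite !exprS expr0; nra.
have e1 : (1 + expR z)^-1 <= (z ^+ 2 / 4)^-1.
  rewrite lef_pV2 ?posrE ?addr_gt0 ?expR_gt0 ?divr_gt0 ?exprn_gt0 //; lra.
have e2 : 0 <= 1 - (1 + expR z)^-1 <= 1.
  have i0 : 0 < (1 + expR z)^-1 by rewrite invr_gt0 addr_gt0.
  have i1 : (1 + expR z)^-1 <= 1 by rewrite invf_le1 ?addr_gt0 //; lra.
  by apply/andP; split; lra.
have /andP[e20 e21] := e2.
apply: (@le_trans _ _ (k * ((z ^+ 2 / 4)^-1 * 1))).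
  apply: ler_wpM2l; first exact: ltW.
  apply: ler_pM => //; by rewrite invr_ge0 ltW // addr_gt0.
have dz : (k * d) ^+ 2 <= z ^+ 2.
  by rewrite ler_sqr ?nnegrE ?(ltW z0) ?mulr_ge0 ?(ltW k0) ?(ltW d0) // /z ler_pM2l.
have -> : 4 / (k * d ^+ 2) = k * ((k * d) ^+ 2 / 4)^-1 by field; rewrite !gt_eqF.
rewrite mulr1 ler_pM2l // lef_pV2 ?posrE ?divr_gt0 ?exprn_gt0 ?mulr_gt0 //.
  by rewrite ler_pM2r // invr_gt0.
exact: lt_le_trans d0 dy.
Qed.

Lemma continuous_integrable_seg (a b : R) (f : R -> R) : continuous f ->
  mu.-integrable `[a, b] (EFin \o f).
Proof.
move=> cf; apply: continuous_compact_integrable; first exact: segment_compact.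
exact: continuous_subspaceT.
Qed.

Lemma FTCseg (F f : R -> R) (a b : R) : a < b -> (forall x : R, is_derive x 1 F (f x)) ->
  continuous f -> \int[mu]_(x in `[a, b]) f x = F b - F a.
Proof.
move=> ab HF cf; rewrite /Rintegral (@continuous_FTC2 _ f F) //.
- exact: continuous_subspaceT.
- split.
  + by move=> x _; have [] := HF x.
  + by apply: cvg_at_right_filter; exact: is_derive_cont (HF a).
  + by apply: cvg_at_left_filter; exact: is_derive_cont (HF b).
- by move=> x _; exact: is_derive_derive1 (HF x).
Qed.

Lemma dlgs_continuous k a : continuous (dlgs k a).
Proof.
move=> x; apply: cvgM; first apply: cvgM; first exact: cvg_cst.
  exact: is_derive_cont (is_derive_lgs k a x).
apply: cvgB; first exact: cvg_cst.
exact: is_derive_cont (is_derive_lgs k a x).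
Qed.

Lemma dlgs_mass k a (lam : R) : 0 < lam ->
  \int[mu]_(x in `[0, lam]) dlgs k a x = lgs k a lam - lgs k a 0.
Proof.
by move=> l0; apply: FTCseg => //; [exact: is_derive_lgs|exact: dlgs_continuous].
Qed.

(** [dlgs k a] is an approximate Dirac mass at a. Near a the variation of C costs [e]; the values
    far from a and the mass lost outside [0, lam] are of order 1/k. *)
Lemma dlgs_approx (C : R -> R) (M lam a e d k : R) : continuous C ->
  (forall t, 0 <= t <= lam -> `|C t| <= M) -> 0 < a < lam -> 0 < d -> d <= a -> d <= lam - a ->
  0 <= e -> 0 < k -> (forall t, `|t - a| < d -> `|C t - C a| <= e) ->
  `|\int[mu]_(t in `[0, lam]) (dlgs k a t * C t) - C a|
    <= e + (2 * M * lam * (4 / d ^+ 2) + 2 * M / d) / k.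
Proof.
move=> cC CM /andP[a0 al] d0 da dl e0 k0 Cd.
have l0 : 0 < lam by exact: lt_trans a0 al.
have Ma : `|C a| <= M by apply: CM; rewrite !ltW.
have M0 : 0 <= M by apply: le_trans (normr_ge0 _) Ma.
have cK : continuous (dlgs k a) by exact: dlgs_continuous.
have cKC : continuous (fun t => dlgs k a t * C t).
  by move=> x; apply: cvgM; [exact: cK|exact: cC].
pose eta : R := 4 / (k * d ^+ 2).
have eta0 : 0 <= eta by rewrite divr_ge0 // mulr_ge0 ?sqr_ge0 // ltW.
have iK := @continuous_integrable_seg 0 lam _ cK.
have cKD : continuous (fun t => dlgs k a t * (C t - C a)).
  by move=> x; apply: cvgM; [exact: cK|apply: cvgB; [exact: cC|exact: cvg_cst]].
have mass := dlgs_mass k a l0.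
have m1 : \int[mu]_(x in `[0, lam]) dlgs k a x <= 1.
  by rewrite mass; have := lgs_lt1 k a lam; have := lgs_gt0 k a 0; lra.
have m2 : 1 - 2 / (k * d) <= \int[mu]_(x in `[0, lam]) dlgs k a x.
  rewrite mass; have t1 := lgs_tail k0 al; have t2 := lgs_tail_neg k0 a0.
  have i1 : (k * (lam - a))^-1 <= (k * d)^-1 by rewrite lef_pV2 ?posrE ?mulr_gt0 ?subr_gt0 // ler_pM2l.
  have i2 : (k * (a - 0))^-1 <= (k * d)^-1 by rewrite subr0 lef_pV2 ?posrE ?mulr_gt0 // ler_pM2l.
  by lra.
have -> : \int[mu]_(t in `[0, lam]) (dlgs k a t * C t) - C a =
   \int[mu]_(t in `[0, lam]) (dlgs k a t * (C t - C a)) +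
   C a * (\int[mu]_(x in `[0, lam]) dlgs k a x - 1).
  have -> : \int[mu]_(t in `[0, lam]) (dlgs k a t * C t) =
    \int[mu]_(t in `[0, lam]) (dlgs k a t * (C t - C a) + C a * dlgs k a t).
    by apply: eq_Rintegral => t _; ring.
  rewrite RintegralD //; first last.
  - apply: (@continuous_integrable_seg 0 lam (fun t => C a * dlgs k a t)).
    by move=> x; apply: cvgM; [exact: cvg_cst|exact: cK].
  - exact: (@continuous_integrable_seg 0 lam _ cKD).
  by rewrite RintegralZl //; ring.
apply: (le_trans (ler_normD _ _)).
have b1 : `|\int[mu]_(t in `[0, lam]) (dlgs k a t * (C t - C a))| <= e + 2 * M * eta * lam.
  apply: (le_trans (le_normr_Rintegral _ _)) => //; first exact: (@continuous_integrable_seg 0 lam _ cKD).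
  apply: (@le_trans _ _ (\int[mu]_(t in `[0, lam]) (e * dlgs k a t + 2 * M * eta))).
    apply: le_Rintegral => //.
    - apply: (@continuous_integrable_seg 0 lam (fun t => `|dlgs k a t * (C t - C a)|)).
      by move=> x; apply: cvg_norm; exact: cKD.
    - apply: (@continuous_integrable_seg 0 lam (fun t => e * dlgs k a t + 2 * M * eta)).
      by move=> x; apply: cvgD; [apply: cvgM; [exact: cvg_cst|exact: cK]|exact: cvg_cst].
    move=> t; rewrite /= in_itv /= => tl.
    have K0 := dlgs_ge0 a t k0.
    rewrite normrM ger0_norm //.
    have Me0 : 0 <= 2 * M * eta by apply: mulr_ge0 => //; apply: mulr_ge0.
    have [td|td] := ltP `|t - a| d.
      by have := ler_wpM2l K0 (Cd t td); lra.
    have far := dlgs_far k0 d0 td; rewrite -/eta in far.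
    have CC : `|C t - C a| <= 2 * M.
      by apply: (le_trans (ler_normB _ _)); have := CM t tl; lra.
    have := ler_pM K0 (normr_ge0 _) far CC.
    have : 0 <= e * dlgs k a t by rewrite mulr_ge0.
    by lra.
  rewrite RintegralD //; first last.
  - exact: (@continuous_integrable_seg 0 lam (fun=> 2 * M * eta) (fun x => cvg_cst _)).
  - apply: (@continuous_integrable_seg 0 lam (fun t => e * dlgs k a t)).
    by move=> x; apply: cvgM; [exact: cvg_cst|exact: cK].
  rewrite RintegralZl // Rintegral_cst //= lebesgue_measure_itv /= lte_fin l0 oppr0 adde0 /=.
  by have := ler_wpM2l e0 m1; lra.
have b2 : `|C a * (\int[mu]_(x in `[0, lam]) dlgs k a x - 1)| <= M * (2 / (k * d)).
  rewrite normrM ler_pM // ler0_norm ?subr_le0 //; lra.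
have -> : (2 * M * lam * (4 / d ^+ 2) + 2 * M / d) / k = 2 * M * eta * lam + M * (2 / (k * d)).
  by rewrite /eta; field; rewrite !gt_eqF.
by lra.
Qed.

End Slicing.

Section Slicing2.
Variable R : realType.
Notation mu := (@lebesgue_measure R).

Lemma continuous_seg_bounded (C : R -> R) (a b : R) : continuous C ->
  exists M, forall t, a <= t <= b -> `|C t| <= M.
Proof.
move=> cC.
have : compact (C @` `[a, b]).
  apply: continuous_compact; last exact: segment_compact.
  exact: continuous_subspaceT.
move=> /compact_bounded [M [_ HM]].
exists (M + 1) => t tab; apply: (HM (M + 1)); first by rewrite ltrDl.
by exists t => //=; rewrite in_itv.
Qed.

Lemma continuous_eps (C : R -> R) (x e : R) : continuous C -> 0 < e ->
  exists2 d, 0 < d & forall t, `|t - x| < d -> `|C t - C x| <= e.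
Proof.
move=> cC e0; have /cvgrPdist_le /(_ e e0) := cC x.
move=> /nbhs_ballP [d /= d0 H]; exists d => // t td.
by rewrite distrC; apply: H; rewrite /ball /= distrC.
Qed.

(** As k grows the integral tends to C y1 - C y2, while the terms in [cl] and [c0] see only the
    tails of the logistic steps at the ends of the interval and vanish. *)
Lemma nonincr_of_tests (C : R -> R) (lam c0 cl : R) : continuous C -> 0 < lam ->
  (forall k y1 y2, 0 < k -> 0 < y1 -> y1 < y2 -> y2 < lam ->
    0 <= \int[mu]_(t in `[0, lam]) ((dlgs k y1 t - dlgs k y2 t) * C t)
      + cl * (lgs k y1 lam - lgs k y2 lam) + c0 * (lgs k y1 0 - lgs k y2 0)) ->
  forall y1 y2, 0 < y1 -> y1 < y2 -> y2 < lam -> C y2 <= C y1.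
Proof.
move=> cC l0 H y1 y2 y10 y12 y2l; rewrite leNgt; apply/negP => CC.
pose e : R := (C y2 - C y1) / 8.
have e0 : 0 < e by rewrite divr_gt0 // subr_gt0.
have [M HM] := @continuous_seg_bounded C 0 lam cC.
have [d1 d10 Hd1] := continuous_eps y1 cC e0.
have [d2 d20 Hd2] := continuous_eps y2 cC e0.
pose d := Num.min (Num.min d1 d2) (Num.min y1 (lam - y2)).
have d0 : 0 < d by rewrite !lt_min d10 d20 y10 subr_gt0.
have dd1 : d <= d1 by rewrite !ge_min lexx.
have dd2 : d <= d2 by rewrite !ge_min lexx orbT.
have dy1 : d <= y1 by rewrite !ge_min lexx !orbT.
have dy2 : d <= lam - y2 by rewrite !ge_min lexx !orbT.
pose Q : R := 2 * M * lam * (4 / d ^+ 2) + 2 * M / d.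
pose Qt : R := 2 * Q + (`|cl| + `|c0|) / d.
(* Sharp enough for all the errors of order 1/k, collected in [Qt], to stay below one eighth of the
   supposed increase of C. *)
pose k : R := `|Qt| / e + 1.
have k0 : 0 < k by rewrite ltr_wpDl // divr_ge0 // ltW.
have Qk : Qt / k <= e.
  rewrite ler_pdivrMr // /k mulrDr mulr1 mulrC divfK ?gt_eqF //.
  by have := ler_norm Qt; lra.
have y20 : 0 < y2 by exact: lt_trans y12.
have y1l : y1 < lam by exact: lt_trans y2l.
have a1 : `|\int[mu]_(t in `[0, lam]) (dlgs k y1 t * C t) - C y1| <= e + Q / k.
  apply: dlgs_approx => //; [by rewrite y10|lra|exact: ltW|].
  by move=> t td; apply: Hd1; exact: lt_le_trans td dd1.
have a2 : `|\int[mu]_(t in `[0, lam]) (dlgs k y2 t * C t) - C y2| <= e + Q / k.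
  apply: dlgs_approx => //; [by rewrite y20|lra|exact: ltW|].
  by move=> t td; apply: Hd2; exact: lt_le_trans td dd2.
have tail y : d <= lam - y -> 0 < y -> y < lam -> 1 - lgs k y lam <= (k * d)^-1.
  move=> dy yy yl; apply: (le_trans (lgs_tail k0 yl)).
  by rewrite lef_pV2 ?posrE ?mulr_gt0 ?subr_gt0 // ler_pM2l.
have tail0 y : d <= y -> 0 < y -> lgs k y 0 <= (k * d)^-1.
  move=> dy yy; apply: (le_trans (lgs_tail_neg k0 yy)).
  by rewrite lef_pV2 ?posrE ?mulr_gt0 ?subr_gt0 // ?ler_pM2l ?subr0.
have g1 : cl * (lgs k y1 lam - lgs k y2 lam) <= `|cl| * (k * d)^-1.
  apply: (le_trans (ler_norm _)); rewrite normrM ler_wpM2l // ler_norml.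
  have ly1 : d <= lam - y1 by clear -dy2 y12; lra.
  have := tail y1 ly1 y10 y1l; have := tail y2 dy2 y20 y2l.
  have := lgs_lt1 k y1 lam; have := lgs_lt1 k y2 lam; clear => ? ? ? ?.
  by apply/andP; split; lra.
have g0 : c0 * (lgs k y1 0 - lgs k y2 0) <= `|c0| * (k * d)^-1.
  apply: (le_trans (ler_norm _)); rewrite normrM ler_wpM2l // ler_norml.
  have ly2 : d <= y2 by clear -dy1 y12; lra.
  have := tail0 y1 dy1 y10; have := tail0 y2 ly2 y20.
  have := lgs_gt0 k y1 0; have := lgs_gt0 k y2 0; clear => ? ? ? ?.
  by apply/andP; split; lra.
have ck y : continuous (fun t => dlgs k y t * C t).
  by move=> x; apply: cvgM; [exact: dlgs_continuous|exact: cC].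
have := H k y1 y2 k0 y10 y12 y2l.
have -> : \int[mu]_(t in `[0, lam]) ((dlgs k y1 t - dlgs k y2 t) * C t) =
  \int[mu]_(t in `[0, lam]) (dlgs k y1 t * C t) - \int[mu]_(t in `[0, lam]) (dlgs k y2 t * C t).
  rewrite -RintegralB //; [|exact: (@continuous_integrable_seg _ 0 lam _ (ck y1))|exact: (@continuous_integrable_seg _ 0 lam _ (ck y2))].
  by apply: eq_Rintegral => t _; ring.
have Qe : Qt / k = 2 * (Q / k) + `|cl| * (k * d)^-1 + `|c0| * (k * d)^-1.
  by rewrite /Qt; field; rewrite !gt_eqF.
move: a1 a2; rewrite !ler_norml => /andP[p1 p2] /andP[p3 p4].
have e8 : 8 * e = C y2 - C y1 by rewrite /e; field.
clearbody e; move=> H0; move: (\int[mu]_(t in _) _) (\int[mu]_(t in _) _) p1 p2 p3 p4 H0.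
by clear -e0 Qk Qe e8 g1 g0 => I1 I2 p1 p2 p3 p4 H0; lra.
Qed.

(** Extends functions on [0, lam] by constants, so that continuity can be used on the whole line. *)
Definition clamp (lam t : R) := Num.min lam (Num.max 0 t).

Lemma clampE lam t : 0 <= t <= lam -> clamp lam t = t.
Proof. by move=> /andP[t0 tl]; rewrite /clamp max_r // min_r. Qed.

Lemma clamp_itv lam t : 0 < lam -> 0 <= clamp lam t <= lam.
Proof. by move=> l0; rewrite /clamp le_min ge_min le_max lexx /= (ltW l0) lexx. Qed.

Lemma clamp_lip lam s t : 0 < lam -> `|clamp lam s - clamp lam t| <= `|s - t|.
Proof.
move=> l0; wlog st : s t / s <= t.
  by move=> W; case: (leP s t) => [/W//|/ltW /W]; rewrite distrC (distrC t).
rewrite distrC (distrC s) [X in _ <= X]ger0_norm ?subr_ge0 //.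
have /andP[p0 p1] : 0 <= Num.max 0 t - Num.max 0 s <= t - s.
  by rewrite !maxEle; case: (leP 0 t) => ?; case: (leP 0 s) => ?; apply/andP; split; lra.
rewrite /clamp; set p := Num.max 0 t in p0 p1 *; set q := Num.max 0 s in p0 p1 *.
rewrite !minEle; case: (leP lam p) => ?; case: (leP lam q) => ?; rewrite ger0_norm; lra.
Qed.

Definition unif_cont_on (lam : R) (A : R -> R) := forall e : R, 0 < e -> exists2 d, 0 < d &
  forall y y', 0 <= y <= lam -> 0 <= y' <= lam -> `|y - y'| < d -> `|A y - A y'| <= e.

Lemma clamp_cont lam A : 0 < lam -> unif_cont_on lam A -> continuous (fun t => A (clamp lam t)).
Proof.
move=> l0 uA x; apply/cvgrPdist_le => e e0; have [d d0 Hd] := uA e e0.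
apply/nbhs_ballP; exists d => //= t; rewrite /ball /= => xt.
by apply: Hd; rewrite ?clamp_itv // (le_lt_trans (clamp_lip _ _ l0)).
Qed.

(** Integration by parts moves B onto a primitive F, and the tests then say that A - F is
    nonincreasing. The mean value theorem turns the increment of F into a value of B at one time. *)
Lemma slicing (A B : R -> R) (lam : R) : 0 < lam -> unif_cont_on lam A -> unif_cont_on lam B ->
  (forall k y1 y2, 0 < k -> 0 < y1 -> y1 < y2 -> y2 < lam ->
    0 <= \int[mu]_(t in `[0, lam]) ((dlgs k y1 t - dlgs k y2 t) * A t
            + (lgs k y1 t - lgs k y2 t) * B t) + (lgs k y1 0 - lgs k y2 0) * A 0) ->
  forall y1 y2, 0 <= y1 -> y1 <= y2 -> y2 <= lam ->
  exists2 c, y1 <= c <= y2 & A y2 - A y1 <= B c * (y2 - y1).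
Proof.
move=> l0 uA uB H.
pose a t := A (clamp lam t); pose b t := B (clamp lam t).
have ca : continuous a by exact: clamp_cont.
have cb : continuous b by exact: clamp_cont.
(* Starting the primitive at -1 makes it differentiable at 0 too. *)
pose F t := \int[mu]_(s in `[-1, t]) b s.
have dF (t : R) : -1 < t -> is_derive t 1 F (b t).
  move=> t1; have tu : t < t + 1 by rewrite ltrDl.
  have ib : mu.-integrable [set` Interval (BLeft (-1)) (BRight (t + 1))] (EFin \o b).
    exact: (@continuous_integrable_seg _ (-1) (t + 1) _ cb).
  have at1 : (BLeft (-1 : R)%R < BRight t)%E by have := t1 => /ltW.
  have [d1 d2] := continuous_FTC1 tu ib at1 (cb t).
  by split; [exact: d1|rewrite -derive1E; exact: d2].
pose C t := a t - F (clamp lam t).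
have cF : continuous (fun t => F (clamp lam t)).
  move=> x; have cl : {for x, continuous (clamp lam)}.
    apply/cvgrPdist_le => e e0; apply/nbhs_ballP; exists e => //= t; rewrite /ball /= => xt.
    by apply: le_trans (clamp_lip _ _ l0) (ltW xt).
  apply: (continuous_comp cl); apply: is_derive_cont (dF _ _).
  by have /andP[h _] := @clamp_itv lam x l0; apply: lt_le_trans h; rewrite ltrN10.
have cC : continuous C by move=> x; apply: cvgB; [exact: ca|exact: cF].
have aE t : 0 <= t <= lam -> a t = A t by move=> tl; rewrite /a clampE.
have bE t : 0 <= t <= lam -> b t = B t by move=> tl; rewrite /b clampE.
have CE t : 0 <= t <= lam -> C t = A t - F t by move=> tl; rewrite /C clampE // aE.
have i0 : 0 <= (0 : R) <= lam by rewrite lexx ltW.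
have il : 0 <= lam <= lam by rewrite lexx ltW.
have mono y1 y2 : 0 < y1 -> y1 < y2 -> y2 < lam -> C y2 <= C y1.
  apply: (@nonincr_of_tests C lam (C 0) (F lam)) => // k z1 z2 k0 z10 z12 z2l.
  have := H k z1 z2 k0 z10 z12 z2l.
  pose g t := lgs k z1 t - lgs k z2 t; pose dg t := dlgs k z1 t - dlgs k z2 t.
  have dgP (t : R) : is_derive t 1 g (dg t).
    by apply: is_deriveB; exact: is_derive_lgs.
  have cdg : continuous dg by move=> x; apply: cvgB; exact: dlgs_continuous.
  have cg : continuous g by move=> x; exact: is_derive_cont (dgP x).
  have ibp : \int[mu]_(t in `[0, lam]) (F t * dg t) = F lam * g lam - F 0 * g 0 -
     \int[mu]_(t in `[0, lam]) (b t * g t).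
    apply: Rintegration_by_parts => //.
    - exact: continuous_subspaceT.
    - split.
      + by move=> t; rewrite in_itv /= => /andP[t0 _]; have [] := dF t (lt_trans (ltrN10 _) t0).
      + by apply: cvg_at_right_filter; exact: is_derive_cont (dF 0 (ltrN10 _)).
      + by apply: cvg_at_left_filter; exact: is_derive_cont (dF lam (lt_trans (ltrN10 _) l0)).
    - by move=> t; rewrite in_itv /= => /andP[t0 _]; exact: is_derive_derive1 (dF t (lt_trans (ltrN10 _) t0)).
    - exact: continuous_subspaceT.
    - split.
      + by move=> t _; have [] := dgP t.
      + by apply: cvg_at_right_filter; exact: cg.
      + by apply: cvg_at_left_filter; exact: cg.
    - by move=> t _; exact: is_derive_derive1 (dgP t).
  have -> : \int[mu]_(t in `[0, lam]) ((dlgs k z1 t - dlgs k z2 t) * A t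
            + (lgs k z1 t - lgs k z2 t) * B t) =
      \int[mu]_(t in `[0, lam]) (dg t * C t) + \int[mu]_(t in `[0, lam]) (F t * dg t)
      + \int[mu]_(t in `[0, lam]) (b t * g t).
    have -> : \int[mu]_(t in `[0, lam]) (F t * dg t) = \int[mu]_(t in `[0, lam]) (F (clamp lam t) * dg t).
      by apply: eq_Rintegral => t; rewrite inE /= in_itv /= => tl; rewrite clampE.
    rewrite -RintegralD //; first last.
    - by apply: (@continuous_integrable_seg _ 0 lam (fun t => F (clamp lam t) * dg t)) => x; apply: cvgM; [exact: cF|exact: cdg].
    - by apply: (@continuous_integrable_seg _ 0 lam (fun t => dg t * C t)) => x; apply: cvgM; [exact: cdg|exact: cC].
    rewrite -RintegralD //; first last.
    - by apply: (@continuous_integrable_seg _ 0 lam (fun t => b t * g t)) => x; apply: cvgM; [exact: cb|exact: cg].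
    - apply: (@continuous_integrable_seg _ 0 lam (fun t => dg t * C t + F (clamp lam t) * dg t)) => x.
      by apply: cvgD; apply: cvgM; [exact: cdg|exact: cC|exact: cF|exact: cdg].
    apply: eq_Rintegral => t; rewrite inE /= in_itv /= => tl.
    by rewrite CE // clampE // bE // /dg /g; ring.
  by rewrite ibp CE // /g; lra.
have ext y1 y2 : 0 <= y1 -> y1 < y2 -> y2 <= lam -> C y2 <= C y1.
  move=> y10 y12 y2l; rewrite leNgt; apply/negP => CC.
  pose e : R := (C y2 - C y1) / 4.
  have e0 : 0 < e by rewrite divr_gt0 // subr_gt0.
  have [d1 d10 Hd1] := continuous_eps y1 cC e0.
  have [d2 d20 Hd2] := continuous_eps y2 cC e0.
  pose h := Num.min (Num.min d1 d2) (y2 - y1) / 4.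
  have h0 : 0 < h by rewrite divr_gt0 // !lt_min d10 d20 subr_gt0.
  have hh1 : 4 * h <= d1 by rewrite /h mulrC divfK // !ge_min lexx.
  have hh2 : 4 * h <= d2 by rewrite /h mulrC divfK // !ge_min lexx orbT.
  have hh3 : 4 * h <= y2 - y1 by rewrite /h mulrC divfK // !ge_min lexx !orbT.
  clearbody h; have hd1 : h < d1 by clear -h0 hh1; lra.
  have hd2 : h < d2 by clear -h0 hh2; lra.
  have m : C (y2 - h) <= C (y1 + h) by apply: mono; clear -h0 hh3 y10 y12 y2l; lra.
  have := Hd1 (y1 + h); rewrite addrAC subrr add0r gtr0_norm // => /(_ hd1).
  have := Hd2 (y2 - h); rewrite addrAC subrr add0r normrN gtr0_norm // => /(_ hd2).
  rewrite !ler_norml => /andP[p1 p2] /andP[p3 p4].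
  have e4 : 4 * e = C y2 - C y1 by rewrite /e; field.
  clearbody e C; by clear -e0 e4 m p1 p2 p3 p4; lra.
move=> y1 y2 y10 y12 y2l.
have [E|y12'] := eqVneq y1 y2.
  by exists y2; rewrite E ?lexx // !subrr mulr0.
have {}y12' : y1 < y2 by rewrite lt_neqAle y12' y12.
have {}m := ext y1 y2 y10 y12' y2l.
have i1 : 0 <= y1 <= lam by rewrite y10 (le_trans y12 y2l).
have i2 : 0 <= y2 <= lam by rewrite y2l (le_trans y10 y12).
rewrite (CE _ i1) (CE _ i2) in m.
have h1 (x : R) : x \in `]y1, y2[ -> is_derive x 1 F (b x).
  rewrite in_itv /= => /andP[yc _]; apply: dF; apply: lt_trans yc.
  by apply: lt_le_trans y10; rewrite ltrN10.
have h2 : {within `[y1, y2], continuous F}.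
  apply: derivable_within_continuous => t; rewrite in_itv /= => /andP[yt _].
  have t1 : -1 < t by apply: lt_le_trans yt; apply: lt_le_trans y10; rewrite ltrN10.
  by have [] := dF t t1.
have [c cy E] := MVT_segment y12 h1 h2.
move: cy; rewrite in_itv /= => /andP[c1 c2].
exists c; first by rewrite c1 c2.
rewrite -bE; last by rewrite (le_trans y10 c1) (le_trans c2 y2l).
by rewrite -E; lra.
Qed.

End Slicing2.

(** * Kuznetsov's argument *)

Section UnitIntegral.
Variable R : realType.
Notation mu := (@lebesgue_measure R).
Notation Int f := (\int[mu]_(x in `[0, 1[) f x).

Definition bm (f : R -> R) := measurable_fun (`[0, 1[ : set R) f /\
  exists b, forall x, 0 <= x < 1 -> `|f x| <= b.

Lemma bm_int f : bm f -> mu.-integrable `[0, 1[ (EFin \o f).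
Proof.
move=> [mf [b fb]]; apply: measurable_bounded_integrable => //.
  by rewrite /= lebesgue_measure_itv /= lte_fin ltr01 oppr0 adde0 ltry.
exists b; split; first by rewrite num_real.
move=> M bM x /=; rewrite in_itv /= => x01.
by apply: (le_trans (fb x x01)); exact: ltW.
Qed.

Lemma bm_cst c : bm (fun=> c).
Proof. by split; [exact: measurable_cst|exists `|c|]. Qed.

Lemma bm_add f g : bm f -> bm g -> bm (fun x => f x + g x).
Proof.
move=> [mf [b fb]] [mg [c gc]]; split; first exact: measurable_funD.
by exists (b + c) => x x01; rewrite (le_trans (ler_normD _ _)) // lerD ?fb ?gc.
Qed.

Lemma bm_mul f g : bm f -> bm g -> bm (fun x => f x * g x).
Proof.
move=> [mf [b fb]] [mg [c gc]]; split; first exact: measurable_funM.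
by exists (b * c) => x x01; rewrite normrM ler_pM ?fb ?gc.
Qed.

Lemma bm_sub f g : bm f -> bm g -> bm (fun x => f x - g x).
Proof.
move=> [mf [b fb]] [mg [c gc]]; split; first exact: measurable_funB.
by exists (b + c) => x x01; rewrite (le_trans (ler_normB _ _)) // lerD ?fb ?gc.
Qed.

Lemma bm_norm f : bm f -> bm (fun x => `|f x|).
Proof.
move=> [mf [b fb]]; split; first exact: (measurableT_comp (@normr_measurable R setT)).
by exists b => x x01; rewrite normr_id fb.
Qed.

Lemma bm_cont f : continuous f -> bm f.
Proof.
move=> cf; split; first by apply: measurable_funTS; exact: continuous_measurable_fun.
have [M HM] := @continuous_seg_bounded R f 0 1 cf.
by exists M => x /andP[x0 x1]; apply: HM; rewrite x0 ltW.
Qed.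

Lemma IntD f g : bm f -> bm g -> Int (fun x => f x + g x) = Int f + Int g.
Proof. by move=> /bm_int fi /bm_int gi; rewrite RintegralD. Qed.

Lemma IntB f g : bm f -> bm g -> Int (fun x => f x - g x) = Int f - Int g.
Proof. by move=> /bm_int fi /bm_int gi; rewrite RintegralB. Qed.

Lemma IntZ c f : bm f -> Int (fun x => c * f x) = c * Int f.
Proof. by move=> /bm_int fi; rewrite RintegralZl. Qed.

Lemma Int_le f g : bm f -> bm g -> (forall x, 0 <= x < 1 -> f x <= g x) -> Int f <= Int g.
Proof.
move=> /bm_int fi /bm_int gi H; by apply: le_Rintegral.
Qed.

Lemma Int_eq f g : (forall x, 0 <= x < 1 -> f x = g x) -> Int f = Int g.
Proof. by move=> H; apply: eq_Rintegral => x; rewrite inE /= in_itv; exact: H. Qed.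

Lemma Int_norm f : bm f -> `|Int f| <= Int (fun x => `|f x|).
Proof. by move=> /bm_int fi; apply: le_normr_Rintegral. Qed.

Lemma Int_ge0 f : (forall x, 0 <= x < 1 -> 0 <= f x) -> 0 <= Int f.
Proof. by move=> H; apply: Rintegral_ge0 => x /=; rewrite in_itv; exact: H. Qed.

Lemma Int_cst c : Int (fun=> c) = c.
Proof. by rewrite Rintegral_cst //= lebesgue_measure_itv /= lte_fin ltr01 oppr0 adde0 /= mulr1. Qed.

Lemma bm_sum m (F : 'I_m -> R -> R) : (forall j, bm (F j)) -> bm (fun x => \sum_j F j x).
Proof.
move=> HF; elim: (index_enum _) => [|j s IH].
  have -> : (fun x => \sum_(j <- [::]) F j x) = (fun=> 0) by apply/funext=> x; rewrite big_nil.
  exact: bm_cst.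
have -> : (fun x => \sum_(j <- j :: s) F j x) = (fun x => F j x + \sum_(j <- s) F j x).
  by apply/funext=> x; rewrite big_cons.
exact: bm_add.
Qed.

Lemma Int_sum m (F : 'I_m -> R -> R) : (forall j, bm (F j)) ->
  Int (fun x => \sum_j F j x) = \sum_j Int (F j).
Proof.
move=> HF.
suff [] : bm (fun x => \sum_(j <- index_enum 'I_m) F j x) /\
   Int (fun x => \sum_(j <- index_enum 'I_m) F j x) = \sum_(j <- index_enum 'I_m) Int (F j) by [].
elim: (index_enum _) => [|j s [IH1 IH2]].
  have -> : (fun x => \sum_(j <- [::]) F j x) = (fun=> 0) by apply/funext=> x; rewrite big_nil.
  by split; [exact: bm_cst|rewrite big_nil Int_cst].
have -> : (fun x => \sum_(j <- j :: s) F j x) = (fun x => F j x + \sum_(j <- s) F j x).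
  by apply/funext=> x; rewrite big_cons.
by split; [exact: bm_add|rewrite IntD // IH2 big_cons].
Qed.

Lemma Int_mul_le (a f : R -> R) (B : R) : bm a -> bm f -> (forall x, `|a x| <= B) ->
  `|Int (fun x => a x * f x)| <= B * Int (fun x => `|f x|).
Proof.
move=> ba bf aB; apply: (le_trans (Int_norm (bm_mul ba bf))).
rewrite -IntZ; last exact: bm_norm.
apply: Int_le; [by apply: bm_norm; exact: bm_mul|apply: bm_mul; [exact: bm_cst|exact: bm_norm]|].
by move=> x _; rewrite normrM ler_wpM2r.
Qed.

(** Heine's theorem for a pseudo-distance, stated abstractly because it serves both the L^1 distance
    of time slices and ordinary uniform continuity. *)
Lemma segment_uniform (lam : R) (D : R -> R -> R) :
  (forall y y' y'' : R, 0 <= y <= lam -> 0 <= y' <= lam -> 0 <= y'' <= lam ->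
     D y y'' <= D y y' + D y' y'') ->
  (forall y y' : R, D y y' = D y' y) ->
  (forall y0 : R, 0 <= y0 <= lam -> forall e : R, 0 < e -> exists2 d : R, 0 < d &
     forall y : R, 0 <= y <= lam -> `|y - y0| < d -> D y y0 <= e) ->
  forall e : R, 0 < e -> exists2 d : R, 0 < d &
  forall y y' : R, 0 <= y <= lam -> 0 <= y' <= lam -> `|y - y'| < d -> D y y' <= e.
Proof.
move=> D_tri D_sym D_cont e e0.
pose P (d y : R) := 0 <= y <= lam -> forall y' : R, 0 <= y' <= lam -> `|y - y'| < d -> D y y' <= e.
have /compact_near_coveringP cov : compact (`[0, lam]%classic : set R) by exact: segment_compact.
have := cov R (0 : R)^'+ P _.
have e2 : 0 < e / 2 by rewrite divr_gt0.
case=> [y0 /=|d /= d0 H].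
  rewrite in_itv /= => hy0; have [d d0 Hd] := D_cont _ hy0 _ e2.
  exists (ball y0 (d / 2), `]0, d / 2[%classic) => /=.
    split; first by apply: nbhsx_ballx; rewrite divr_gt0.
    by near=> z; rewrite /= in_itv /=; apply/andP; split; near: z; [exact: nbhs_right_gt|apply: nbhs_right_lt; rewrite divr_gt0].
  move=> [y z] /= [yb]; rewrite in_itv /= => /andP[z0 zd] hy y' hy' yz.
  apply: (le_trans (D_tri _ _ _ hy hy0 hy')).
  have yd : `|y - y0| < d / 2 by rewrite distrC.
  have h1 : D y y0 <= e / 2 by apply: Hd => //; lra.
  have h2 : D y0 y' <= e / 2.
    rewrite D_sym; apply: Hd => //.
    have := ler_distD y y' y0; rewrite (distrC y' y); lra.
  lra.
exists (d / 2); first by rewrite divr_gt0.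
move=> y y' hy hy' yy'; apply: (H (d / 2)) => //=.
- by rewrite sub0r normrN gtr0_norm ?divr_gt0 //; lra.
- by rewrite divr_gt0.
Unshelve. all: by end_near.
Qed.

End UnitIntegral.

Notation Int01 f := (\int[lebesgue_measure]_(x in `[0, 1[) f x).

Section EntropySolution.
Variables (R : realType) (b1 b2 lam : R) (Psi : R -> R) (G : R -> R -> R).
Hypotheses (b1_gt0 : 0 < b1) (b1_lt_b2 : b1 < b2) (b2_lt1 : b2 < 1) (lam_gt0 : 0 < lam).
Hypothesis ent : entropy_solution b1 b2 lam Psi G.
Notation mu := (@lebesgue_measure R).
Let ph := phi b1 b2.
Let ka := kappa b1 b2.

Lemma sol_01 x y : 0 <= x < 1 -> 0 <= y <= lam -> 0 <= G x y <= 1.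
Proof. by have [H _] := ent; exact: H. Qed.

Lemma bm_sol y : 0 <= y <= lam -> bm (fun x => G x y).
Proof.
move=> yl; have [_ [mG _]] := ent; split; last first.
  by exists 1 => x x01; have /andP[h0 h1] := sol_01 x01 yl; rewrite ger0_norm.
have -> : (fun x => G x y) = (fun p : R * R => G p.1 p.2) \o (fun x => (x, y)) by [].
apply: (measurable_comp _ _ mG).
- by apply: measurableX.
- by move=> _ [x xi <-]; split => //=; rewrite in_itv.
- by apply: measurable_funTS; exact: pair2_measurable.
Qed.

Lemma bm_phi_sol y : 0 <= y <= lam -> bm (fun x => phi b1 b2 (G x y)).
Proof.
move=> yl; have [mG _] := bm_sol yl; split; last first.
  exists 1 => x x01; have /andP[h0 h1] := phi_01 b1_lt_b2 b2_lt1 (sol_01 x01 yl).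
  by rewrite ger0_norm.
(* Cut off at 0, [phi] is monotone on the whole line, hence measurable. *)
have mph : measurable_fun [set: R] (fun z : R => phi b1 b2 (Num.max 0 z)).
  apply: nondecreasing_measurable => // x z xz; apply: phi_le => //.
    by rewrite le_max lexx.
  by rewrite ge_max le_max lexx /= le_max xz orbT.
apply: eq_measurable_fun (measurableT_comp mph mG).
move=> x; rewrite inE /= in_itv /= => x01.
by have /andP[h0 _] := sol_01 x01 yl; rewrite max_r.
Qed.

Definition dL1 y y' : R := Int01 (fun x => `|G x y - G x y'|).

Lemma dL1_tri y y' y'' : 0 <= y <= lam -> 0 <= y' <= lam -> 0 <= y'' <= lam ->
  dL1 y y'' <= dL1 y y' + dL1 y' y''.
Proof.
move=> hy hy' hy''; rewrite /dL1 -IntD; [|apply: bm_norm; apply: bm_sub; exact: bm_sol..].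
apply: Int_le.
- by apply: bm_norm; apply: bm_sub; exact: bm_sol.
- by apply: bm_add; apply: bm_norm; apply: bm_sub; exact: bm_sol.
- by move=> x _; exact: ler_distD.
Qed.

Lemma dL1_sym y y' : dL1 y y' = dL1 y' y.
Proof. by apply: Int_eq => x _; rewrite distrC. Qed.

Lemma dL1_cont y0 : 0 <= y0 <= lam -> forall e, 0 < e -> exists2 d, 0 < d &
  forall y, 0 <= y <= lam -> `|y - y0| < d -> dL1 y y0 <= e.
Proof.
move=> hy0 e e0; have [_ [_ [_ [cont _]]]] := ent.
have [d [d0 H]] := cont y0 hy0 e e0; exists d => // y hy yd.
have := H y hy yd.
have bb : bm (fun x => `|G x y - G x y0|) by apply: bm_norm; apply: bm_sub; exact: bm_sol.
have fin : (\int[mu]_(x in `[0%R, 1%R[) (`|G x y - G x y0|)%:E)%E \is a fin_num.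
  by apply: integrable_fin_num => //; exact: bm_int.
by rewrite -(fineK fin) lee_fin.
Qed.

Lemma dL1_unif e : 0 < e -> exists2 d, 0 < d &
  forall y y', 0 <= y <= lam -> 0 <= y' <= lam -> `|y - y'| < d -> dL1 y y' <= e.
Proof. by apply: segment_uniform; [exact: dL1_tri|exact: dL1_sym|exact: dL1_cont]. Qed.

End EntropySolution.

(** * The Kruzkov inequality between two times *)

Section KruzkovSlice.
Variables (R : realType) (b1 b2 lam : R) (Psi : R -> R) (G : R -> R -> R).
Hypotheses (b1_gt0 : 0 < b1) (b1_lt_b2 : b1 < b2) (b2_lt1 : b2 < 1) (lam_gt0 : 0 < lam).
Hypothesis ent : entropy_solution b1 b2 lam Psi G.
Notation mu := (@lebesgue_measure R).
Variables (om dom : R -> R) (B1 B2 eta : R).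
Hypothesis kern : mollifier om dom B1 B2 eta.

Let shift_derive (z x : R) : is_derive x 1 (fun x => om (x - z)) (dom (x - z)).
Proof.
have d1 : is_derive x 1 (fun y : R => y - z) 1 by apply: is_derive_eq; rewrite subr0.
have := @is_derive1_comp R om (fun y : R => y - z) x (dom (x - z)) 1 (ker_derive kern (x - z)) d1.
by rewrite mulr1.
Qed.

Lemma ker_shift_cont (z : R) : continuous (fun x => om (x - z)).
Proof. by move=> x; exact: is_derive_cont (shift_derive z x). Qed.

Lemma dker_shift_cont (z : R) : continuous (fun x => dom (x - z)).
Proof.
have [d sd Hd] := smooth1_derive (ker_smooth kern z).
have -> : (fun x => dom (x - z)) = d.
  apply/funext => x; rewrite -(is_derive_derive1 (shift_derive z x)).
  exact: is_derive_derive1 (Hd x).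
exact: smooth1_continuous.
Qed.

Let lgs_le (k a b y : R) : 0 < k -> a <= b -> lgs k b y <= lgs k a y.
Proof.
move=> k0 ab; rewrite /lgs lef_pV2 ?posrE ?addr_gt0 ?expR_gt0 // lerD2l ler_expR lerN2.
by rewrite ler_pM2l // lerD2l lerN2.
Qed.

Let Aq z c y := Int01 (fun x => om (x - z) * `|G x y - c|).
Let Bq z c y := Int01 (fun x => dom (x - z) * `|phi b1 b2 (G x y) - phi b1 b2 c|).

Lemma bm_ent_pair c y : 0 <= y <= lam -> bm (fun x => `|G x y - c|).
Proof. by move=> hy; apply: bm_norm; apply: bm_sub; [exact: (bm_sol ent)|exact: bm_cst]. Qed.

Lemma bm_flux_pair c y : 0 <= y <= lam -> bm (fun x => `|phi b1 b2 (G x y) - phi b1 b2 c|).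
Proof.
move=> hy; apply: bm_norm; apply: bm_sub; last exact: bm_cst.
exact: (bm_phi_sol b1_lt_b2 b2_lt1 ent).
Qed.

Lemma flux_lip z c y y' : 0 <= y <= lam -> 0 <= y' <= lam ->
  `|Bq z c y - Bq z c y'| <= B1 * kappa b1 b2 * dL1 G y y'.
Proof.
move=> hy hy'.
have k0 : 0 <= kappa b1 b2 by apply: ltW; apply: lt_trans ltr01 (kappa_gt1 _ _).
have bd := bm_cont (@dker_shift_cont z).
have B10 : 0 <= B1 by apply: le_trans (normr_ge0 _) (ker_B1 kern 0).
rewrite /Bq -IntB; [|by apply: bm_mul => //; exact: bm_flux_pair..].
have -> : Int01 (fun x => dom (x - z) * `|phi b1 b2 (G x y) - phi b1 b2 c|
     - dom (x - z) * `|phi b1 b2 (G x y') - phi b1 b2 c|) =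
   Int01 (fun x => dom (x - z) * (`|phi b1 b2 (G x y) - phi b1 b2 c|
     - `|phi b1 b2 (G x y') - phi b1 b2 c|)).
  by apply: Int_eq => x _; rewrite mulrBr.
apply: (le_trans (Int_mul_le _ _ (fun x => ker_B1 kern (x - z)))) => //.
  by apply: bm_sub; exact: bm_flux_pair.
rewrite -mulrA ler_wpM2l // /dL1 -IntZ; last by apply: bm_norm; apply: bm_sub; exact: (bm_sol ent).
apply: Int_le.
- by apply: bm_norm; apply: bm_sub; exact: bm_flux_pair.
- by apply: bm_mul; [exact: bm_cst|apply: bm_norm; apply: bm_sub; exact: (bm_sol ent)].
move=> x x01; apply: (le_trans (ler_dist_dist _ _)).
rewrite opprB addrA subrK.
have /andP[g0 _] := sol_01 ent x01 hy; have /andP[g0' _] := sol_01 ent x01 hy'.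
exact: phi_lip_norm.
Qed.

(** The test function is the kernel in space times a difference of logistic steps in time. The
    inequality asks only for nonnegative tests, without vanishing at time lam, so the tails of the
    logistic steps are admissible. *)
Lemma kruzkov_slice z c y1 y2 : 0 <= c <= 1 -> 0 <= y1 -> y1 <= y2 -> y2 <= lam ->
  exists2 t, y1 <= t <= y2 &
  Int01 (fun x => om (x - z) * `|G x y2 - c|) - Int01 (fun x => om (x - z) * `|G x y1 - c|)
  <= Int01 (fun x => dom (x - z) * `|phi b1 b2 (G x t) - phi b1 b2 c|) * (y2 - y1).
Proof.
move=> c01 y10 y12 y2l.
have k0 : 0 <= kappa b1 b2 by apply: ltW; apply: lt_trans ltr01 (kappa_gt1 _ _).
have bo := bm_cont (@ker_shift_cont z).
have bd := bm_cont (@dker_shift_cont z).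
have B10 : 0 <= B1 by apply: le_trans (normr_ge0 _) (ker_B1 kern 0).
have i0 : 0 <= (0 : R) <= lam by rewrite lexx ltW.
(* The kernel has period 1, so a bound on [0, 1] is global. *)
have [Bo HBo] : exists b, forall x : R, `|om (x - z)| <= b.
  have [b Hb] := @continuous_seg_bounded R om 0 1 (fun x => is_derive_cont (ker_derive kern x)).
  exists b => x.
  suff H (s : R) : `|om s| <= b by exact: H.
  have per (n : int) t : om (t + n%:~R) = om t.
    have pn (k : nat) u : om (u + k%:R) = om u.
      by elim: k => [|k IH]; [rewrite addr0|rewrite -natr1 addrA (ker_per kern)].
    case: n => k; first by rewrite -pmulrn pn.
    by rewrite NegzE mulrNz -[LHS](pn k.+1) -pmulrn subrK.
  rewrite -(per (- Num.floor s)); apply: Hb.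
  have /andP[f1 f2] := floor_itv s.
  by rewrite mulrNz subr_ge0 f1 /= lerBlDr; move: f2; rewrite intrD addrC; exact: ltW.
have Bo0 : 0 <= Bo by apply: le_trans (normr_ge0 _) (HBo 0).
have uB : unif_cont_on lam (Bq z c).
  move=> e e0; pose M := B1 * kappa b1 b2 + 1.
  have M0 : 0 < M by rewrite ltr_wpDl // mulr_ge0.
  have [d d0 Hd] := dL1_unif ent (divr_gt0 e0 M0).
  exists d => // y y' hy hy' yy'; apply: (le_trans (flux_lip _ _ hy hy')).
  have D0 : 0 <= dL1 G y y' by apply: Int_ge0.
  have := Hd y y' hy hy' yy'; rewrite ler_pdivlMr // /M; lra.
have uA : unif_cont_on lam (Aq z c).
  move=> e e0; pose M := Bo + 1.
  have M0 : 0 < M by rewrite ltr_wpDl.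
  have [d d0 Hd] := dL1_unif ent (divr_gt0 e0 M0).
  exists d => // y y' hy hy' yy'.
  rewrite /Aq -IntB; [|by apply: bm_mul => //; exact: bm_ent_pair..].
  have -> : Int01 (fun x => om (x - z) * `|G x y - c| - om (x - z) * `|G x y' - c|) =
     Int01 (fun x => om (x - z) * (`|G x y - c| - `|G x y' - c|)).
    by apply: Int_eq => x _; rewrite mulrBr.
  apply: (le_trans (Int_mul_le _ _ HBo)) => //.
    by apply: bm_sub; exact: bm_ent_pair.
  have D0 : 0 <= dL1 G y y' by apply: Int_ge0.
  have D1 : Int01 (fun x => `|(`|G x y - c| - `|G x y' - c|)|) <= dL1 G y y'.
    apply: Int_le.
    - by apply: bm_norm; apply: bm_sub; exact: bm_ent_pair.
    - by apply: bm_norm; apply: bm_sub; exact: (bm_sol ent).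
    move=> x x01; apply: (le_trans (ler_dist_dist _ _)).
    by rewrite opprB addrA subrK.
  apply: (le_trans (ler_wpM2l Bo0 D1)).
  by have := Hd y y' hy hy' yy'; rewrite ler_pdivlMr // /M; lra.
have [|t ty H] := @slicing R (Aq z c) (Bq z c) lam lam_gt0 uA uB _ y1 y2 y10 y12 y2l; last by exists t.
move=> k u1 u2 kp u10 u12 u2l.
have [_ [_ [_ [_ [_ kru]]]]] := ent.
pose f (x y : R) := om (x - z) * (lgs k u1 y - lgs k u2 y).
have := kru f c _ _ _ c01.
have sf : smooth2 f by apply: smooth2_prod; [exact: (ker_smooth kern)|exact: smooth1_lgs2].
have pf : periodic_x f.
  by move=> x y; rewrite /f (_ : x + 1 - z = (x - z) + 1) ?(ker_per kern) //; ring.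
have f0 x y : 0 <= f x y.
  by rewrite mulr_ge0 ?(ker_ge0 kern) // subr_ge0 lgs_le // ltW.
move=> /(_ sf pf f0).
have px : pdx f = (fun x y => dom (x - z) * (lgs k u1 y - lgs k u2 y)).
  apply/funext=> x; apply/funext=> y; rewrite /pdx /f.
  exact: (is_derive_derive1 (is_derive_mulr _ (shift_derive z x))).
have py : pdy f = (fun x y => om (x - z) * (dlgs k u1 y - dlgs k u2 y)).
  apply/funext=> x; apply/funext=> y; rewrite /pdy /f.
  have dd : is_derive y 1 (fun y => lgs k u1 y - lgs k u2 y) (dlgs k u1 y - dlgs k u2 y).
    by apply: is_deriveB; exact: is_derive_lgs.
  exact: (is_derive_derive1 (is_derive_mull _ dd)).
rewrite px py /dint.
have -> : \int[mu]_(t in `[0, lam]) \int[mu]_(s in `[0, 1[)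
    (om (s - z) * (dlgs k u1 t - dlgs k u2 t) * `|G s t - c|
     + dom (s - z) * (lgs k u1 t - lgs k u2 t) * `|phi b1 b2 (G s t) - phi b1 b2 c|) =
  \int[mu]_(t in `[0, lam]) ((dlgs k u1 t - dlgs k u2 t) * Aq z c t
     + (lgs k u1 t - lgs k u2 t) * Bq z c t).
  apply: eq_Rintegral => t; rewrite inE /= in_itv /= => tl.
  rewrite /Aq /Bq -IntZ; last by apply: bm_mul => //; exact: bm_ent_pair.
  rewrite -IntZ; last by apply: bm_mul => //; exact: bm_flux_pair.
  rewrite -IntD; first last.
  - by apply: bm_mul; [exact: bm_cst|apply: bm_mul => //; exact: bm_flux_pair].
  - by apply: bm_mul; [exact: bm_cst|apply: bm_mul => //; exact: bm_ent_pair].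
  by apply: Int_eq => x _; ring.
have -> : \int[mu]_(s in `[0, 1[) (`|G s 0 - c| * f s 0) =
   (lgs k u1 0 - lgs k u2 0) * Aq z c 0.
  rewrite /Aq -IntZ; last by apply: bm_mul => //; exact: bm_ent_pair.
  by apply: Int_eq => x _; rewrite /f; ring.
by [].
Qed.

End KruzkovSlice.

Section LinearSteps.
Variable R : realType.
Implicit Types a b c d e h mi : R.

Lemma linear_step1 h a b c d : 0 <= h -> a - c <= b -> d - h * b <= d - h * a + h * c.
Proof. by move=> h0 abc; have := ler_wpM2l h0 abc; lra. Qed.

Lemma linear_step2 h a b c d e : d <= e + h * a + h * b -> d - h * a + h * c <= e + h * (c + b).
Proof. by lra. Qed.

Lemma linear_step3 a b c d : a - b <= c -> c <= d -> a <= b + d.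
Proof. by lra. Qed.

Lemma linear_step4 mi h a b c d e : 0 <= mi -> 0 <= h -> a - b <= c * h -> c <= d + e ->
  mi * a <= mi * b + h * (mi * d) + h * (mi * e).
Proof.
move=> mi0 h0 h1 h2; have := ler_wpM2l mi0 h1; have := ler_wpM2l mi0 (ler_wpM2l h0 h2).
by lra.
Qed.

End LinearSteps.

(** * The Kuznetsov functional *)

Section Kuznetsov.
Variables (R : realType) (b1 b2 lam : R) (Psi : R -> R) (G : R -> R -> R).
Hypotheses (b1_gt0 : 0 < b1) (b1_lt_b2 : b1 < b2) (b2_lt1 : b2 < 1) (lam_gt0 : 0 < lam).
Hypothesis ent : entropy_solution b1 b2 lam Psi G.
Variables (om dom : R -> R) (B1 B2 eta : R).
Hypothesis kern : mollifier om dom B1 B2 eta.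
Variables (m : nat) (dt e1 : R) (g : nat -> nat -> R).
Hypotheses (m_gt0 : (0 < m)%N) (dt_ge0 : 0 <= dt) (cfl : kappa b1 b2 * dt * m%:R <= 1).
Hypothesis g01 : forall n j, 0 <= g n j <= 1.
Hypothesis g_per : forall n j, g n (j + m)%N = g n j.
Hypothesis gS : forall n j, g n.+1 j =
  g n j - dt * m%:R * (phi b1 b2 (g n j) - phi b1 b2 (g n (j + m).-1)).
Hypothesis modulus : forall y y', 0 <= y <= lam -> 0 <= y' <= lam -> `|y - y'| <= dt ->
  dL1 G y y' <= e1.

Let mr0 : 0 < m%:R :> R. Proof. by rewrite ltr0n. Qed.
Let ph := phi b1 b2.
Let k0 : 0 <= kappa b1 b2.
Proof. by apply: ltW; apply: lt_trans ltr01 (kappa_gt1 _ _). Qed.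
Let B10 : 0 <= B1. Proof. by apply: le_trans (normr_ge0 _) (ker_B1 kern 0). Qed.
Let B20 : 0 <= B2.
Proof.
have := ker_B2 kern 0 1; rewrite sub0r normrN normr1 mulr1.
exact: le_trans (normr_ge0 _).
Qed.

(** Only space is doubled: scheme and solution are compared at the same time, the L^1 continuity in
    time taking over the role of a kernel in time. *)
Definition kuz (n : nat) (y : R) : R := \sum_(j < m) m%:R^-1 *
  Int01 (fun x => om (x - j%:R / m%:R) * `|G x y - g n j|).

Let bo j : bm (fun x => om (x - j%:R / m%:R)) := bm_cont (@ker_shift_cont _ _ _ _ _ _ kern _).
Let bd j : bm (fun x => dom (x - j%:R / m%:R)) := bm_cont (@dker_shift_cont _ _ _ _ _ _ kern _).

Lemma ker_taylor s h : 0 <= h -> `|om s - om (s - h) - h * dom s| <= B2 * h ^+ 2.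
Proof.
move=> h0; have sh : s - h <= s by rewrite gerBl.
have cf : {within `[s - h, s], continuous om}.
  by apply: continuous_subspaceT => z; exact: is_derive_cont (ker_derive kern z).
have [c ci ->] := MVT_segment sh (fun z _ => ker_derive kern z) cf.
rewrite opprB [s + _]addrC subrK mulrC -mulrBr normrM ger0_norm //.
rewrite expr2 mulrA [B2 * h]mulrC -mulrA ler_wpM2l //.
apply: (le_trans (ker_B2 kern _ _)); rewrite ler_wpM2l //.
move: ci; rewrite in_itv /= => /andP[c1 c2].
by rewrite ler0_norm; lra.
Qed.

(** Under the CFL condition a - mu phi(a) is nondecreasing in a, so the distance of c to a shrinks
    by exactly mu |phi(c) - phi(a)|; the incoming flux adds at most its own distance to phi(c). *)
Lemma scheme_entropy n j c : 0 <= c <= 1 ->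
  `|c - g n.+1 j| <= `|c - g n j|
    - dt * m%:R * (`|ph c - ph (g n j)| - `|ph c - ph (g n (j + m).-1)|).
Proof.
move=> /andP[c0 c1]; rewrite gS.
have /andP[a0 a1] := g01 n j; set a := g n j in a0 a1 *.
set b := g n _; set mu := dt * m%:R.
have mu0 : 0 <= mu by rewrite mulr_ge0 // ltW.
have cflm : kappa b1 b2 * mu <= 1 by rewrite /mu mulrA.
have -> : c - (a - mu * (phi b1 b2 a - phi b1 b2 b)) =
  ((c - a) - mu * (ph c - ph a)) + mu * (ph c - ph b) by rewrite /ph; ring.
apply: (le_trans (ler_normD _ _)); rewrite normrM (ger0_norm mu0).
suff : `|c - a - mu * (ph c - ph a)| <= `|c - a| - mu * `|ph c - ph a| by lra.
have [ac|/ltW ca] := leP a c.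
  have p0 : 0 <= ph c - ph a by rewrite subr_ge0 phi_le.
  have L := ler_wpM2l mu0 (phi_lip b1_lt_b2 b2_lt1 a0 ac).
  have d0 : 0 <= c - a by rewrite subr_ge0.
  have cc := ler_wpM2r d0 cflm.
  rewrite (ger0_norm p0) (ger0_norm d0) ger0_norm // /ph.
  by lra.
have p0 : ph c - ph a <= 0 by rewrite subr_le0 phi_le.
have L := ler_wpM2l mu0 (phi_lip b1_lt_b2 b2_lt1 c0 ca).
have d0 : 0 <= a - c by rewrite subr_ge0.
have cc := ler_wpM2r d0 cflm.
have d0' : c - a <= 0 by rewrite subr_le0.
rewrite (ler0_norm p0) (ler0_norm d0') ler0_norm; rewrite /ph; lra.
Qed.

Let bG n j y : 0 <= y <= lam -> bm (fun x => `|G x y - g n j|).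
Proof. by move=> hy; exact: (bm_ent_pair ent). Qed.

Let Ph n j y x := `|ph (G x y) - ph (g n j)|.

Let bP n j y : 0 <= y <= lam -> bm (Ph n j y).
Proof. by move=> hy; exact: (bm_flux_pair b1_lt_b2 b2_lt1 ent). Qed.

Let Ph_01 n j y x : 0 <= x < 1 -> 0 <= y <= lam -> 0 <= Ph n j y x <= 1.
Proof.
move=> x01 hy; have /andP[p0 p1] := phi_01 b1_lt_b2 b2_lt1 (sol_01 ent x01 hy).
have /andP[q0 q1] := phi_01 b1_lt_b2 b2_lt1 (g01 n j).
by rewrite /Ph /ph normr_ge0 /= ler_norml; apply/andP; split; lra.
Qed.

(** Summation by parts on the ring; the boundary terms match since both the kernel and the scheme
    are periodic. *)
Lemma discrete_parts n y x : \sum_(j < m) om (x - j%:R / m%:R) * (Ph n j y x - Ph n (j + m).-1 y x) =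
  \sum_(j < m) (om (x - j%:R / m%:R) - om (x - j.+1%:R / m%:R)) * Ph n j y x.
Proof.
have -> : \sum_(j < m) om (x - j%:R / m%:R) * (Ph n j y x - Ph n (j + m).-1 y x) =
  \sum_(j < m) om (x - j%:R / m%:R) * Ph n j y x - \sum_(j < m) om (x - j%:R / m%:R) * Ph n (j + m).-1 y x.
  by rewrite -sumrB; apply: eq_bigr => j _; rewrite mulrBr.
have -> : \sum_(j < m) (om (x - j%:R / m%:R) - om (x - j.+1%:R / m%:R)) * Ph n j y x =
  \sum_(j < m) om (x - j%:R / m%:R) * Ph n j y x - \sum_(j < m) om (x - j.+1%:R / m%:R) * Ph n j y x.
  by rewrite -sumrB; apply: eq_bigr => j _; rewrite mulrBl.
congr (_ - _).
case: m m_gt0 mr0 g_per => // m' _ mr0' gp.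
rewrite big_ord_recl [RHS]big_ord_recr [LHS]addrC /=; congr (_ + _).
  apply: eq_bigr => j _; congr (_ * _).
  rewrite /Ph -[in RHS](gp n j); congr (`|_ - ph (g n _)|).
rewrite mul0r subr0 divff ?gt_eqF //; congr (_ * _).
by rewrite -[RHS](ker_per kern) subrK.
Qed.

(** The discrete entropy inequality with the constant c = G x y, integrated against the kernel.
    After summation by parts the difference of the kernel is replaced by its derivative, at cost
    B2/m^2 for each of the m cells. *)
Lemma kuz_scheme_step n y : 0 <= y <= lam ->
  kuz n.+1 y <= kuz n y - dt * \sum_(j < m) m%:R^-1 *
     Int01 (fun x => dom (x - j%:R / m%:R) * Ph n j y x) + dt * (B2 / m%:R).
Proof.
move=> hy.
have bD j : bm (fun x => om (x - j%:R / m%:R) * (Ph n j y x - Ph n (j + m).-1 y x)).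
  by apply: bm_mul => //; apply: bm_sub; exact: bP.
have bF (j : nat) : bm (fun x => (om (x - j%:R / m%:R) - om (x - j.+1%:R / m%:R)) * Ph n j y x).
  by apply: bm_mul; [apply: bm_sub|exact: bP].
have S1 : kuz n.+1 y <= kuz n y - dt * \sum_(j < m)
    Int01 (fun x => om (x - j%:R / m%:R) * (Ph n j y x - Ph n (j + m).-1 y x)).
  rewrite /kuz mulr_sumr -sumrB; apply: ler_sum => j _.
  rewrite -!IntZ //; [|by apply: bm_mul => //; exact: bG..].
  rewrite -IntB; last 2 first.
  - by apply: bm_mul; [exact: bm_cst|apply: bm_mul => //; exact: bG].
  - by apply: bm_mul => //; exact: bm_cst.
  apply: Int_le.
  - by apply: bm_mul; [exact: bm_cst|apply: bm_mul => //; exact: bG].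
  - apply: bm_sub; first by apply: bm_mul; [exact: bm_cst|apply: bm_mul => //; exact: bG].
    by apply: bm_mul => //; exact: bm_cst.
  move=> x x01; have S := scheme_entropy n j (sol_01 ent x01 hy).
  have mi0 : 0 <= m%:R^-1 :> R by rewrite invr_ge0 ltW.
  rewrite mulrA; apply: (le_trans (ler_wpM2l (mulr_ge0 mi0 (ker_ge0 kern (x - j%:R / m%:R))) S)).
  rewrite le_eqVlt; apply/orP; left; apply/eqP; rewrite /Ph; field.
  by rewrite gt_eqF.
apply: (le_trans S1).
suff H : \sum_(j < m) m%:R^-1 * Int01 (fun x => dom (x - j%:R / m%:R) * Ph n j y x) - B2 / m%:R
    <= \sum_(j < m) Int01 (fun x => om (x - j%:R / m%:R) * (Ph n j y x - Ph n (j + m).-1 y x)).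
  exact: linear_step1.
rewrite -Int_sum //.
have -> : Int01 (fun x => \sum_(j < m) om (x - j%:R / m%:R) * (Ph n j y x - Ph n (j + m).-1 y x)) =
   \sum_(j < m) Int01 (fun x => (om (x - j%:R / m%:R) - om (x - j.+1%:R / m%:R)) * Ph n j y x).
  rewrite -Int_sum //; apply: Int_eq => x _; exact: discrete_parts.
have -> : B2 / m%:R = \sum_(j < m) B2 / m%:R ^+ 2.
  rewrite sumr_const card_ord -mulr_natl; field.
  by rewrite gt_eqF.
rewrite -sumrB; apply: ler_sum => j _.
rewrite lerBlDl -IntZ; last by apply: bm_mul => //; exact: bP.
have cE : B2 / m%:R ^+ 2 = Int01 (fun _ : R => B2 / m%:R ^+ 2) by rewrite Int_cst.
rewrite cE -IntD //; last exact: bm_cst.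
apply: Int_le.
- by apply: bm_mul; [exact: bm_cst|apply: bm_mul => //; exact: bP].
- by apply: bm_add => //; exact: bm_cst.
move=> x x01; have /andP[P0 P1] := Ph_01 n j x01 hy.
have hm0 : 0 <= m%:R^-1 :> R by rewrite invr_ge0 ltW.
have := ker_taylor (x - j%:R / m%:R) hm0.
have -> : x - j%:R / m%:R - m%:R^-1 = x - j.+1%:R / m%:R.
  by rewrite -[j.+1%:R]natr1; field; rewrite gt_eqF.
rewrite ler_norml exprVn => /andP[t1 t2].
set o1 := om _ in t1 t2 *; set o2 := om _ in t1 t2 *; set d := dom _ in t1 t2 *.
have : 0 <= (o1 - o2 - m%:R^-1 * d + B2 / m%:R ^+ 2) * Ph n j y x by rewrite mulr_ge0 //; lra.
have : 0 <= B2 / m%:R ^+ 2 * (1 - Ph n j y x).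
  by rewrite mulr_ge0 ?subr_ge0 // divr_ge0 // exprn_ge0 // ltW.
by lra.
Qed.

(** The scheme advances with the solution frozen at the new time, then the solution advances with
    the scheme frozen. The kernel depends on the difference of the two points, so the flux terms are
    opposite; they cancel up to moving the intermediate time of [kruzkov_slice] to the new time. *)
Lemma kuz_step n : n.+1%:R * dt <= lam ->
  kuz n.+1 (n.+1%:R * dt) <= kuz n (n%:R * dt) + dt * (B2 / m%:R + B1 * kappa b1 b2 * e1).
Proof.
move=> nl; have dt0 := dt_ge0; set y' := n.+1%:R * dt in nl *; set y := n%:R * dt.
have y0 : 0 <= y by rewrite mulr_ge0.
have yy : y' - y = dt by rewrite /y' /y -[n.+1%:R]natr1; ring.
have hy' : 0 <= y' <= lam by rewrite nl mulr_ge0.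
have hy : 0 <= y <= lam by rewrite y0 /=; lra.
apply: (le_trans (kuz_scheme_step n hy')).
suff : kuz n y' <= kuz n y + dt * \sum_(j < m) m%:R^-1 *
     Int01 (fun x => dom (x - j%:R / m%:R) * Ph n j y' x) + dt * (B1 * kappa b1 b2 * e1).
  exact: linear_step2.
have -> : B1 * kappa b1 b2 * e1 = \sum_(j < m) m%:R^-1 * (B1 * kappa b1 b2 * e1).
  rewrite sumr_const card_ord -mulr_natl; field.
  by rewrite gt_eqF.
rewrite !mulr_sumr /kuz -!big_split /=; apply: ler_sum => j _.
have yley' : y <= y' by lra.
have [t /andP[t1 t2] Ht] := kruzkov_slice b1_lt_b2 b2_lt1 lam_gt0 ent kern (j%:R / m%:R) (g01 n j) y0 yley' nl.
have ht : 0 <= t <= lam by lra.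
have mt : dL1 G t y' <= e1.
  by apply: modulus => //; rewrite ler0_norm; lra.
have F := flux_lip b1_lt_b2 b2_lt1 ent kern (j%:R / m%:R) (g n j) ht hy'.
rewrite yy in Ht.
have F2 : Int01 (fun x => dom (x - j%:R / m%:R) * Ph n j t x) <=
  Int01 (fun x => dom (x - j%:R / m%:R) * Ph n j y' x) + B1 * kappa b1 b2 * e1.
  apply: linear_step3 (le_trans (ler_norm _) F) _.
  by apply: ler_wpM2l => //; exact: mulr_ge0.
have mi0 : 0 <= m%:R^-1 :> R by rewrite invr_ge0 ltW.
exact: linear_step4 mi0 dt_ge0 Ht F2.
Qed.

Lemma kuz_bound n : n%:R * dt <= lam ->
  kuz n (n%:R * dt) <= kuz 0 0 + lam * (B2 / m%:R + B1 * kappa b1 b2 * e1).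
Proof.
have e10 : 0 <= e1.
  apply: (@le_trans _ _ (dL1 G 0 0)); first exact: Int_ge0.
  by apply: modulus; rewrite ?lexx ?(ltW lam_gt0) // subrr normr0.
set err := B2 / m%:R + B1 * kappa b1 b2 * e1 => nl.
have err0 : 0 <= err.
  apply: addr_ge0; first by apply: divr_ge0 => //; exact: ltW.
  by apply: mulr_ge0 => //; exact: mulr_ge0.
suff : kuz n (n%:R * dt) <= kuz 0 0 + n%:R * dt * err.
  by move=> /le_trans; apply; rewrite lerD2l ler_wpM2r.
elim: n nl => [|n IH] nl; first by rewrite !mul0r addr0.
have nl' : n%:R * dt <= lam.
  by apply: le_trans nl; rewrite ler_wpM2r // ler_nat.
apply: (le_trans (kuz_step nl)); rewrite -/err.
by have := IH nl'; rewrite -[n.+1%:R]natr1; lra.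
Qed.

End Kuznetsov.

(** * Convergence of the scheme *)

Section Steps.
Variable R : realType.
Notation mu := (@lebesgue_measure R).
Implicit Types p q x z r : R.

Lemma pdistE x : pdist x = sin (pi * x) ^+ 2.
Proof.
rewrite /pdist; have -> : 2 * pi * x = (pi * x) *+ 2 by ring.
rewrite cos_mulr2n; have := cos2Dsin2 (pi * x) => H.
have -> : sin (pi * x) ^+ 2 = 1 - cos (pi * x) ^+ 2 by move: H; lra.
by field.
Qed.

Lemma pdist_ge0 x : 0 <= pdist x.
Proof. by rewrite pdistE sqr_ge0. Qed.

Lemma pdist_cont : continuous (@pdist R).
Proof.
move=> x; apply: (@is_derive_cont R _ x (pi * sin (2 * pi * x))).
by apply: is_derive_eq; rewrite /GRing.scale /=; field.
Qed.

Lemma pdist_far r : 0 < r -> r < 1 / 2 ->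
  exists2 c, 0 < c & forall x, r <= `|x| <= 1 - r -> c <= pdist x.
Proof.
move=> r0 r1; have rr : r <= 1 - r by lra.
have [c ci Hc] := @EVT_min R (@pdist R) r (1 - r) rr (continuous_subspaceT pdist_cont).
exists (pdist c).
  rewrite pdistE exprn_gt0 // sin_gt0_pi //.
  move: ci; rewrite in_itv /= => /andP[c1 c2]; have := pi_gt0 R => p0.
  rewrite mulr_gt0 //=; last by lra.
  by rewrite gtr_pMr //; lra.
move=> x hx; have -> : pdist x = pdist `|x|.
  by rewrite /pdist; case: (leP 0 x) => [/ger0_norm->//|/ltr0_norm->]; rewrite mulrN cosN.
by apply: Hc; rewrite in_itv.
Qed.

Definition step q x : R := if x < q then 1 else 0.

Lemma step_01 q x : 0 <= step q x <= 1.
Proof. by rewrite /step; case: ifP; rewrite ?lexx ler01. Qed.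

Lemma step_le p q x : p <= q -> step p x <= step q x.
Proof.
rewrite /step => pq; case: ifP => xp; last by case: ifP.
by rewrite (lt_le_trans xp pq).
Qed.

Lemma bm_step q : bm (step q).
Proof.
split; last by exists 1 => x _; have /andP[h0 h1] := step_01 q x; rewrite ger0_norm.
apply: nonincreasing_measurable => // x z xz.
rewrite /step; case: ifP => zq; last by case: ifP.
by rewrite (le_lt_trans xz zq).
Qed.

Lemma Int_step_mul (p q : R) (f : R -> R) : 0 <= p -> p <= q -> q <= 1 ->
  \int[mu]_(x in `[p, q[) f x = Int01 (fun x => (step q x - step p x) * f x).
Proof.
move=> p0 pq q1; rewrite Rintegral_mkcond [RHS]Rintegral_mkcond; congr Rintegral.
apply/funext => x; rewrite /patch !mem_setE !in_itv /= /step.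
case: (ltP x q) => xq; case: (ltP x p) => xp; rewrite ?andbF ?andbT //=.
- by case: ifP; rewrite ?subrr ?mul0r.
- by rewrite (le_trans p0 xp) (lt_le_trans xq q1) subr0 mul1r.
- by case: ifP => _; rewrite ?sub0r //; move: (lt_le_trans xp pq); rewrite ltNge xq.
- by case: ifP; rewrite ?subrr ?mul0r.
Qed.

Lemma Int_step q : 0 <= q <= 1 -> Int01 (step q) = q.
Proof.
move=> /andP[q0 q1].
have -> : Int01 (step q) = Int01 (fun x => (step q x - step 0 x) * 1).
  apply: Int_eq => x /andP[x0 _]; rewrite mulr1 /step [x < 0]ltNge x0 /= subr0 //.
rewrite -Int_step_mul // Rintegral_cst //= lebesgue_measure_itv /= lte_fin mul1r.
have [q0'|] := ltP 0 q; first by rewrite oppr0 adde0.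
by move=> q0'; apply/eqP; rewrite eq_le q0 q0'.
Qed.

Lemma Int_step_clamp q : Int01 (step q) = Num.min 1 (Num.max 0 q).
Proof.
have [q0|q0] := ltP q 0.
  have -> : Int01 (step q) = Int01 (fun _ : R => 0).
    by apply: Int_eq => x /andP[x0 _]; rewrite /step ltNge (le_trans (ltW q0) x0).
  by rewrite Int_cst min_r.
have [q1|q1] := leP q 1; first by rewrite Int_step ?q0.
have -> : Int01 (step q) = Int01 (fun _ : R => 1).
  by apply: Int_eq => x /andP[_ x1]; rewrite /step (lt_trans x1 q1).
by rewrite Int_cst.
Qed.

Lemma Int_step_diff p q : p <= q -> Int01 (fun x => step q x - step p x) <= q - p.
Proof.
move=> pq; rewrite IntB; [|exact: bm_step..].
have m0 : Num.min 1 0 = 0 :> R by rewrite min_r.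
rewrite !Int_step_clamp.
by case: (leP 0 q) => ?; case: (leP 0 p) => ?; case: (leP 1 q) => ?; case: (leP 1 p) => ?;
  rewrite ?m0; lra.
Qed.

End Steps.

(** * Smearing by the kernel on a grid *)

Section Smearing.
Variables (R : realType) (om dom : R -> R) (B1 B2 eta : R).
Hypothesis kern : mollifier om dom B1 B2 eta.
Variable m : nat.
Hypothesis m_gt0 : (0 < m)%N.
Let mr0 : 0 < m%:R :> R. Proof. by rewrite ltr0n. Qed.
Let B10 : 0 <= B1. Proof. by apply: le_trans (normr_ge0 _) (ker_B1 kern 0). Qed.

Definition chi (j : nat) (x : R) : R := step (j.+1%:R / m%:R) x - step (j%:R / m%:R) x.

Let grid_le (j : nat) : j%:R / m%:R <= j.+1%:R / m%:R :> R.
Proof. by rewrite ler_pM2r ?invr_gt0 // ler_nat. Qed.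

Lemma bm_chi j : bm (chi j).
Proof. by apply: bm_sub; exact: bm_step. Qed.

Lemma chi_ge0 j x : 0 <= chi j x.
Proof. by rewrite subr_ge0 step_le. Qed.

Lemma chiP j x : chi j x = 0 \/ `|x - j%:R / m%:R| <= m%:R^-1.
Proof.
rewrite /chi /step; case: (ltP x (j%:R / m%:R)) => x1; case: (ltP x (j.+1%:R / m%:R)) => x2.
- by left; rewrite subrr.
- by left; have := lt_le_trans x1 (grid_le j); rewrite ltNge x2.
- right; have E : j.+1%:R / m%:R = j%:R / m%:R + m%:R^-1 :> R.
    by rewrite -[j.+1%:R]natr1 mulrDl mul1r.
  by rewrite ger0_norm ?subr_ge0 //; lra.
- by left; rewrite subrr.
Qed.

Lemma sum_chi x : 0 <= x < 1 -> \sum_(j < m) chi j x = 1.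
Proof.
move=> /andP[x0 x1].
rewrite -(big_mkord predT (fun j => chi j x)) telescope_sumr //.
by rewrite /step mul0r divff ?gt_eqF // x1 ltNge x0 subr0.
Qed.

Lemma Int_chi j : (j < m)%N -> Int01 (chi j) = m%:R^-1.
Proof.
move=> jm; rewrite IntB; [|exact: bm_step..].
have i0 (k : nat) : (k <= m)%N -> 0 <= (k%:R / m%:R : R) <= 1.
  by move=> km; rewrite divr_ge0 // ler_pdivrMr // mul1r ler_nat.
rewrite !Int_step ?i0 // ?(ltnW jm) //.
by rewrite -[j.+1%:R]natr1; ring.
Qed.

Let bo (z : R) : bm (fun x => om (x - z)) := bm_cont (@ker_shift_cont _ _ _ _ _ _ kern _).
Let bo' (z : R) : bm (fun x => om (z - x)).
Proof.
have -> : (fun x => om (z - x)) = (fun x => om (x - z)); last exact: bo.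
by apply/funext => x; rewrite -(ker_even kern) opprB.
Qed.

(** The kernel has mass 1 and varies by at most B1/m within a cell. *)
Lemma ker_riemann x : `|\sum_(j < m) m%:R^-1 * om (x - j%:R / m%:R) - 1| <= B1 / m%:R.
Proof.
pose F (j : 'I_m) (z : R) := chi j z * (om (x - j%:R / m%:R) - om (x - z)).
have bF j : bm (F j).
  by apply: bm_mul; [exact: bm_chi|apply: bm_sub; [exact: bm_cst|exact: bo']].
have -> : \sum_(j < m) m%:R^-1 * om (x - j%:R / m%:R) - 1 = Int01 (fun z => \sum_j F j z).
  have E1 : 1 = Int01 (fun z => \sum_(j < m) chi j z * om (x - z)).
    transitivity (Int01 (fun z => om (z - x))); first by rewrite (ker_mass kern).
    apply: Int_eq => z z01.
    by rewrite -mulr_suml sum_chi // mul1r -(ker_even kern) opprB.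
  rewrite [X in _ - X = _]E1.
  rewrite Int_sum //; last by move=> j; apply: bm_mul; [exact: bm_chi|exact: bo'].
  rewrite Int_sum // -sumrB; apply: eq_bigr => j _.
  rewrite /F; under [in RHS]eq_Rintegral do rewrite mulrBr.
  rewrite IntB; last 2 first.
  - by apply: bm_mul; [exact: bm_chi|exact: bm_cst].
  - by apply: bm_mul; [exact: bm_chi|exact: bo'].
  congr (_ - _); under [in RHS]eq_Rintegral do rewrite mulrC.
  by rewrite IntZ ?Int_chi //; [rewrite mulrC|exact: bm_chi].
apply: (le_trans (Int_norm (bm_sum bF))).
have -> : B1 / m%:R = Int01 (fun _ : R => B1 / m%:R) by rewrite Int_cst.
apply: Int_le; [by apply: bm_norm; exact: bm_sum|exact: bm_cst|].
move=> z z01; apply: (le_trans (ler_norm_sum _ _ _)).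
apply: (@le_trans _ _ (\sum_(j < m) chi j z * (B1 / m%:R))); last by rewrite -mulr_suml sum_chi // mul1r.
apply: ler_sum => j _; rewrite /F normrM ger0_norm ?chi_ge0 //.
have [->|zj] := chiP j z; first by rewrite !mul0r.
apply: ler_wpM2l; first exact: chi_ge0.
apply: (le_trans (lip_of_derive (ker_derive kern) (ker_B1 kern) _ _)).
rewrite ler_wpM2l // (_ : x - j%:R / m%:R - (x - z) = z - j%:R / m%:R) //; ring.
Qed.

Lemma Int_smear W : bm W -> (forall x, 0 <= x < 1 -> 0 <= W x) ->
  \sum_(j < m) m%:R^-1 * Int01 (fun x => om (x - j%:R / m%:R) * W x) <= (1 + B1 / m%:R) * Int01 W.
Proof.
move=> bW W0.
have bj (j : 'I_m) : bm (fun x => m%:R^-1 * (om (x - j%:R / m%:R) * W x)).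
  by apply: bm_mul; [exact: bm_cst|exact: bm_mul].
have -> : \sum_(j < m) m%:R^-1 * Int01 (fun x => om (x - j%:R / m%:R) * W x) =
   Int01 (fun x => \sum_(j < m) m%:R^-1 * (om (x - j%:R / m%:R) * W x)).
  by rewrite Int_sum //; apply: eq_bigr => j _; rewrite IntZ //; exact: bm_mul.
rewrite -IntZ //; apply: Int_le; [exact: bm_sum|by apply: bm_mul => //; exact: bm_cst|].
move=> x x01.
have -> : \sum_(j < m) m%:R^-1 * (om (x - j%:R / m%:R) * W x) =
  (\sum_(j < m) m%:R^-1 * om (x - j%:R / m%:R)) * W x.
  by rewrite mulr_suml; apply: eq_bigr => j _; rewrite mulrA.
apply: ler_wpM2r; first exact: W0.
by have := le_trans (ler_norm _) (ker_riemann x); lra.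
Qed.

Variables (r c : R).
Hypotheses (r0 : 0 < r) (r1 : r < 1 / 2) (c0 : 0 < c).
Hypothesis far : forall x : R, r <= `|x| <= 1 - r -> c <= pdist x.

(** The indicator, on [0, 1), of the two layers of width r at the ends. Points close to each other
    across the cut 0 = 1 are not separated by [pdist] although they are far apart in [0, 1); this
    happens only in these layers. *)
Definition ends (x : R) : R := step r x + (step 1 x - step (1 - r) x).

Lemma bm_ends : bm ends.
Proof. by apply: bm_add; [exact: bm_step|apply: bm_sub; exact: bm_step]. Qed.

Lemma ends_ge0 x : 0 <= ends x.
Proof.
have /andP[s0 _] := step_01 r x; rewrite addr_ge0 // subr_ge0 step_le //.
by have := r0 => ?; lra.
Qed.

Lemma Int_ends : Int01 ends <= 2 * r.
Proof.
have r0' := r0; have r1' := r1.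
rewrite IntD; [|exact: bm_step|by apply: bm_sub; exact: bm_step].
have h : 1 - r <= 1 by lra.
have := Int_step_diff h; rewrite Int_step; last by apply/andP; split; lra.
by lra.
Qed.

Lemma near_or_far (q e K x z : R) : 0 <= x < 1 -> 0 <= z < 1 -> 0 <= K -> 0 <= e -> q <= K ->
  (`|x - z| < r -> q <= e) -> q <= e + K / c * pdist (x - z) + K * ends x.
Proof.
move=> /andP[x0 x1] /andP[z0 z1] K0 e0 qK near.
have p0 : 0 <= K / c * pdist (x - z) by rewrite mulr_ge0 ?pdist_ge0 // divr_ge0 // ltW.
have n0 : 0 <= K * ends x by rewrite mulr_ge0 // ends_ge0.
have [/near|xz] := ltP `|x - z| r; first by lra.
case: (boolP ((r <= x) && (x < 1 - r))) => [/andP[rx xr]|ne].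
  have : c <= pdist (x - z).
    by apply: far; rewrite xz /= ler_norml; apply/andP; split; lra.
  move=> cp; have : K <= K / c * pdist (x - z).
    by rewrite mulrAC ler_pdivlMr // ler_wpM2l.
  by lra.
have : 1 <= ends x.
  rewrite /ends /step x1; move: ne; rewrite negb_and -ltNge -leNgt.
  case: (ltP x r) => _ /=; last by move=> h; rewrite ltNge h /=; lra.
  by move=> _; case: ifP; lra.
by move=> h; have := ler_wpM2l K0 h; lra.
Qed.

(** Near the diagonal [q] is at most [e + w]; elsewhere the bound [K] is paid either by the kernel
    mass far from the diagonal, at most eta/c, or by the end layers, of total length at most 2 r. *)
Lemma smear_bound (q : nat -> R -> R) (w : R -> R) (e K : R) :
  (forall j, bm (q j)) -> bm w -> 0 <= K -> 0 <= e ->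
  (forall x, 0 <= x < 1 -> 0 <= w x) ->
  (forall j x, (j < m)%N -> 0 <= x < 1 -> q j x <= K) ->
  (forall j x, (j < m)%N -> 0 <= x < 1 -> `|x - j%:R / m%:R| < r -> q j x <= e + w x) ->
  \sum_(j < m) m%:R^-1 * Int01 (fun x => om (x - j%:R / m%:R) * q j x)
  <= e + K / c * eta + (1 + B1 / m%:R) * (K * (2 * r) + Int01 w).
Proof.
move=> bq bw K0 e0 w0 qK near.
pose W x := K * ends x + w x.
have bW : bm W by apply: bm_add => //; apply: bm_mul; [exact: bm_cst|exact: bm_ends].
have bp (z : R) : bm (fun x => pdist (x - z)).
  apply: bm_cont => x; apply: (@continuous_comp _ _ _ (fun x => x - z) (@pdist R)).
    by apply: cvgB; [exact: cvg_id|exact: cvg_cst].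
  exact: pdist_cont.
have Kc0 : 0 <= K / c by rewrite divr_ge0 // ltW.
have mi0 : 0 <= m%:R^-1 :> R by rewrite invr_ge0 ltW.
apply: (@le_trans _ _ (\sum_(j < m) (m%:R^-1 * (e + K / c * eta) +
   m%:R^-1 * Int01 (fun x => om (x - j%:R / m%:R) * W x)))).
  apply: ler_sum => j _; rewrite -mulrDr; apply: ler_wpM2l => //.
  have z01 : 0 <= (j%:R / m%:R : R) < 1.
    by rewrite divr_ge0 //= ltr_pdivrMr // mul1r ltr_nat.
  set z := j%:R / m%:R in z01 *.
  apply: (@le_trans _ _ (Int01 (fun x => e * om (x - z) + K / c * (om (x - z) * pdist (x - z))
      + om (x - z) * W x))).
    apply: Int_le.
    - by apply: bm_mul.
    - apply: bm_add; last exact: bm_mul.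
      apply: bm_add; first by apply: bm_mul => //; exact: bm_cst.
      by apply: bm_mul; [exact: bm_cst|exact: bm_mul].
    move=> x x01.
    have H : q j x - w x <= e + K / c * pdist (x - z) + K * ends x.
      apply: near_or_far => //.
        by have := qK j x (ltn_ord j) x01; have := w0 x x01; lra.
      by move=> xz; have := near j x (ltn_ord j) x01 xz; lra.
    have := ler_wpM2l (ker_ge0 kern (x - z)) H; rewrite /W; lra.
  rewrite IntD; last 2 first.
  - apply: bm_add; first by apply: bm_mul => //; exact: bm_cst.
    by apply: bm_mul; [exact: bm_cst|exact: bm_mul].
  - exact: bm_mul.
  rewrite lerD2r IntD; last 2 first.
  - by apply: bm_mul => //; exact: bm_cst.
  - by apply: bm_mul; [exact: bm_cst|exact: bm_mul].
  rewrite IntZ // IntZ; last exact: bm_mul.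
  rewrite (ker_mass kern) mulr1 lerD2l; apply: ler_wpM2l => //; exact: (ker_conc kern).
rewrite big_split /=; apply: lerD.
  set t := e + K / c * eta; rewrite sumr_const card_ord -[_ *+ m]mulr_natl mulrA divff ?mul1r //.
  by rewrite gt_eqF.
have W0 x : 0 <= x < 1 -> 0 <= W x.
  by move=> x01; rewrite addr_ge0 ?w0 // mulr_ge0 // ends_ge0.
apply: (le_trans (Int_smear bW W0)).
have f0 : 0 <= 1 + B1 / m%:R by rewrite addr_ge0 // divr_ge0 // ltW.
apply: ler_wpM2l => //.
rewrite /W IntD //; last by apply: bm_mul; [exact: bm_cst|exact: bm_ends].
rewrite lerD2r IntZ; last exact: bm_ends.
by apply: ler_wpM2l => //; exact: Int_ends.
Qed.

End Smearing.

Section Approximation.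
Variable R : realType.
Notation mu := (@lebesgue_measure R).

Lemma bm_approx (f : R -> R) (e : R) : bm f -> 0 < e ->
  exists2 fc : R -> R, continuous fc & Int01 (fun x => `|f x - fc x|) <= e.
Proof.
move=> bf e0.
have fin : (mu `[0%R, 1%R[ < +oo)%E by rewrite lebesgue_measure_itv /= lte_fin ltr01 oppr0 adde0 ltry.
have [g [cg ig lg]] := approximation_continuous_integrable (measurable_itv `[0%R, 1%R[) fin (bm_int bf).
have e0' : (0 < e%:E)%E by rewrite lte_fin.
have /fine_cvgP [_ /cvgrPdist_le /(_ e e0) [n _ /(_ n (leqnn n)) H]] := lg.
exists (g n) => //; move: H.
rewrite /= sub0r normrN; exact: le_trans (ler_norm _).
Qed.

Lemma continuous_uniform01 (f : R -> R) (e : R) : continuous f -> 0 < e ->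
  exists2 d : R, 0 < d & forall x z, 0 <= x <= 1 -> 0 <= z <= 1 -> `|x - z| < d -> `|f x - f z| <= e.
Proof.
move=> cf; apply: (@segment_uniform R 1 (fun x z => `|f x - f z|)).
- by move=> x y z _ _ _; exact: ler_distD.
- by move=> x y; rewrite distrC.
- move=> x _ d d0; have [t t0 H] := continuous_eps x cf d0.
  by exists t => // y _; exact: H.
Qed.

End Approximation.

(** * Profiles and their integrals *)

Section Profiles.
Variables (R : realType) (om dom : R -> R) (B1 B2 eta : R).
Hypothesis kern : mollifier om dom B1 B2 eta.
Variable m : nat.
Hypothesis m_gt0 : (0 < m)%N.
Variables (r c : R).
Hypotheses (r0 : 0 < r) (r1 : r < 1 / 2) (c0 : 0 < c).
Hypothesis far : forall x : R, r <= `|x| <= 1 - r -> c <= pdist x.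
Let mr0 : 0 < m%:R :> R. Proof. by rewrite ltr0n. Qed.
Let mi0 : 0 <= m%:R^-1 :> R. Proof. by rewrite invr_ge0 ltW. Qed.
Let B10 : 0 <= B1. Proof. by apply: le_trans (normr_ge0 _) (ker_B1 kern 0). Qed.
Let bo (z : R) : bm (fun x => om (x - z)) := bm_cont (@ker_shift_cont _ _ _ _ _ _ kern _).
Let z01 (j : 'I_m) : 0 <= (j%:R / m%:R : R) <= 1.
Proof. by rewrite divr_ge0 //= ler_pdivrMr // mul1r ler_nat ltnW. Qed.

Section InitialProfile.
Variables (f fc : R -> R) (g : nat -> R) (e e3 : R).
Hypotheses (bf : bm f) (f01 : forall x, 0 <= x < 1 -> 0 <= f x <= 1) (cfc : continuous fc).
Hypotheses (g01 : forall j, 0 <= g j <= 1) (e_ge0 : 0 <= e) (e3_ge0 : 0 <= e3).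
Hypothesis mr : m%:R^-1 < r.
Hypothesis fc_unif : forall x z, 0 <= x <= 1 -> 0 <= z <= 1 -> `|x - z| < r -> `|fc x - fc z| <= e.
Hypothesis g_avg : forall j, (j < m)%N -> `|g j - m%:R * Int01 (fun x => chi m j x * f x)| <= e3.

Let D := Int01 (fun x => `|f x - fc x|).
Let bD : bm (fun x => `|f x - fc x|).
Proof. by apply: bm_norm; apply: bm_sub => //; exact: bm_cont. Qed.
Let a (j : nat) := m%:R * Int01 (fun x => chi m j x * `|f x - fc x|).

Lemma cell_average j : (j < m)%N ->
  `|fc (j%:R / m%:R) - m%:R * Int01 (fun x => chi m j x * f x)| <= e + a j.
Proof.
move=> jm; set z := j%:R / m%:R.
have bc : bm (chi m j : R -> R) by exact: bm_chi.
have mc (t : R) : t = m%:R * Int01 (fun x => chi m j x * t).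
  have -> : Int01 (fun x => chi m j x * t) = Int01 (fun x => t * chi m j x).
    by apply: Int_eq => x _; rewrite mulrC.
  by rewrite IntZ // Int_chi //; field; rewrite gt_eqF.
rewrite {1}(mc (fc z)) (mc e) /a -mulrBr -mulrDr.
rewrite -IntB; [|by apply: bm_mul => //; exact: bm_cst|exact: bm_mul].
rewrite -IntD; [|by apply: bm_mul => //; exact: bm_cst|exact: bm_mul].
rewrite normrM ger0_norm ?(ltW mr0) // ler_pM2l //.
have b3 : bm (fun x => chi m j x * fc z - chi m j x * f x).
  by apply: bm_sub; apply: bm_mul => //; exact: bm_cst.
apply: (le_trans (Int_norm b3)); apply: Int_le.
- exact: bm_norm.
- by apply: bm_add; apply: bm_mul => //; exact: bm_cst.
move=> x /andP[x0 x1]; rewrite -mulrBr -mulrDr normrM ger0_norm ?chi_ge0 //.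
have [->|xz] := chiP m_gt0 j x; first by rewrite !mul0r.
apply: ler_wpM2l; first exact: chi_ge0.
apply: (le_trans (ler_distD (fc x) _ _)); rewrite [`|f x - _|]distrC lerD2r.
apply: fc_unif; first exact: (z01 (Ordinal jm)).
  by rewrite x0 ltW.
by rewrite distrC; exact: le_lt_trans mr.
Qed.

(** The cell averages of f are compared with f through a continuous approximation [fc]. Its L^1
    error [D] enters twice: pointwise in x, and through the averages over cells. *)
Lemma initial_profile :
  \sum_(j < m) m%:R^-1 * Int01 (fun x => om (x - j%:R / m%:R) * `|f x - g j|)
  <= (2 * e + e3) + 1 / c * eta + (1 + B1 / m%:R) * (1 * (2 * r) + D) + D.
Proof.
have a_ge0 j : 0 <= a j.
  by apply: mulr_ge0; [exact: ltW|apply: Int_ge0 => x _; rewrite mulr_ge0 // chi_ge0].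
have bq j : bm (fun x => `|f x - g j|) by apply: bm_norm; apply: bm_sub => //; exact: bm_cst.
have bqa j : bm (fun x => `|f x - g j| - a j) by apply: bm_sub => //; exact: bm_cst.
(* The cell errors [a j] are subtracted first, since they are small only on average: together they
   contribute exactly [D]. *)
have -> : \sum_(j < m) m%:R^-1 * Int01 (fun x => om (x - j%:R / m%:R) * `|f x - g j|) =
  \sum_(j < m) m%:R^-1 * Int01 (fun x => om (x - j%:R / m%:R) * (`|f x - g j| - a j)) + D.
  have -> : D = \sum_(j < m) m%:R^-1 * a j.
    have -> : D = Int01 (fun x => \sum_(j < m) chi m j x * `|f x - fc x|).
      by apply: Int_eq => x x01; rewrite -mulr_suml sum_chi // mul1r.
    rewrite Int_sum; last by move=> j; apply: bm_mul => //; exact: bm_chi.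
    by apply: eq_bigr => j _; rewrite /a mulrA mulVf ?mul1r // gt_eqF.
  rewrite -big_split /=; apply: eq_bigr => j _; rewrite -mulrDr; congr (_ * _).
  have Ea : Int01 (fun x => a j * om (x - j%:R / m%:R)) = a j.
    by rewrite IntZ // (ker_mass kern) mulr1.
  rewrite -[X in _ = _ + X]Ea -IntD; last 2 first.
  - exact: bm_mul.
  - by apply: bm_mul => //; exact: bm_cst.
  by apply: Int_eq => x _; ring.
rewrite lerD2r.
apply: (smear_bound kern m_gt0 r0 r1 c0 far (q := fun j x => `|f x - g j| - a j)) => //; first by have := e_ge0; have := e3_ge0; lra.
  move=> j x jm x01; have /andP[f0 f1] := f01 x01; have /andP[g0 g1] := g01 j.
  have := a_ge0 j; suff : `|f x - g j| <= 1 by lra.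
  by rewrite ler_norml; apply/andP; split; lra.
move=> j x jm x01 xz; have /andP[x0 x1] := x01.
have h6 : `|fc x - fc (j%:R / m%:R)| <= e.
  by apply: fc_unif => //; [rewrite x0 ltW|exact: (z01 (Ordinal jm))].
have h5 := g_avg jm; rewrite distrC in h5.
rewrite lerBlDr.
apply: (le_trans (ler_distD (fc x) (f x) (g j))).
have -> : 2 * e + e3 + `|f x - fc x| + a j = `|f x - fc x| + (e + (e + a j + e3)) by ring.
apply: lerD => //; apply: (le_trans (ler_distD (fc (j%:R / m%:R)) _ _)); apply: lerD => //.
apply: (le_trans (ler_distD (m%:R * Int01 (fun x => chi m j x * f x)) _ _)).
by apply: lerD => //; exact: cell_average.
Qed.

End InitialProfile.

(** [A] is the integral smeared over the grid. It differs from the partial sum of g by the smeared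
    distance of f and g plus the smearing of the step function, which is nonzero only near the
    jump. *)
Lemma profile_height (f : R -> R) (g : nat -> R) (J : nat) :
  bm f -> (forall x, 0 <= x < 1 -> 0 <= f x <= 1) -> (forall j, 0 <= g j <= 1) -> (J <= m)%N ->
  `|Int01 (fun x => step (J%:R / m%:R) x * f x) - m%:R^-1 * \sum_(j < J) g j|
  <= \sum_(j < m) m%:R^-1 * Int01 (fun x => om (x - j%:R / m%:R) * `|f x - g j|)
     + B1 / m%:R + (0 + 1 / c * eta + (1 + B1 / m%:R) * (1 * (2 * r) + 2 * r)).
Proof.
move=> bf f01 g01 Jm; set p := J%:R / m%:R.
pose one (j : nat) : R := if (j < J)%N then 1 else 0.
have one01 j : 0 <= one j <= 1 by rewrite /one; case: ifP; rewrite ?lexx ler01.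
have bs : bm (step p : R -> R) by exact: bm_step.
have bsf : bm (fun x => step p x * f x) by exact: bm_mul.
pose A := \sum_(j < m) m%:R^-1 * Int01 (fun x => om (x - j%:R / m%:R) * (step p x * f x)).
have H1 : `|Int01 (fun x => step p x * f x) - A| <= B1 / m%:R.
  have bj (j : 'I_m) : bm (fun x => m%:R^-1 * (om (x - j%:R / m%:R) * (step p x * f x))).
    by apply: bm_mul; [exact: bm_cst|exact: bm_mul].
  have -> : A = Int01 (fun x => \sum_(j < m) m%:R^-1 * (om (x - j%:R / m%:R) * (step p x * f x))).
    by rewrite Int_sum //; apply: eq_bigr => j _; rewrite IntZ //; exact: bm_mul.
  rewrite -IntB //; last exact: bm_sum.
  have b2 : bm (fun x => step p x * f x -
      \sum_(j < m) m%:R^-1 * (om (x - j%:R / m%:R) * (step p x * f x))).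
    by apply: bm_sub => //; exact: bm_sum.
  apply: (le_trans (Int_norm b2)).
  have -> : B1 / m%:R = Int01 (fun _ : R => B1 / m%:R) by rewrite Int_cst.
  apply: Int_le; [exact: bm_norm|exact: bm_cst|move=> x x01].
  have -> : \sum_(j < m) m%:R^-1 * (om (x - j%:R / m%:R) * (step p x * f x)) =
     (\sum_(j < m) m%:R^-1 * om (x - j%:R / m%:R)) * (step p x * f x).
    by rewrite mulr_suml; apply: eq_bigr => j _; rewrite !mulrA.
  rewrite -{1}[step p x * f x]mul1r -mulrBl normrM distrC.
  have := ker_riemann kern m_gt0 x; set S := `|_ - 1| => HS.
  have : `|step p x * f x| <= 1.
    have /andP[s0 s1] := step_01 p x; have /andP[f0 f1] := f01 x x01.
    by rewrite ger0_norm; [exact: mulr_ile1|exact: mulr_ge0].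
  move=> h; rewrite -[X in _ <= X]mulr1; apply: ler_pM => //; exact: normr_ge0.
have H2 : `|A - m%:R^-1 * \sum_(j < J) g j| <=
   \sum_(j < m) m%:R^-1 * Int01 (fun x => om (x - j%:R / m%:R) * `|f x - g j|)
   + \sum_(j < m) m%:R^-1 * Int01 (fun x => om (x - j%:R / m%:R) * `|step p x - one j|).
  have -> : m%:R^-1 * \sum_(j < J) g j =
     \sum_(j < m) m%:R^-1 * Int01 (fun x => om (x - j%:R / m%:R) * (one j * g j)).
    rewrite mulr_sumr (big_ord_widen m (fun j => m%:R^-1 * g j)) // big_mkcond /=.
    apply: eq_bigr => j _; rewrite /one; case: ifP => _.
      under eq_Rintegral do rewrite mul1r mulrC.
      by rewrite IntZ // (ker_mass kern) mulr1.
    by under eq_Rintegral do rewrite mul0r mulr0; rewrite Int_cst mulr0.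
  rewrite -sumrB -big_split /=; apply: (le_trans (ler_norm_sum _ _ _)); apply: ler_sum => j _.
  have bfg : bm (fun x => `|f x - g j|) by apply: bm_norm; apply: bm_sub => //; exact: bm_cst.
  have bso : bm (fun x => `|step p x - one j|) by apply: bm_norm; apply: bm_sub => //; exact: bm_cst.
  rewrite -mulrBr -mulrDr normrM ger0_norm //; apply: ler_wpM2l => //.
  rewrite -IntB; [|exact: bm_mul|by apply: bm_mul => //; exact: bm_cst].
  rewrite -IntD; [|exact: bm_mul..].
  have bb : bm (fun x => om (x - j%:R / m%:R) * (step p x * f x) - om (x - j%:R / m%:R) * (one j * g j)).
    by apply: bm_sub; apply: bm_mul => //; exact: bm_cst.
  apply: (le_trans (Int_norm bb)); apply: Int_le.
  - exact: bm_norm.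
  - by apply: bm_add; exact: bm_mul.
  move=> x x01; rewrite -mulrBr -mulrDr normrM ger0_norm ?(ker_ge0 kern) //.
  apply: ler_wpM2l; first exact: (ker_ge0 kern).
  have -> : step p x * f x - one j * g j = step p x * (f x - g j) + (step p x - one j) * g j by ring.
  have /andP[s0 s1] := step_01 p x; have /andP[g0 g1] := g01 j.
  apply: (le_trans (ler_normD _ _)); rewrite !normrM (ger0_norm s0) (ger0_norm g0).
  by apply: lerD; [rewrite ler_piMl|rewrite ler_piMr].
have H3 : \sum_(j < m) m%:R^-1 * Int01 (fun x => om (x - j%:R / m%:R) * `|step p x - one j|) <=
    0 + 1 / c * eta + (1 + B1 / m%:R) * (1 * (2 * r) + Int01 (fun x => step (p + r) x - step (p - r) x)).
  have r0' := r0.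
  have pr : p - r <= p + r by lra.
  apply: (smear_bound kern m_gt0 r0 r1 c0 far (q := fun j x => `|step p x - one j|)) => //.
  - by move=> j; apply: bm_norm; apply: bm_sub => //; exact: bm_cst.
  - by apply: bm_sub; exact: bm_step.
  - by move=> x _; rewrite subr_ge0 step_le.
  - move=> j x _ _; have /andP[s0 s1] := step_01 p x; have /andP[t0 t1] := one01 j.
    by rewrite ler_norml; apply/andP; split; lra.
  move=> j x jm x01; rewrite ltr_norml => /andP[l1 l2]; rewrite add0r.
  have zj : (j%:R / m%:R < p) = (j < J)%N by rewrite /p ltr_pM2r ?invr_gt0 // ltr_nat.
  rewrite /one -zj /step.
  case: (ltP x p) => xp; case: (ltP (j%:R / m%:R) p) => zp.
  - by rewrite subrr normr0; do 2 case: ltP => ? //; lra.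
  - rewrite subr0 normr1 (_ : x < p + r); last by lra.
    by rewrite ltNge (_ : p - r <= x) ?subr0 //; lra.
  - rewrite sub0r normrN normr1 (_ : x < p + r); last by lra.
    by rewrite ltNge (_ : p - r <= x) ?subr0 //; lra.
  - by rewrite subrr normr0; do 2 case: ltP => ? //; lra.
have H4 : Int01 (fun x => step (p + r) x - step (p - r) x) <= 2 * r.
  have r0' := r0.
  have pr : p - r <= p + r by lra.
  by have := Int_step_diff pr; lra.
have f0 : 0 <= 1 + B1 / m%:R by rewrite addr_ge0 // divr_ge0 // ltW.
have H5 := ler_wpM2l f0 H4.
have := ler_distD A (Int01 (fun x => step p x * f x)) (m%:R^-1 * \sum_(j < J) g j).
set k := \sum_(j < m) _ in H2 *; set l := \sum_(j < m) _ in H2 H3.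
by rewrite !mulrDr in H3 H5 *; lra.
Qed.

End Profiles.

Section MacroArithmetic.
Variable R : realType.

Lemma macro_arith (lam x e k0 r D q b bb : R) : 0 < x -> x <= 1 -> 0 < lam ->
  (21 + 2 * lam) * x <= e -> r <= x -> 0 <= r -> D <= x -> 0 <= D -> q = x -> 0 <= b -> b <= x -> bb <= 2 * x ->
  k0 <= (2 * x + x) + q + (1 + b) * (1 * (2 * r) + D) + D + lam * bb ->
  k0 + b + (0 + q + (1 + b) * (1 * (2 * r) + 2 * r)) <= e.
Proof.
move=> x0 x1 l0 he hr r0 hD D0 -> b0 hb hbb hk.
have h1 : (1 + b) * (1 * (2 * r) + D) <= 2 * (3 * x) by apply: ler_pM; lra.
have h2 : (1 + b) * (1 * (2 * r) + 2 * r) <= 2 * (4 * x) by apply: ler_pM; lra.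
have h3 := ler_wpM2l (ltW l0) hbb.
lra.
Qed.

End MacroArithmetic.

(** * Choice of the kernel, the mesh and the time step *)

Section SchemeConvergence.
Variables (R : realType) (b1 b2 lam : R) (Psi : R -> R) (G : R -> R -> R).
Hypotheses (b1_gt0 : 0 < b1) (b1_lt_b2 : b1 < b2) (b2_lt1 : b2 < 1) (lam_gt0 : 0 < lam).
Hypothesis ent : entropy_solution b1 b2 lam Psi G.

Lemma bm_Psi : bm Psi /\ forall x, 0 <= x < 1 -> 0 <= Psi x <= 1.
Proof.
have l0 : 0 <= (0 : R) <= lam by rewrite lexx ltW.
have [_ [_ [G0 _]]] := ent.
have E x : 0 <= x < 1 -> 0 <= Psi x <= 1 by move=> x01; rewrite -G0 //; exact: (sol_01 ent).
split => //; have [mG _] := bm_sol ent l0; split; last first.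
  by exists 1 => x /E /andP[h0 h1]; rewrite ger0_norm.
apply: eq_measurable_fun mG => x; rewrite inE /= in_itv /= => x01; exact: G0.
Qed.

Lemma nat_above (x : R) : exists n : nat, x <= n%:R.
Proof.
exists (Num.truncn `|x|).+1; apply: (le_trans (ler_norm _)).
by apply: ltW; exact: truncnS_gt.
Qed.

(** The choices must follow this order: continuous approximation of the data, radius r, lower bound
    c of [pdist] beyond r, kernel, mesh against the bounds of the kernel, time step against the L^1
    modulus of G. *)
Lemma scheme_converges (e : R) : 0 < e -> exists2 e3 : R, 0 < e3 & exists M0 : nat,
  forall m, (M0 <= m)%N -> (0 < m)%N -> exists2 d0 : R, 0 < d0 &
  forall dt g, 0 <= dt -> dt < d0 -> kappa b1 b2 * dt * m%:R <= 1 ->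
  (forall n j, 0 <= g n j <= 1) -> (forall n j, g n (j + m)%N = g n j) ->
  (forall n j, g n.+1 j =
     g n j - dt * m%:R * (phi b1 b2 (g n j) - phi b1 b2 (g n (j + m).-1))) ->
  (forall j, (j < m)%N -> `|g 0%N j - m%:R * Int01 (fun x => chi m j x * Psi x)| <= e3) ->
  forall n J, n%:R * dt <= lam -> (J <= m)%N ->
  `|Int01 (fun x => step (J%:R / m%:R) x * G x (n%:R * dt)) - m%:R^-1 * \sum_(j < J) g n j| <= e.
Proof.
move=> e0; have l0 := lam_gt0.
(* [macro_arith] collects 21 + 2 lam multiples of x; the cap 1/4 keeps r below one half. *)
pose x : R := Num.min (1 / 4) (e / (21 + 2 * lam)).
have d0 : 0 < 21 + 2 * lam by lra.
have x0 : 0 < x by rewrite lt_min; apply/andP; split; [lra|exact: divr_gt0].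
have x4 : x <= 1 / 4 by rewrite ge_min lexx.
have x1 : x <= 1 by lra.
have xe : (21 + 2 * lam) * x <= e by rewrite mulrC -ler_pdivlMr // ge_min lexx orbT.
have [bP P01] := bm_Psi.
have [fc cfc HD] := bm_approx bP x0.
have [r' r'0 Hr'] := continuous_uniform01 cfc x0.
pose r : R := Num.min r' x.
have r0 : 0 < r by rewrite lt_min r'0.
have rx : r <= x by rewrite ge_min lexx orbT.
have r1 : r < 1 / 2 by lra.
have Hr y z : 0 <= y <= 1 -> 0 <= z <= 1 -> `|y - z| < r -> `|fc y - fc z| <= x.
  by move=> y01 z01 yz; apply: Hr' => //; apply: (lt_le_trans yz); rewrite ge_min lexx.
have [c c0 far] := pdist_far r0 r1.
(* With eta = c x, the kernel mass beyond distance r is at most x. *)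
have [om [dom [B1 [B2 kern]]]] := mollifier_exists (mulr_gt0 c0 x0).
have B10 : 0 <= B1 by apply: le_trans (normr_ge0 _) (ker_B1 kern 0).
have k0 : 0 < kappa b1 b2 by apply: lt_trans ltr01 (kappa_gt1 b1_lt_b2 b2_lt1).
have [M HM] := nat_above (Num.max (Num.max (B1 / x) (B2 / x)) (2 / r)).
exists x => //; exists M => m Mm m0.
have mr0 : 0 < m%:R :> R by rewrite ltr0n.
have : Num.max (Num.max (B1 / x) (B2 / x)) (2 / r) <= m%:R.
  by apply: (le_trans HM); rewrite ler_nat.
rewrite !ge_max => /andP[/andP[]]; rewrite !ler_pdivrMr // => Bm1 Bm2 rm.
have mB1 : B1 / m%:R <= x by rewrite ler_pdivrMr // mulrC.
have mB2 : B2 / m%:R <= x by rewrite ler_pdivrMr // mulrC.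
have mr : m%:R^-1 < r.
  rewrite -[m%:R^-1]mul1r ltr_pdivrMr // mulrC; lra.
pose e1 : R := x / (B1 * kappa b1 b2 + 1).
have B1k : 0 <= B1 * kappa b1 b2 by rewrite mulr_ge0 // ltW.
have e10 : 0 < e1 by rewrite divr_gt0 // ltr_wpDl.
have Be1 : B1 * kappa b1 b2 * e1 <= x.
  rewrite /e1 mulrA ler_pdivrMr; last by lra.
  by rewrite mulrC ler_wpM2l ?(ltW x0) //; lra.
have [d d00 Hd] := dL1_unif ent e10.
exists d => // dt g dt0 dtd cfl g01 g_per gS g_init n J nl Jm.
have mod y y' : 0 <= y <= lam -> 0 <= y' <= lam -> `|y - y'| <= dt -> dL1 G y y' <= e1.
  by move=> hy hy' yy; apply: Hd => //; exact: le_lt_trans dtd.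
have ny : 0 <= n%:R * dt <= lam by rewrite nl mulr_ge0.
apply: (le_trans (profile_height kern m0 r0 r1 c0 far (bm_sol ent ny)
   (fun z hz => sol_01 ent hz ny) (g01 n) Jm)).
have KB := kuz_bound b1_lt_b2 b2_lt1 l0 ent kern m0 dt0 cfl g01 g_per gS mod nl.
have IP := initial_profile kern m0 r0 r1 c0 far bP P01 cfc (g01 0%N) (ltW x0) (ltW x0) mr Hr g_init.
have E0 : kuz G om m g 0%N 0 = \sum_(j < m) m%:R^-1 *
    Int01 (fun x => om (x - j%:R / m%:R) * `|Psi x - g 0%N j|).
  rewrite /kuz; apply: eq_bigr => j _; congr (_ * _); apply: Int_eq => z z01.
  by have [_ [_ [G0 _]]] := ent; rewrite G0.
rewrite -E0 in IP.
have D0 : 0 <= Int01 (fun z => `|Psi z - fc z|) by apply: Int_ge0.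
apply: (@macro_arith R lam x e _ r _ _ _ (B2 / m%:R + B1 * kappa b1 b2 * e1) x0 x1 l0 xe rx (ltW r0) HD D0 _ _ mB1).
- by field; rewrite gt_eqF.
- by rewrite divr_ge0 // ltW.
- by have := lerD mB2 Be1; lra.
- by apply: (le_trans KB); rewrite lerD2r.
Qed.

End SchemeConvergence.

(** * Height functions *)

Section HeightFunction.
Variables (R : realType) (n L : nat) (psi : nat -> bool) (c : {ffun 'I_n.+1 * 'I_L -> coin}).
Notation N := n.+1.
Notation V := (Vt c psi).
Notation H := (Ht c psi).
Notation r_ b := ((b : bool)%:R : R).

(** Subtracting the arrows that have crossed the line at X fixes the additive constant of each row,
    so that space increments are particles at every time and time increments are currents. *)
Definition height (t X : nat) : R := \sum_(i < X) r_ (V 0%N i) - \sum_(s < t) r_ (H s X).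

Lemma vertex_conserve t x : r_ (V t.+1 x) + r_ (H t x.+1) = r_ (V t x) + r_ (H t x).
Proof.
have := vout_conserve (crow c t x) (V t x) (H t x).
by rewrite -(Vt_vertex c psi t x) /= => E; rewrite -!natrD E.
Qed.

Lemma heightS t X : height t X.+1 = height t X + r_ (V t X).
Proof.
elim: t => [|t IH]; first by rewrite /height !big_ord0 !subr0 big_ord_recr.
have E Y : height t.+1 Y = height t Y - r_ (H t Y) by rewrite /height big_ord_recr /=; ring.
by rewrite !E IH; have := vertex_conserve t X; lra.
Qed.

Lemma height_sum t X : height t X = height t 0 + \sum_(i < X) r_ (V t i).
Proof.
by elim: X => [|X IH]; rewrite ?big_ord0 ?addr0 // heightS IH big_ord_recr addrA.
Qed.

Lemma Vt_per t X : V t (X + N) = V t X.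
Proof. by rewrite -Vt_mod modnDr Vt_mod. Qed.

Lemma Ht_per t X : H t (X + N) = H t X.
Proof. by rewrite -Ht_mod modnDr Ht_mod. Qed.

Lemma height_per t X : height t (X + N) = height t X + height 0 N.
Proof.
elim: X => [|X IH]; last first.
  by rewrite addSn (heightS t (X + N)) (heightS t X) IH Vt_per; ring.
rewrite add0n /height !big_ord0 subr0 sub0r.
by rewrite [RHS]addrC; congr (_ - _); apply: eq_bigr => s _; rewrite -(Ht_per s 0).
Qed.

Lemma height_time t T X :
  height (t + T) X = height t X - (cnt [seq H r X | r <- iota t T])%:R.
Proof.
elim: T => [|T IH]; first by rewrite addn0 subr0.
have E Y s : height s.+1 Y = height s Y - r_ (H s Y) by rewrite /height big_ord_recr /=; ring.
rewrite addnS E IH -addn1 iotaD map_cat /cnt count_cat natrD /= addn0; ring.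
Qed.

Lemma height_window t Y W k : (k <= W)%N ->
  (cnt (drop k [seq V t x | x <- iota Y W]))%:R = height t (Y + W) - height t (Y + k).
Proof.
move=> kW; rewrite -map_drop drop_iota addnC -(subnKC kW).
rewrite addKn; move: (W - k)%N => w; rewrite addnA (addnC k Y).
elim: w => [|w IH]; first by rewrite addn0 subrr.
rewrite -addn1 iotaD map_cat /cnt count_cat natrD -/(cnt _) IH.
by rewrite addnA [(_ + w + 1)%N]addn1 heightS /= addn0; ring.
Qed.

Lemma height_gap t T X : `|(height (t + T) X - height (t + T) 0) - (height t X - height t 0)| <= T%:R.
Proof.
rewrite !height_time.
have b Y : 0 <= ((cnt [seq H r Y | r <- iota t T])%:R : R) <= T%:R.
  by rewrite ler0n ler_nat (leq_trans (count_size _ _)) // size_map size_iota.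
have /andP[? ?] := b X; have /andP[? ?] := b 0%N.
by rewrite ler_norml; apply/andP; split; lra.
Qed.

(* The initial heights on the grid of mesh 1/m, interpolated through the common
   refinement of mesh 1/(m N). *)
Definition fine_height (m k : nat) : R := \sum_(i < k) r_ (V 0%N (i %/ m)).

Definition grid_height (m j : nat) : R := fine_height m (j * N) / (m * N)%:R.

Lemma fine_height_incr m k l : (k <= l)%N ->
  0 <= fine_height m l - fine_height m k <= (l - k)%:R.
Proof.
move=> kl; rewrite -(subnKC kl) addKn; move: (l - k)%N => d.
elim: d => [|d /andP[h0 h1]]; first by rewrite addn0 subrr lexx.
rewrite addnS {1 3}/fine_height big_ord_recr /= -/(fine_height m _).
rewrite -[d.+1%:R]natr1; have b : 0 <= r_ (V 0%N ((k + d) %/ m)) <= 1 by case: (V _ _); rewrite ?lexx ler01.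
by move: b => /andP[? ?]; apply/andP; split; lra.
Qed.

Lemma fine_height_mul m X : (0 < m)%N -> fine_height m (m * X) = m%:R * height 0 X.
Proof.
move=> m0; rewrite /height big_ord0 subr0.
elim: X => [|X IH]; first by rewrite muln0 /fine_height !big_ord0 mulr0.
rewrite big_ord_recr /= mulrDr -IH mulnS addnC /fine_height big_split_ord /=; congr (_ + _).
rewrite (eq_bigr (fun=> r_ (V 0%N X))) ?sumr_const ?card_ord ?mulr_natl //.
by move=> i _; rewrite mulnC divnMDl // divn_small // addn0.
Qed.

Lemma fine_height_per m k : (0 < m)%N ->
  fine_height m (k + m * N) = fine_height m k + m%:R * height 0 N.
Proof.
move=> m0; rewrite -fine_height_mul // addnC /fine_height big_split_ord /= addrC; congr (_ + _).
apply: eq_bigr => i _; congr (r_ _).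
by rewrite mulnC divnMDl // [(N + _)%N]addnC modnDr.
Qed.

Section Grid.
Variable m : nat.
Hypothesis m_gt0 : (0 < m)%N.
Let mr0 : 0 < m%:R :> R. Proof. by rewrite ltr0n. Qed.
Let Nr0 : 0 < N%:R :> R. Proof. by rewrite ltr0n. Qed.

Lemma grid_slopeE j : m%:R * (grid_height m j.+1 - grid_height m j) =
  (fine_height m (j.+1 * N) - fine_height m (j * N)) / N%:R.
Proof. by rewrite /grid_height natrM; field; rewrite nat1r !pnatr_eq0 -!lt0n m_gt0. Qed.

Lemma grid_slope j : 0 <= m%:R * (grid_height m j.+1 - grid_height m j) <= 1.
Proof.
rewrite grid_slopeE.
have /andP[h0 h1] := @fine_height_incr m (j * N) (j.+1 * N) (leq_mul (leqnSn j) (leqnn N)).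
rewrite divr_ge0 //= ler_pdivrMr // mul1r; apply: (le_trans h1).
by rewrite mulSn addnK.
Qed.

Lemma grid_per j : grid_height m (j + m) = grid_height m j + height 0 N / N%:R.
Proof.
rewrite /grid_height mulnDl fine_height_per // natrM.
by field; rewrite nat1r !pnatr_eq0 -!lt0n m_gt0.
Qed.

Let gridX j X : j%:R / m%:R - X%:R / N%:R = ((j * N)%:R - (m * X)%:R) / (m * N)%:R :> R.
Proof. by rewrite !natrM; field; rewrite nat1r !pnatr_eq0 -!lt0n m_gt0. Qed.

Let uE X : height 0 X / N%:R = fine_height m (m * X) / (m * N)%:R.
Proof. by rewrite fine_height_mul // natrM; field; rewrite nat1r !pnatr_eq0 -!lt0n m_gt0. Qed.

Lemma fine_height_lip k l : fine_height m k <= fine_height m l + Num.max 0 (k%:R - l%:R).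
Proof.
have [kl|/ltnW lk] := leqP k l.
  have /andP[h _] := fine_height_incr m kl.
  have : 0 <= Num.max 0 (k%:R - l%:R) :> R by rewrite le_max lexx.
  by lra.
have /andP[_ h] := fine_height_incr m lk.
have : k%:R - l%:R <= Num.max 0 (k%:R - l%:R) :> R by rewrite le_max lexx orbT.
by rewrite natrB // in h; lra.
Qed.

Let mN0 : 0 < (m * N)%:R :> R. Proof. by rewrite ltr0n muln_gt0 m_gt0. Qed.

Let scale_max (x : R) : Num.max 0 (x / (m * N)%:R) = Num.max 0 x / (m * N)%:R.
Proof. by rewrite maxr_pMl ?mul0r // invr_ge0 ltW. Qed.

Lemma grid_init_lower j X :
  grid_height m j <= height 0 X / N%:R + Num.max 0 (j%:R / m%:R - X%:R / N%:R).
Proof. by rewrite gridX uE scale_max -mulrDl ler_pM2r ?invr_gt0 //; exact: fine_height_lip. Qed.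

Lemma grid_init_upper j X :
  height 0 X / N%:R <= grid_height m j + Num.max 0 (X%:R / N%:R - j%:R / m%:R).
Proof.
rewrite -opprB gridX uE -mulNr opprB scale_max -mulrDl ler_pM2r ?invr_gt0 //.
exact: fine_height_lip.
Qed.

End Grid.

End HeightFunction.

(** * Windows with typical currents *)

Section GoodWindows.
Variables (R : realType) (b1 b2 : R) (n L : nat) (psi : nat -> bool) (W T a : nat).
Notation N := n.+1.
Implicit Type c : {ffun 'I_N * 'I_L -> coin}.

(** The event bounded by [window_current_lower] at density k/N; restricting to this grid of
    densities keeps the union bound polynomial in N. *)
Definition slow_window (t Y k : nat) c : bool := [forall i : 'I_W.+1,
  (cnt [seq Ht c psi r (Y + W) | r <- iota t T])%:R + 3 * a%:R
  < phi b1 b2 (k%:R / N%:R) * T%:R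
    - (k%:R / N%:R * (W - i)%:R - (cnt (drop i [seq Vt c psi t x | x <- iota Y W]))%:R)].

Definition fast_window (t Y k : nat) c : bool := [forall i : 'I_W.+1,
  phi b1 b2 (k%:R / N%:R) * T%:R
  + ((cnt (drop i [seq Vt c psi t x | x <- iota Y W]))%:R - k%:R / N%:R * (W - i)%:R) + 3 * a%:R
  < (cnt [seq Ht c psi r (Y + W) | r <- iota t T])%:R].

(** The suffix starting at i yields the shift r = W - i, its particle count being the height
    difference across the last r sites. *)
Lemma not_slow t Y k c : ~~ slow_window t Y k c -> exists2 r, (r <= W)%N &
  height R psi c (t + T) (Y + W) <= height R psi c t (Y + W - r)
    + k%:R / N%:R * r%:R - phi b1 b2 (k%:R / N%:R) * T%:R + 3 * a%:R.
Proof.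
rewrite negb_forall => /existsP[i]; rewrite -leNgt => Hi.
have iW : (i <= W)%N by rewrite -ltnS.
exists (W - i)%N; first exact: leq_subr.
have -> : (Y + W - (W - i) = Y + i)%N by lia.
rewrite height_time; rewrite (height_window R psi c t Y iW) in Hi.
move: Hi; move: (k%:R / N%:R) (cnt _) => z w Hi.
lra.
Qed.

Lemma not_fast t Y k c : ~~ fast_window t Y k c -> exists2 r, (r <= W)%N &
  height R psi c t (Y + W - r) + k%:R / N%:R * r%:R - phi b1 b2 (k%:R / N%:R) * T%:R - 3 * a%:R
  <= height R psi c (t + T) (Y + W).
Proof.
rewrite negb_forall => /existsP[i]; rewrite -leNgt => Hi.
have iW : (i <= W)%N by rewrite -ltnS.
exists (W - i)%N; first exact: leq_subr.
have -> : (Y + W - (W - i) = Y + i)%N by lia.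
rewrite height_time; rewrite (height_window R psi c t Y iW) in Hi.
move: Hi; move: (k%:R / N%:R) (cnt _) => z w Hi.
lra.
Qed.

Definition bad_windows (S : nat) c : bool := [exists p : 'I_S * 'I_N * 'I_N.+1,
  slow_window (p.1.1 * T) p.1.2 p.2 c || fast_window (p.1.1 * T) p.1.2 p.2 c].

Section ParticlesVersusScheme.
Hypotheses (b1_gt0 : 0 < b1) (b1_lt_b2 : b1 < b2) (b2_lt1 : b2 < 1).
Variables (m S : nat) (al : R) (c : {ffun 'I_N * 'I_L -> coin}).
Let dt : R := T%:R / N%:R.
Hypotheses (m_gt0 : (0 < m)%N) (cfl : kappa b1 b2 * dt * m%:R <= 1) (al_gt0 : 0 < al).
Hypotheses (WN : (W <= N)%N) (good : ~~ bad_windows S c).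
Let tau : R := 3 * a%:R / N%:R.
Let Nr0 : 0 < N%:R :> R. Proof. by rewrite ltr0n. Qed.
Let mr0 : 0 < m%:R :> R. Proof. by rewrite ltr0n. Qed.
Let u q X := height R psi c (q * T) X / N%:R.
Let K := height R psi c 0 N / N%:R.
Let dt0 : 0 <= dt. Proof. by rewrite divr_ge0. Qed.

Let u_per q X : u q (X + N) = u q X + K.
Proof. by rewrite /u height_per mulrDl. Qed.

Let u_per_mul q X k : u q (X + k * N) = u q X + k%:R * K.
Proof.
elim: k => [|k IH]; first by rewrite mul0n addn0 mul0r addr0.
by rewrite mulSn addnCA addnC u_per IH -[k.+1%:R]natr1; ring.
Qed.

Let reduce X : (W <= X)%N -> exists Y k, (Y < N)%N /\ X = (Y + W + k * N)%N.
Proof.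
move=> WX; exists ((X - W) %% N)%N, ((X - W) %/ N)%N; rewrite ltn_mod; split=> //.
by rewrite addnAC [(_ + _ * N)%N]addnC -divn_eq subnK.
Qed.

Let wind q Y k : (q < S)%N -> (Y < N)%N -> (k <= N)%N ->
  ~~ slow_window (q * T) Y k c /\ ~~ fast_window (q * T) Y k c.
Proof.
move=> qS YN kN; have kN' : (k < N.+1)%N by [].
move: good; rewrite negb_exists => /forallP /(_ (Ordinal qS, Ordinal YN, Ordinal kN')) /=.
by rewrite negb_or => /andP[].
Qed.

Let u_lower q X k : (q < S)%N -> (W <= X)%N -> (k <= N)%N -> exists2 r, (r <= W)%N &
    u q (X - r)%N + k%:R / N%:R * (r%:R / N%:R) - dt * phi b1 b2 (k%:R / N%:R) - tau
    <= u q.+1 X.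
Proof.
move=> qS /reduce[Y [j [YN ->]]] kN; have [_ /not_fast[r rW Hr]] := wind qS YN kN.
exists r => //; have -> : (Y + W + j * N - r = (Y + W - r) + j * N)%N.
  by rewrite addnBAC // (leq_trans rW) // leq_addl.
rewrite !u_per_mul /u mulSn [(T + _)%N]addnC -(ler_pM2r Nr0).
have := Hr; set A := height _ _ _ _ _; set B := height _ _ _ _ _.
rewrite /dt /tau; have N0 : N%:R != 0 :> R by rewrite gt_eqF.
move: (k%:R / N%:R) => z h; rewrite -subr_ge0 in h; rewrite -subr_ge0.
move: h; congr (0 <= _); field.
by rewrite nat1r.
Qed.

Let u_upper q X k : (q < S)%N -> (W <= X)%N -> (k <= N)%N -> exists2 r, (r <= W)%N & u q.+1 X <=
    u q (X - r)%N + k%:R / N%:R * (r%:R / N%:R) - dt * phi b1 b2 (k%:R / N%:R) + tau.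
Proof.
move=> qS /reduce[Y [j [YN ->]]] kN; have [/not_slow[r rW Hr] _] := wind qS YN kN.
exists r => //; have -> : (Y + W + j * N - r = (Y + W - r) + j * N)%N.
  by rewrite addnBAC // (leq_trans rW) // leq_addl.
rewrite !u_per_mul /u mulSn [(T + _)%N]addnC -(ler_pM2r Nr0).
have := Hr; set A := height _ _ _ _ _; set B := height _ _ _ _ _.
rewrite /dt /tau; have N0 : N%:R != 0 :> R by rewrite gt_eqF.
move: (k%:R / N%:R) => z h; rewrite -subr_ge0 in h; rewrite -subr_ge0.
move: h; congr (0 <= _); field.
by rewrite nat1r.
Qed.

Lemma doubling_error_ge0 : 0 <= doubling_error b1 b2 m N W dt tau al.
Proof.
have k0 : 0 <= kappa b1 b2 by apply: ltW; apply: lt_trans ltr01 (kappa_gt1 b1_lt_b2 b2_lt1).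
have a0 := ltW al_gt0; have w0 : 0 <= W%:R / N%:R :> R by exact: divr_ge0.
have a2 : 0 <= 2 * al by exact: mulr_ge0.
by rewrite /doubling_error; do !apply: addr_ge0; apply: divr_ge0 => //; do ?[apply: mulr_ge0 => // | apply: exprn_ge0].
Qed.

(** Both doubling bounds are used at the pairs (J, X) and (0, 0), where J is the node just to the
    left of X; differences to position 0 are particle counts, and the mismatch of J and X costs
    1/m. *)
Lemma particles_scheme q X : (q <= S)%N ->
  `|(height R psi c (q * T) X - height R psi c (q * T) 0) / N%:R
    - m%:R^-1 * \sum_(j < (X * m) %/ N) gsch b1 b2 m dt (grid_height R psi c m) q j|
  <= m%:R^-1 + 2 * (al / 2 + S%:R * doubling_error b1 b2 m N W dt tau al).
Proof.
move=> qS; set v := scheme b1 b2 m dt (grid_height R psi c m).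
set Th := al / 2 + _.
have slope := grid_slope R psi c m_gt0.
have per := grid_per R psi c m_gt0.
have i0l j Y : grid_height R psi c m j <= u 0 Y + Num.max 0 (j%:R / m%:R - Y%:R / N%:R).
  by rewrite /u mul0n; exact: grid_init_lower.
have i0u j Y : u 0 Y <= grid_height R psi c m j + Num.max 0 (Y%:R / N%:R - j%:R / m%:R).
  by rewrite /u mul0n; exact: grid_init_upper.
have lo := doubling_lower b1_lt_b2 b2_lt1 m_gt0 dt0 cfl slope per al_gt0 (ltn0Sn n) WN u_per
  u_lower i0l qS.
have up := doubling_upper b1_lt_b2 b2_lt1 m_gt0 dt0 cfl slope per al_gt0 (ltn0Sn n) WN u_per
  u_upper i0u qS.
have Thq : al / 2 + q%:R * doubling_error b1 b2 m N W dt tau al <= Th.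
  by rewrite lerD2l ler_wpM2r ?doubling_error_ge0 // ler_nat.
set J := (X * m %/ N)%N.
have tel : m%:R^-1 * \sum_(j < J) gsch b1 b2 m dt (grid_height R psi c m) q j = v q J - v q 0%N.
  rewrite mulr_sumr (eq_bigr (fun j : 'I_J => v q j.+1 - v q j)); last first.
    by move=> j _; rewrite /gsch mulrA mulVf ?gt_eqF // mul1r.
  by rewrite -(big_mkord predT (fun j => v q j.+1 - v q j)) telescope_sumr.
have s0 : J%:R / m%:R - X%:R / N%:R <= 0 :> R.
  rewrite subr_le0 ler_pdivrMr // mulrAC ler_pdivlMr // -!natrM ler_nat.
  exact: leq_trunc_div.
have s1 : X%:R / N%:R - J%:R / m%:R <= m%:R^-1 :> R.
  rewrite lerBlDl -[X in _ + X]mul1r -mulrDl natr1 ler_pdivlMr // mulrAC ler_pdivrMr //.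
  by rewrite -!natrM ler_nat ltnW // -ltn_divLR.
have p0 := pen_0 al.
have := lo J X; have := up J X; have := lo 0%N 0%N; have := up 0%N 0%N.
rewrite !mul0r !subrr p0 !addr0 tel mulrBl -/(u q X) -/(u q 0%N) -/v => h1 h2 h3 h4.
have pa : pen al (J%:R / m%:R - X%:R / N%:R) <= 0.
  by have /andP[+ _] := pen_incr al_gt0 s0; rewrite p0 sub0r oppr_ge0.
have pb : pen al (X%:R / N%:R - J%:R / m%:R) <= m%:R^-1.
  have s0' : 0 <= X%:R / N%:R - J%:R / m%:R :> R by rewrite -opprB oppr_ge0.
  by have /andP[_] := pen_incr al_gt0 s0'; rewrite p0 !subr0 => /le_trans; apply.
have mi0 : 0 <= m%:R^-1 :> R by rewrite invr_ge0 ltW.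
move: pa pb h1 h2 h3 h4.
move: (pen _ _) (pen _ _) (u q X) (u q 0%N) (v q J) (v q 0%N) => pa pb u1 u0 v1 v0 hpa hpb h1 h2 h3 h4.
by rewrite ler_norml; apply/andP; split; lra.
Qed.

End ParticlesVersusScheme.

End GoodWindows.

Section UnionBound.
Variables (R : realType) (X : Type) (ev : (X -> R) -> R).
Hypothesis evP : is_expect ev.

Lemma ev_sum (I : finType) (f : I -> X -> R) :
  ev (fun x => \sum_i f i x) = \sum_i ev (f i).
Proof.
suff H (s : seq I) : ev (fun x => \sum_(i <- s) f i x) = \sum_(i <- s) ev (f i) by exact: H.
elim: s => [|i s IH].
  by rewrite big_nil -[RHS](ev_cst evP 0); congr ev; apply/funext => x; rewrite big_nil.
rewrite big_cons -IH -(evD evP); congr ev; apply/funext => x; by rewrite big_cons.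
Qed.

Lemma union_bound (I : finType) (P : I -> X -> bool) :
  ev (fun x => ind R [exists i, P i x]) <= \sum_i ev (fun x => ind R (P i x)).
Proof.
rewrite -ev_sum; apply: (ev_le evP) => x; rewrite /ind.
case: existsP => [[i Pi]|_]; last by rewrite sumr_ge0.
by rewrite (bigD1 i) //= Pi lerDl sumr_ge0.
Qed.

End UnionBound.

Section BadWindows.
Variables (R : realType) (b1 b2 : R) (n L : nat) (psi : nat -> bool) (W T a S : nat) (s : R).
Hypotheses (b1_gt0 : 0 < b1) (b1_lt_b2 : b1 < b2) (b2_lt1 : b2 < 1).
Hypotheses (WN : (W <= n.+1)%N) (STL : (S * T <= L)%N) (s01 : 0 <= s <= 1 / 2).

Lemma bad_windows_prob :
  EF b1 b2 (fun c => ind R (bad_windows b1 b2 (n := n) (L := L) psi W T a S c))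
  <= (S * n.+1 * n.+2)%:R * (2 * rect_error b1 b2 W T a s).
Proof.
have b1_01 : 0 <= b1 <= 1 by rewrite !ltW // (lt_trans b1_lt_b2 b2_lt1).
have b2_01 : 0 <= b2 <= 1 by rewrite !ltW // (lt_trans b1_gt0 b1_lt_b2).
have EFP := EF_expect ('I_n.+1 * 'I_L)%type b1_01 b2_01.
apply: (le_trans (union_bound EFP (fun (p : 'I_S * 'I_n.+1 * 'I_n.+2) c =>
  slow_window b1 b2 psi W T a (p.1.1 * T) p.1.2 p.2 c
  || fast_window b1 b2 psi W T a (p.1.1 * T) p.1.2 p.2 c))).
rewrite (_ : (S * n.+1 * n.+2)%:R * _ =
  \sum_(p : 'I_S * 'I_n.+1 * 'I_n.+2) 2 * rect_error b1 b2 W T a s); last first.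
  by rewrite sumr_const !card_prod !card_ord mulr_natl.
apply: ler_sum => -[[q Y] k] _ /=.
have rho01 : 0 <= (k%:R / n.+1%:R : R) <= 1.
  by rewrite divr_ge0 //= ler_pdivrMr ?ltr0n // mul1r ler_nat -ltnS.
have /andP[rho0 _] := rho01.
have sig01 := phi_01 b1_lt_b2 b2_lt1 rho01.
have bal := phi_balance b1_lt_b2 b2_lt1 rho0.
have qT : (q * T + T <= L)%N.
  by apply: leq_trans STL; rewrite addnC -mulSn leq_mul2r (ltn_ord q) orbT.
have lo := window_current_lower b1_gt0 b1_lt_b2 b2_lt1 rho01 sig01 bal psi Y a WN qT s01.
have up := window_current_upper b1_gt0 b1_lt_b2 b2_lt1 rho01 sig01 bal psi Y a WN qT s01.
have -> : 2 * rect_error b1 b2 W T a s = rect_error b1 b2 W T a s + rect_error b1 b2 W T a s.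
  by ring.
apply: le_trans (lerD lo up); rewrite -(evD EFP); apply: (ev_le EFP) => c.
rewrite -/(slow_window b1 b2 psi W T a (q * T) Y k c) -/(fast_window b1 b2 psi W T a (q * T) Y k c).
by rewrite /ind -natrD ler_nat; case: slow_window; case: fast_window.
Qed.

End BadWindows.

(** * Decay of the probability bounds *)

Section Decay.
Variable R : realType.

(** The sixth power beats the fifth power of N in [poly_geometric_small] and leaves a factor 1/N. *)
Lemma exp_le_pow6 (x : R) : 0 < x -> expR (- x) <= (6 / x) ^+ 6.
Proof.
move=> x0; have x6 : 0 < x / 6 by rewrite divr_gt0.
have -> : expR (- x) = (expR (x / 6))^-1 ^+ 6.
  rewrite exprVn -expRM_natl expRN; by congr (expR _)^-1; field.
have -> : 6 / x = (x / 6)^-1 by rewrite invf_div.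
apply: lerXn2r; [by rewrite nnegrE invr_ge0 expR_ge0|by rewrite nnegrE invr_ge0 ltW|].
rewrite lef_pV2 ?posrE ?expR_gt0 //.
by apply: le_trans (expR_ge1Dx _); rewrite lerDr.
Qed.

Lemma poly_geometric_small (C q de e : R) : 0 <= C -> 0 < q -> q < 1 -> 0 < de -> 0 < e ->
  exists N0 : nat, forall N : nat, (N0 <= N)%N ->
    C * N.+1%:R ^+ 5 * q ^+ (Num.truncn (de * N%:R)) <= e.
Proof.
move=> C0 q0 q1 d0 e0.
pose k : R := - ln q.
have k0 : 0 < k by rewrite oppr_gt0 ln_lt0 // q0.
pose B : R := C * (2 ^+ 5) * (6 / (k * (de / 2))) ^+ 6.
have B0 : 0 <= B.
  apply: mulr_ge0; first by rewrite mulr_ge0 // exprn_ge0.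
  by apply: exprn_ge0; rewrite divr_ge0 // mulr_ge0 // ltW // divr_gt0.
exists (maxn 1 (maxn (Num.truncn (2 / de)).+1 (Num.truncn (B / e)).+1)) => N.
rewrite !geq_max => /and3P[N1 N2 N3].
have Nr0 : 0 < N%:R :> R by rewrite ltr0n.
have hN2 : 2 / de <= N%:R.
  by apply: ltW; apply: (lt_le_trans (truncnS_gt _)); rewrite ler_nat.
have hN3 : B / e <= N%:R.
  by apply: ltW; apply: (lt_le_trans (truncnS_gt _)); rewrite ler_nat.
set a := Num.truncn _.
have ha : de / 2 * N%:R <= a%:R.
  have : de * N%:R < a.+1%:R by exact: truncnS_gt.
  rewrite -[a.+1%:R]natr1; rewrite ler_pdivrMr // in hN2.
  by lra.
have qa : q ^+ a <= expR (- (k * (de / 2 * N%:R))).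
  have -> : q ^+ a = expR (- (k * a%:R)).
    by rewrite -{1}(lnK (_ : q \is Num.pos)) ?posrE // -expRM_natl /k; congr expR; ring.
  by rewrite ler_expR lerN2 ler_pM2l.
have p0 : 0 < k * (de / 2 * N%:R) by rewrite !mulr_gt0 // invr_gt0.
have qb := le_trans qa (exp_le_pow6 p0).
have n2 : N.+1%:R ^+ 5 <= (2 * N%:R) ^+ 5 :> R.
  apply: lerXn2r; rewrite ?nnegrE ?mulr_ge0 //.
  by rewrite -natrM ler_nat mul2n -addnn -addn1 leq_add2l.
apply: (@le_trans _ _ (C * (2 * N%:R) ^+ 5 * (6 / (k * (de / 2 * N%:R))) ^+ 6)).
  apply: ler_pM => //; last exact: ler_wpM2l.
    by rewrite mulr_ge0 // exprn_ge0.
  by rewrite exprn_ge0 // ltW.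
have -> : C * (2 * N%:R) ^+ 5 * (6 / (k * (de / 2 * N%:R))) ^+ 6 = B / N%:R.
  rewrite /B; field; rewrite !gt_eqF //.
by rewrite ler_pdivrMr // mulrC -ler_pdivrMr.
Qed.

(** From (1 + x)^k (1 - k x) <= 1, proved by induction on k. *)
Lemma geometric_defect (x : R) (L : nat) : 0 <= x -> L%:R * x <= 1 / 2 ->
  (1 + x) ^+ L - 1 <= 2 * (L%:R * x).
Proof.
move=> x0 Lx.
have H k : (1 + x) ^+ k * (1 - k%:R * x) <= 1.
  elim: k => [|k IH]; first by rewrite expr0 mul0r subr0 mulr1.
  apply: le_trans IH; rewrite exprSr -mulrA; apply: ler_wpM2l.
    by rewrite exprn_ge0 // addr_ge0.
  have : 0 <= k.+1%:R * x * x by rewrite !mulr_ge0.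
  by rewrite -[k.+1%:R]natr1; lra.
have p0 : 0 <= (1 + x) ^+ L by rewrite exprn_ge0 // addr_ge0.
have L0 : 0 <= L%:R * x by rewrite mulr_ge0.
have h := H L; set y := (1 + x) ^+ L in p0 h *; set z := L%:R * x in Lx L0 h *.
have y2 : y <= 2 by have := mulr_ge0 p0 (_ : 0 <= 1 / 2 - z); rewrite subr_ge0 => /(_ Lx); lra.
have := mulr_ge0 L0 (_ : 0 <= 2 - y); rewrite subr_ge0 => /(_ y2); lra.
Qed.

End Decay.

Section RectError.
Variables (R : realType) (b1 b2 : R).
Hypotheses (b1_gt0 : 0 < b1) (b1_lt_b2 : b1 < b2) (b2_lt1 : b2 < 1).
Let b2_gt0 : 0 < b2. Proof. exact: lt_trans b1_lt_b2. Qed.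
Let b1_lt1 : b1 < 1. Proof. exact: lt_trans b2_lt1. Qed.

Lemma speed_ratio : exists2 M : nat, (0 < M)%N & 2 * Lsp b2 <= Zsp b2 ^+ M.
Proof.
have z1 := Zsp_gt1 b2_gt0 b2_lt1.
have d0 : 0 < Zsp b2 - 1 by rewrite subr_gt0.
pose M := (Num.truncn (2 * Lsp b2 / (Zsp b2 - 1))).+1; exists M => //.
have B k : 1 + k%:R * (Zsp b2 - 1) <= Zsp b2 ^+ k.
  elim: k => [|k IH]; first by rewrite mul0r addr0 expr0.
  rewrite exprSr; have z0 := ltW (lt_trans ltr01 z1).
  have h := ler_wpM2r z0 IH.
  have : 0 <= k%:R * (Zsp b2 - 1) * (Zsp b2 - 1) by rewrite !mulr_ge0 // ltW.
  by rewrite -[k.+1%:R]natr1; lra.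
have h := B M.
have : 2 * Lsp b2 / (Zsp b2 - 1) <= M%:R by apply: ltW; exact: truncnS_gt.
by rewrite ler_pdivrMr //; lra.
Qed.

(* The scales T = P a, W = M T and s = 1 / (4 M P) make the exponents in
   [rect_error] proportional to [- a]. *)
Lemma rect_error_decay (M P : nat) : (0 < M)%N -> (0 < P)%N -> 2 * Lsp b2 <= Zsp b2 ^+ M ->
  exists s C q : R, [/\ 0 <= s <= 1 / 2, 0 <= C, 0 < q, q < 1 &
    forall a : nat, rect_error b1 b2 (M * (P * a)) (P * a) a s <= C * a.+1%:R * q ^+ a].
Proof.
move=> M0 P0 HM.
have Mr : 1 <= M%:R :> R by rewrite ler1n.
have Pr : 1 <= P%:R :> R by rewrite ler1n.
pose mp : R := M%:R * P%:R.
have MP : 1 <= mp by rewrite mulr_ege1.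
pose s : R := (4 * mp)^-1.
have s0 : 0 < s by rewrite invr_gt0; lra.
have sE : 4 * mp * s = 1 by rewrite /s mulfV //; apply/eqP; lra.
have s2 : s <= 1 / 2 by have := ler_wpM2l (ltW s0) MP; lra.
have Lb := Lbase_gt1 b1_gt0 b1_lt1 b2_gt0 b2_lt1.
have Lb0 := lt_trans ltr01 Lb.
pose q : R := Num.max (Num.max (expR (- (s / 2))) (1 / 2)) (Lbase b1 b2)^-1.
have q_e : expR (- (s / 2)) <= q by rewrite !le_max lexx.
have q_h : 1 / 2 <= q by rewrite !le_max lexx orbT.
have q_L : (Lbase b1 b2)^-1 <= q by rewrite !le_max lexx !orbT.
have q0 : 0 < q by lra.
have q1 : q < 1.
  rewrite !gt_max invf_lt1 // Lb andbT; apply/andP; split; last by lra.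
  by rewrite expR_lt1; lra.
pose C : R := (mp + 1) + 1 + P%:R + (1 + (Lbase b1 b2 - 1) * mp).
have C4 : 0 <= (Lbase b1 b2 - 1) * mp by rewrite mulr_ge0; lra.
exists s, C, q; split => //; [by rewrite (ltW s0)|by rewrite /C; lra|].
move=> a; have a0 : 0 <= a%:R :> R by [].
have qa0 : 0 <= q ^+ a by rewrite exprn_ge0 // ltW.
have WE : (M * (P * a))%:R = mp * a%:R :> R by rewrite !natrM mulrA.
have e1 (x : R) : x <= mp * a%:R -> expR (2 * s ^+ 2 * x - s * a%:R) <= q ^+ a.
  move=> hx; apply: (@le_trans _ _ (expR (- (s / 2)) ^+ a)); last first.
    by apply: lerXn2r; rewrite ?nnegrE ?expR_ge0 // ltW.
  rewrite -expRM_natl ler_expR.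
  have s20 : 0 <= 2 * s ^+ 2 by rewrite mulr_ge0 // exprn_ge0 // ltW.
  have := ler_wpM2l s20 hx.
  have -> : 2 * s ^+ 2 * (mp * a%:R) = (4 * mp * s) * (s / 2 * a%:R) by field.
  by rewrite sE mul1r; lra.
have t3 : Lsp b2 ^+ (P * a) / Zsp b2 ^+ (M * (P * a)) <= q ^+ a.
  rewrite [Zsp b2 ^+ _]exprM -expr_div_n exprM.
  have Z0 : 0 < Zsp b2 ^+ M by rewrite exprn_gt0 // (lt_trans ltr01 (Zsp_gt1 b2_gt0 b2_lt1)).
  have L0 : 0 <= Lsp b2.
    have := Csp_ge1 b2_gt0 b2_lt1; have := Zsp_gt1 b2_gt0 b2_lt1 => ? ?.
    by rewrite /Lsp addr_ge0 // mulr_ge0; lra.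
  have r0 : 0 <= Lsp b2 / Zsp b2 ^+ M by rewrite divr_ge0 // ltW.
  have rh : Lsp b2 / Zsp b2 ^+ M <= 1 / 2 by rewrite ler_pdivrMr //; lra.
  apply: lerXn2r; rewrite ?nnegrE ?exprn_ge0 ?(ltW q0) //.
  apply: (le_trans _ q_h); apply: (le_trans _ rh).
  rewrite -(prednK P0) exprS ler_piMr //; apply: exprn_ile1 => //; apply: (le_trans rh); lra.
have t4 : (Lbase b1 b2 ^+ a)^-1 <= q ^+ a.
  by rewrite -exprVn; apply: lerXn2r; rewrite ?nnegrE ?invr_ge0 ?(ltW q0) ?(ltW Lb0).
rewrite /rect_error WE.
have t1 : (M * (P * a)).+1%:R * expR (2 * s ^+ 2 * (mp * a%:R) - s * a%:R) <= (mp + 1) * a.+1%:R * q ^+ a.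
  apply: ler_pM => //; rewrite ?expR_ge0 ?e1 //.
  by rewrite -natr1 WE -[a.+1%:R]natr1; nra.
have t2 : expR (2 * s ^+ 2 * (P * a)%:R - s * a%:R) <= 1 * a.+1%:R * q ^+ a.
  apply: (@le_trans _ _ (q ^+ a)).
    by apply: e1; rewrite natrM ler_wpM2r // /mp ler_peMl //; lra.
  by rewrite mul1r ler_peMl // ler1n.
have t3' : (P * a)%:R * Lsp b2 ^+ (P * a) / Zsp b2 ^+ (M * (P * a)) <= P%:R * a.+1%:R * q ^+ a.
  rewrite -mulrA; apply: ler_pM => //; last by rewrite -natrM ler_nat leq_mul.
  rewrite divr_ge0 // exprn_ge0 //.
    have := Csp_ge1 b2_gt0 b2_lt1; have := Zsp_gt1 b2_gt0 b2_lt1 => ? ?.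
    by rewrite /Lsp addr_ge0 // mulr_ge0; lra.
  by rewrite ltW // (lt_trans ltr01 (Zsp_gt1 b2_gt0 b2_lt1)).
have t4' : (1 + (Lbase b1 b2 - 1) * (mp * a%:R)) / Lbase b1 b2 ^+ a <=
    (1 + (Lbase b1 b2 - 1) * mp) * a.+1%:R * q ^+ a.
  apply: ler_pM => //.
  - by rewrite addr_ge0 // mulr_ge0 ?mulr_ge0 //; lra.
  - by rewrite invr_ge0 exprn_ge0 // ltW.
  - by rewrite -[a.+1%:R]natr1; lra.
by have := lerD (lerD (lerD t1 t2) t3') t4'; rewrite /C -!mulrDl.
Qed.

End RectError.

(** * Initial data on the coarse grid *)

Section InitialAverage.
Variables (R : realType) (n L : nat) (psi : nat -> bool) (c : {ffun 'I_n.+1 * 'I_L -> coin}).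
Notation N := n.+1.
Notation mu := (@lebesgue_measure R).

Lemma Int_closed (f : R -> R) (p q : R) : bm f -> 0 <= p -> p <= q -> q <= 1 ->
  \int[mu]_(x in `[p, q]) f x = Int01 (fun x => (step q x - step p x) * f x).
Proof.
move=> bf p0 pq q1; rewrite -Int_step_mul // -Rintegral_itv_bndo_bndc //.
apply: (@integrableS _ _ _ mu (`[0, 1[%classic : set R)) => //; last exact: bm_int.
move=> x /=; rewrite !in_itv /= => /andP[px xq].
by rewrite (le_trans p0 px) (lt_le_trans xq q1).
Qed.

Lemma initial_average (m : nat) (Psi : R -> R) (db : R) : (0 < m)%N -> bm Psi ->
  (forall x1 x2 : R, 0 <= x1 -> x1 <= x2 -> x2 <= 1 ->
      `|(N%:R)^-1 * (\sum_(Num.truncn (x1 * N%:R) <= j < (Num.truncn (x2 * N%:R)).+1)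
                        ((psi (j %% N)%N : nat)%:R : R))
         - \int[mu]_(x in `[x1, x2]) Psi x| <= db) ->
  forall j, (j < m)%N ->
  `|m%:R * (grid_height R psi c m j.+1 - grid_height R psi c m j)
    - m%:R * Int01 (fun x => chi m j x * Psi x)| <= m%:R * (2 / N%:R + db).
Proof.
move=> m0 bP HP j jm.
have mr0 : 0 < m%:R :> R by rewrite ltr0n.
have Nr0 : 0 < N%:R :> R by rewrite ltr0n.
have g01 k : (k <= m)%N -> 0 <= (k%:R / m%:R : R) <= 1.
  by move=> km; rewrite divr_ge0 //= ler_pdivrMr // mul1r ler_nat.
have /andP[p0 _] := g01 j (ltnW jm); have /andP[_ q1] := g01 j.+1 jm.
have pq : j%:R / m%:R <= j.+1%:R / m%:R :> R by rewrite ler_pM2r ?invr_gt0 // ler_nat.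
have IE : \int[mu]_(x in `[j%:R / m%:R, j.+1%:R / m%:R]) Psi x =
  Int01 (fun x => chi m j x * Psi x) := Int_closed bP p0 pq q1.
have := HP _ _ p0 pq q1; rewrite IE.
have tr k : exists2 A, A = Num.truncn (k%:R / m%:R * N%:R : R) & (m * A <= k * N < m * A.+1)%N.
  exists (Num.truncn (k%:R / m%:R * N%:R : R)) => //; set A := Num.truncn _.
  have kN0 : 0 <= (k%:R / m%:R * N%:R : R) by rewrite mulr_ge0 // divr_ge0.
  have /andP[h1 h2] := truncn_itv kN0.
  rewrite -/A mulrAC ler_pdivlMr // -!natrM ler_nat [(A * m)%N]mulnC in h1.
  by rewrite -/A mulrAC ltr_pdivrMr // -!natrM ltr_nat [(A.+1 * m)%N]mulnC in h2; rewrite h1 h2.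
have [A <- /andP[A1 A2]] := tr j; have [B <- /andP[B1 B2]] := tr j.+1.
have AB : (A <= B)%N.
  rewrite -ltnS -(ltn_pmul2l m0); apply: leq_ltn_trans B2; apply: (leq_trans A1).
  by rewrite leq_mul2r leqnSn orbT.
have -> : \sum_(A <= i < B.+1) ((psi (i %% N)%N : nat)%:R : R) =
   height R psi c 0 B.+1 - height R psi c 0 A.
  rewrite /height !big_ord0 !subr0 -!(big_mkord predT (fun i => ((psi (i %% N)%N : nat)%:R : R))).
  by rewrite (@big_cat_nat _ _ _ A 0 B.+1) //= ?(leqW AB) // [RHS]addrAC subrr add0r.
have /andP[f1 f2] := fine_height_incr R psi c m A1.
have /andP[f3 f4] := fine_height_incr R psi c m B1.
rewrite !fine_height_mul // in f1 f2 f3 f4.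
have l1 : (j * N - m * A)%:R <= m%:R :> R by rewrite ler_nat leq_subLR [(_ + m)%N]addnC -mulnS ltnW.
have l2 : (j.+1 * N - m * B)%:R <= m%:R :> R by rewrite ler_nat leq_subLR [(_ + m)%N]addnC -mulnS ltnW.
have {}f2 := le_trans f2 l1; have {}f4 := le_trans f4 l2.
rewrite grid_slopeE // heightS.
have V01 : 0 <= ((Vt c psi 0 B)%:R : R) <= 1 by case: (Vt _ _ _ _); rewrite ?lexx ler01.
move: V01 f1 f2 f3 f4; move: ((Vt c psi 0 B)%:R) => V /andP[V0 V1].
set hA := height _ _ _ _ A; set hB := height _ _ _ _ B.
set fj := fine_height _ _ _ _ (j * N); set fj' := fine_height _ _ _ _ (j.+1 * N).
set I := Rintegral _ _ _ => f1 f2 f3 f4.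
(* Each fine height lies within m of m times the height at the rounded site, and the sum in the
   hypothesis includes its right endpoint, hence [V]. The three corrections have mixed signs and
   total at most 2 m. *)
have -> : (fj' - fj) / N%:R - m%:R * I =
   m%:R * (((fj' - m%:R * hB) - (fj - m%:R * hA) - m%:R * V) / m%:R / N%:R
    + (N%:R^-1 * (hB + V - hA) - I)).
  by field; rewrite nat1r !gt_eqF.
move=> H; rewrite normrM (ger0_norm (ltW mr0)) ler_pM2l //.
apply: (le_trans (ler_normD _ _)); apply: lerD => //.
have -> : 2 / N%:R = 2 * m%:R / m%:R / N%:R :> R by field; rewrite nat1r !gt_eqF.
rewrite !normrM !normfV (gtr0_norm mr0) (gtr0_norm Nr0) !ler_pM2r ?invr_gt0 //.
have mV0 := mulr_ge0 (ltW mr0) V0.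
have mV1 := ler_wpM2l (ltW mr0) V1.
by rewrite ler_norml; apply/andP; split; lra.
Qed.

End InitialAverage.

Section ScaleArithmetic.
Variable R : realType.

(** Every error per step is dt times a small ratio, and S dt is at most lam. For the microscopic
    error this holds because T = P a makes 3 a / N equal to dt times 3 / P. *)
Lemma scale_error (ka dt al m M N P a S lam x : R) :
  0 < al -> 0 < m -> 0 < N -> 0 < P -> 0 <= S * dt -> S * dt <= lam -> 0 <= x ->
  dt = P * a / N ->
  ka / (2 * al * m) <= x -> M ^+ 2 * dt / (2 * al) <= x -> (M + ka) / N <= x -> 3 / P <= x ->
  S * (ka * dt / (2 * al * m) + (M * dt) ^+ 2 / (2 * al) + M * dt / N + ka * dt / N + 3 * a / N)
  <= lam * (4 * x).
Proof.
move=> al0 m0 N0 P0 S0 Sl x0 dtE h1 h2 h3 h4.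
have tE : 3 * a / N = dt * (3 / P) by rewrite dtE; field; rewrite !gt_eqF.
rewrite tE.
have -> : S * (ka * dt / (2 * al * m) + (M * dt) ^+ 2 / (2 * al) + M * dt / N + ka * dt / N
   + dt * (3 / P)) =
   (S * dt) * (ka / (2 * al * m) + M ^+ 2 * dt / (2 * al) + (M + ka) / N + 3 / P).
  by field; rewrite !gt_eqF.
apply: (@le_trans _ _ (S * dt * (4 * x))); first by apply: ler_wpM2l => //; lra.
by apply: ler_wpM2r => //; lra.
Qed.

Lemma final_error (lam x e A0 A1 s0 I1 I2 I3 dt mi Th : R) : 0 <= lam ->
  `|A1 - A0| <= dt -> `|A0 - s0| <= mi + 2 * (x / 2 + Th) -> `|I1 - s0| <= x -> `|I1 - I2| <= mi ->
  `|I2 - I3| <= x -> dt <= x -> mi <= x -> Th <= lam * (4 * x) -> (6 + 8 * lam) * x <= e ->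
  `|A1 - I3| <= e.
Proof.
move=> l0; rewrite !ler_norml => /andP[? ?] /andP[? ?] /andP[? ?] /andP[? ?] /andP[? ?] ? ? ? ?.
by apply/andP; split; lra.
Qed.

Lemma count_error (S N N1 N2 L lam C de a1 qa : R) :
  0 <= C -> 0 <= S -> 0 <= N -> S <= L -> L <= lam * N -> 0 <= lam -> 0 <= qa -> 0 <= de ->
  N1 = N + 1 -> a1 <= de * N + 1 ->
  S * N * N1 * (2 * (C * a1 * qa)) <= 2 * lam * C * (de + 1) * N1 ^+ 5 * qa.
Proof.
move=> C0 S0 N0 SL Ll l0 q0 d0 NE ha.
have h1 : S <= lam * N1 by apply: (le_trans SL); apply: (le_trans Ll); rewrite ler_wpM2l //; lra.
have n1 : 1 <= N1 by lra.
have h2 : a1 <= (de + 1) * N1 by rewrite NE; nra.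
have -> : S * N * N1 * (2 * (C * a1 * qa)) = (2 * C * qa) * (S * (N * N1) * a1) by ring.
have -> : 2 * lam * C * (de + 1) * N1 ^+ 5 * qa = (2 * C * qa) * (lam * (de + 1) * N1 ^+ 5) by ring.
apply: ler_wpM2l; first by rewrite !mulr_ge0.
have S1 : S * (N * N1) <= lam * N1 * (N1 * N1).
  apply: ler_pM => //; first by rewrite mulr_ge0 //; lra.
  by apply: ler_wpM2r; lra.
apply: (@le_trans _ _ (lam * N1 * (N1 * N1) * ((de + 1) * N1))).
  apply: (@le_trans _ _ (S * (N * N1) * ((de + 1) * N1))).
    by apply: ler_wpM2l => //; rewrite !mulr_ge0 //; lra.
  by apply: ler_wpM2r => //; rewrite mulr_ge0 //; lra.
have -> : lam * N1 * (N1 * N1) * ((de + 1) * N1) = lam * (de + 1) * N1 ^+ 4 by ring.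
apply: ler_wpM2l; first by rewrite mulr_ge0 //; lra.
by rewrite [N1 ^+ 5]exprSr ler_peMr // exprn_ge0 //; lra.
Qed.

Lemma half_split (m N e : R) : 0 < N -> 4 * m <= N * e -> 2 * m / N + e / 2 <= e.
Proof.
move=> N0 h; suff : 2 * m / N <= e / 2 by lra.
by rewrite ler_pdivrMr //; lra.
Qed.

End ScaleArithmetic.

Section WeightedIntegrals.
Variable R : realType.

Lemma Int_step_shift (f : R -> R) (p q : R) : bm f -> (forall x, 0 <= x < 1 -> 0 <= f x <= 1) ->
  p <= q -> `|Int01 (fun x => step p x * f x) - Int01 (fun x => step q x * f x)| <= q - p.
Proof.
move=> bf f01 pq; rewrite distrC -IntB; [|by apply: bm_mul => //; exact: bm_step..].
have bs : bm (fun x => step q x * f x - step p x * f x).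
  by apply: bm_sub; apply: bm_mul => //; exact: bm_step.
apply: (le_trans (Int_norm bs)); apply: le_trans (Int_step_diff pq); apply: Int_le.
- exact: bm_norm.
- by apply: bm_sub; exact: bm_step.
move=> x x01; have /andP[f0 f1] := f01 x x01.
have d0 : 0 <= step q x - step p x by rewrite subr_ge0 step_le.
by rewrite -mulrBl normrM (ger0_norm d0) (ger0_norm f0) ler_piMr.
Qed.

Lemma Int_weight_L1 (w f g : R -> R) : bm w -> bm f -> bm g ->
  (forall x, 0 <= x < 1 -> 0 <= w x <= 1) ->
  `|Int01 (fun x => w x * f x) - Int01 (fun x => w x * g x)| <= Int01 (fun x => `|f x - g x|).
Proof.
move=> bw bf bg w01; rewrite -IntB; [|exact: bm_mul..].
have bs : bm (fun x => w x * f x - w x * g x) by apply: bm_sub; exact: bm_mul.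
apply: (le_trans (Int_norm bs)); apply: Int_le.
- exact: bm_norm.
- by apply: bm_norm; exact: bm_sub.
move=> x x01; have /andP[w0 w1] := w01 x x01.
by rewrite -mulrBr normrM (ger0_norm w0) ler_piMl.
Qed.

End WeightedIntegrals.

(** * Uniform convergence of the heights *)

Section HeightConvergence.
Variables (R : realType) (b1 b2 lam : R) (Psi : R -> R) (G : R -> R -> R) (psi : nat -> nat -> bool).
Hypotheses (b1_gt0 : 0 < b1) (b1_lt_b2 : b1 < b2) (b2_lt1 : b2 < 1) (lam_gt0 : 0 < lam).
Hypothesis ent : entropy_solution b1 b2 lam Psi G.
Hypothesis bconv : boundary_converges Psi psi.

Definition height_dev (n L : nat) (c : {ffun 'I_n.+1 * 'I_L -> coin}) (y X : nat) : R :=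
  n.+1%:R^-1 * (\sum_(i < X) (Vt c (psi n.+1) y i)%:R)
  - Int01 (fun x => step (X%:R / n.+1%:R) x * G x (y%:R / n.+1%:R)).

Definition good_heights (n L : nat) (e : R) (c : {ffun 'I_n.+1 * 'I_L -> coin}) : bool :=
  [forall y : 'I_L.+1, forall X : 'I_n.+2, `|height_dev c y X| <= e].

(** The deterministic half: all randomness is confined to the event that no window is bad. *)
Lemma heights_of_windows (x e d1 d0 db e3 : R) (m M P a n : nat) :
  let N := n.+1 in let L := Num.truncn (lam * N%:R) in let T := (P * a)%N in
  let dt : R := T%:R / N%:R in
  0 < x -> (0 < m)%N -> (0 < P)%N -> (0 < a)%N -> (M * T <= N)%N ->
  (6 + 8 * lam) * x <= e ->
  (forall y y', 0 <= y <= lam -> 0 <= y' <= lam -> `|y - y'| < d1 -> dL1 G y y' <= x) ->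
  (forall dt g, 0 <= dt -> dt < d0 -> kappa b1 b2 * dt * m%:R <= 1 ->
    (forall n j, 0 <= g n j <= 1) -> (forall n j, g n (j + m)%N = g n j) ->
    (forall n j, g n.+1 j =
      g n j - dt * m%:R * (phi b1 b2 (g n j) - phi b1 b2 (g n (j + m).-1))) ->
    (forall j, (j < m)%N -> `|g 0%N j - m%:R * Int01 (fun x => chi m j x * Psi x)| <= e3) ->
    forall n J, n%:R * dt <= lam -> (J <= m)%N ->
    `|Int01 (fun x => step (J%:R / m%:R) x * G x (n%:R * dt)) - m%:R^-1 * \sum_(j < J) g n j| <= x) ->
  (forall x1 x2 : R, 0 <= x1 -> x1 <= x2 -> x2 <= 1 ->
      `|(N%:R)^-1 * (\sum_(Num.truncn (x1 * N%:R) <= j < (Num.truncn (x2 * N%:R)).+1)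
                        ((psi N (j %% N)%N : nat)%:R : R))
         - \int[@lebesgue_measure R]_(x in `[x1, x2]) Psi x| <= db) ->
  m%:R * (2 / N%:R + db) <= e3 ->
  kappa b1 b2 * dt * m%:R <= 1 -> dt < d0 -> dt < d1 -> dt <= x -> m%:R^-1 <= x ->
  kappa b1 b2 / (2 * x * m%:R) <= x -> M%:R ^+ 2 * dt / (2 * x) <= x ->
  (M%:R + kappa b1 b2) / N%:R <= x -> 3 / P%:R <= x ->
  forall c : {ffun 'I_N * 'I_L -> coin},
    ~~ bad_windows b1 b2 (psi N) (M * T) T a (L %/ T) c -> good_heights e c.
Proof.
move=> N L T dt x0 m0 P0 a0 MTN xe dl1 schm bnd init cfl dtd0 dtd1 dtx mx k1 k2 k3 k4 c good.
have l0 := lam_gt0.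
have Nr0 : 0 < N%:R :> R by rewrite ltr0n.
have mr0 : 0 < m%:R :> R by rewrite ltr0n.
have T0 : (0 < T)%N by rewrite muln_gt0 P0.
have dt0 : 0 <= dt by rewrite divr_ge0.
have LN : L%:R <= lam * N%:R by rewrite truncn_le mulr_ge0 // ltW.
set S := (L %/ T)%N in good.
have [bP _] := bm_Psi lam_gt0 ent.
pose v0 := grid_height R (psi N) c m.
have slope := grid_slope R (psi N) c m0; have per := grid_per R (psi N) c m0.
have g01 := gsch_01 b1_lt_b2 b2_lt1 m0 dt0 cfl slope per.
have gp := gsch_per b1 b2 dt m0 per.
have gS := gschS b1 b2 dt m0 per.
have g0 j : (j < m)%N -> `|gsch b1 b2 m dt v0 0 j - m%:R * Int01 (fun x => chi m j x * Psi x)| <= e3.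
  by move=> jm; apply: le_trans init; exact: initial_average.
have SC := schm dt (gsch b1 b2 m dt v0) dt0 dtd0 cfl g01 gp gS g0.
have tm (y : nat) : (y <= L)%N -> 0 <= (y%:R / N%:R : R) <= lam.
  move=> yL; rewrite divr_ge0 //= ler_pdivrMr //; apply: le_trans LN; by rewrite ler_nat.
apply/forallP => -[y yL]; apply/forallP => -[X XN] /=.
rewrite ltnS in yL; rewrite ltnS in XN.
set q := (y %/ T)%N.
have qS : (q <= S)%N by exact: leq_div2r.
have qTy : (q * T <= y)%N by exact: leq_trunc_div.
have yE : y = (q * T + y %% T)%N by exact: divn_eq.
have yT : (y %% T < T)%N by rewrite ltn_mod.
have qdt : q%:R * dt = (q * T)%:R / N%:R by rewrite natrM mulrA.
have hq := tm (q * T)%N (leq_trans qTy yL); have hy := tm y yL.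
have ql : q%:R * dt <= lam by rewrite qdt; have /andP[] := hq.
have PS := particles_scheme b1_lt_b2 b2_lt1 m0 cfl x0 MTN good X qS.
set J := (X * m %/ N)%N in PS.
have Jm : (J <= m)%N.
  rewrite /J -[X in (_ <= X)%N](mulKn m (ltn0Sn n)); apply: leq_div2r.
  by rewrite leq_mul2r XN orbT.
have SJ := SC q J ql Jm.
have J1 : J%:R / m%:R <= X%:R / N%:R :> R.
  rewrite ler_pdivrMr // mulrAC ler_pdivlMr // -!natrM ler_nat; exact: leq_trunc_div.
have J2 : X%:R / N%:R - J%:R / m%:R <= m%:R^-1 :> R.
  rewrite lerBlDl -[X in _ + X]mul1r -mulrDl natr1 ler_pdivlMr // mulrAC ler_pdivrMr //.
  by rewrite -!natrM ler_nat ltnW // -ltn_divLR.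
have bG := bm_sol ent hq.
have SH := Int_step_shift bG (fun z hz => sol_01 ent hz hq) J1.
rewrite -qdt in SH; have {}SH := le_trans SH J2.
have L1 := Int_weight_L1 (bm_step (X%:R / N%:R)) bG (bm_sol ent hy) (fun z _ => step_01 _ z).
have D1 : dL1 G ((q * T)%:R / N%:R) (y%:R / N%:R) <= x.
  apply: dl1 => //; apply: le_lt_trans dtd1.
  rewrite -mulrBl normrM normfV (ger0_norm (ltW Nr0)) /dt ler_pM2r ?invr_gt0 //.
  rewrite distrC -natrB // normr_nat ler_nat {1}yE addKn; exact: ltnW.
have {}L1 := le_trans L1 D1; rewrite -qdt in L1.
have HG := height_gap R (psi N) c (q * T) (y %% T) X; rewrite -yE in HG.
have VE t : n.+1%:R^-1 * (\sum_(i < X) (Vt c (psi n.+1) t i)%:R) =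
    (height R (psi N) c t X - height R (psi N) c t 0) / N%:R.
  by rewrite (height_sum R (psi N) c t X) addrC addKr mulrC.
rewrite /height_dev VE.
have GA : `|(height R (psi N) c y X - height R (psi N) c y 0) / N%:R -
    (height R (psi N) c (q * T) X - height R (psi N) c (q * T) 0) / N%:R| <= dt.
  rewrite -mulrBl normrM normfV (ger0_norm (ltW Nr0)) /dt ler_pM2r ?invr_gt0 //.
  by apply: (le_trans HG); rewrite ler_nat ltnW.
(* The chain: heights at y and at the last multiple of T, the scheme at node J, the integral of G up
   to J/m, then up to X/N, and finally at time y/N. With penalty scale x this sums to (6 + 8 lam)
   x. *)
apply: (final_error (ltW lam_gt0) GA PS SJ SH L1 dtx mx _ xe).
rewrite /doubling_error natrM -[M%:R * T%:R / N%:R]mulrA -/dt.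
have Sdt : S%:R * dt = (S * T)%:R / N%:R by rewrite natrM mulrA.
apply: (@scale_error R _ _ _ _ _ _ P%:R) => //.
- by rewrite ltr0n.
- by rewrite mulr_ge0.
- rewrite Sdt ler_pdivrMr //; apply: le_trans LN; rewrite ler_nat; exact: leq_trunc_div.
- exact: ltW.
- by rewrite /dt natrM.
Qed.

Lemma heights_converge (e : R) : 0 < e -> exists N0 : nat, forall n, (N0 <= n.+1)%N ->
  EF b1 b2 (fun c : {ffun 'I_n.+1 * 'I_(Num.truncn (lam * n.+1%:R)) -> coin} =>
    ind R (~~ good_heights e c)) <= e.
Proof.
move=> e0; have l0 := lam_gt0.
have half (z : R) : 0 < z -> z / 2 < z by lra.
have b1_01 : 0 <= b1 <= 1 by rewrite !ltW // (lt_trans b1_lt_b2 b2_lt1).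
have b2_01 : 0 <= b2 <= 1 by rewrite !ltW // (lt_trans b1_gt0 b1_lt_b2).
have k0 : 0 < kappa b1 b2 by apply: lt_trans ltr01 (kappa_gt1 b1_lt_b2 b2_lt1).
pose x : R := e / (6 + 8 * lam).
have d86 : 0 < 6 + 8 * lam by lra.
have x0 : 0 < x by rewrite divr_gt0.
have xe : (6 + 8 * lam) * x <= e by rewrite /x mulrC divfK // gt_eqF.
(* P is the ratio of the window height T to the tolerance a, so that the error 3 a is a small
   fraction of T. *)
have [P' HP'] := nat_above (3 / x); pose P := P'.+1.
have Pr0 : 0 < P%:R :> R by rewrite ltr0n.
have P3 : 3 / P%:R <= x.
  rewrite ler_pdivrMr // mulrC -ler_pdivrMr //; apply: (le_trans HP'); by rewrite ler_nat.
have [e3 e30 [M0 HM0]] := scheme_converges b1_lt_b2 b2_lt1 lam_gt0 ent x0.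
have [m' Hm'] := nat_above (Num.max (1 / x) (kappa b1 b2 / (2 * x ^+ 2))).
pose m := (maxn M0 m').+1.
have mr0 : 0 < m%:R :> R by rewrite ltr0n.
have : Num.max (1 / x) (kappa b1 b2 / (2 * x ^+ 2)) <= m%:R.
  by apply: (le_trans Hm'); rewrite ler_nat /m leqW // leq_maxr.
rewrite ge_max => /andP[]; rewrite ler_pdivrMr // ler_pdivrMr; last by rewrite mulr_gt0 // exprn_gt0.
move=> m1 m2.
have mx : m%:R^-1 <= x by rewrite -[X in X <= _]mul1r ler_pdivrMr // mulrC.
have kmx : kappa b1 b2 / (2 * x * m%:R) <= x.
  rewrite ler_pdivrMr; last by rewrite mulr_gt0 // mulr_gt0.
  by apply: (le_trans m2); rewrite le_eqVlt; apply/orP; left; apply/eqP; ring.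
have [|d0 d00 Hd0] := HM0 m _ (ltn0Sn _); first by rewrite /m leqW // leq_maxl.
have [d1 d10 Hd1] := dL1_unif ent x0.
have [M M_gt0 HM] := speed_ratio b1_gt0 b1_lt_b2 b2_lt1.
have Mr0 : 0 < M%:R :> R by rewrite ltr0n.
(* An upper bound for dt. Its entries serve, in order: convergence of the scheme, the time modulus
   of G, the slip between window times, the CFL condition, the second-order shift error, and windows
   no wider than the ring. *)
pose D : R := Num.min (Num.min (d0 / 2) (d1 / 2)) (Num.min (Num.min x (kappa b1 b2 * m%:R)^-1)
   (Num.min (2 * x ^+ 2 / M%:R ^+ 2) M%:R^-1)).
have D0 : 0 < D.
  have km0 : 0 < (kappa b1 b2 * m%:R)^-1 by rewrite invr_gt0 mulr_gt0.
  have xM0 : 0 < 2 * x ^+ 2 / M%:R ^+ 2 by rewrite divr_gt0 ?exprn_gt0 // mulr_gt0 // exprn_gt0.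
  by rewrite !lt_min x0 km0 xM0 invr_gt0 Mr0 !divr_gt0.
have [Da [Db [Dc [Dd [De Df]]]]] : D <= d0 / 2 /\ D <= d1 / 2 /\ D <= x /\
    D <= (kappa b1 b2 * m%:R)^-1 /\ D <= 2 * x ^+ 2 / M%:R ^+ 2 /\ D <= M%:R^-1.
  by rewrite /D !ge_min !lexx !orbT.
pose de : R := D / P%:R.
have de0 : 0 < de by rewrite divr_gt0.
have [s [C [q [s01 C0 q0 q1 RE]]]] := rect_error_decay b1_gt0 b1_lt_b2 b2_lt1 M_gt0 (ltn0Sn P') HM.
have C'0 : 0 <= 2 * lam * C * (de + 1) by rewrite !mulr_ge0 // ?addr_ge0 // ltW.
have [N1 HN1] := poly_geometric_small C'0 q0 q1 de0 e0.
pose db : R := e3 / (2 * m%:R).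
have db0 : 0 < db by rewrite divr_gt0 // mulr_gt0.
have [N2 HN2] := bconv db0.
have [N3 HN3] := nat_above (Num.max (de^-1) (Num.max (4 * m%:R / e3) ((M%:R + kappa b1 b2) / x))).
exists (maxn N1 (maxn N2 N3)) => n; rewrite !geq_max => /and3P[hN1 hN2 hN3].
set N := n.+1 in hN1 hN2 hN3 *.
have Nr0 : 0 < N%:R :> R by rewrite ltr0n.
have : Num.max (de^-1) (Num.max (4 * m%:R / e3) ((M%:R + kappa b1 b2) / x)) <= N%:R.
  by apply: (le_trans HN3); rewrite ler_nat.
rewrite !ge_max !ler_pdivrMr // => /and3P[hN4 hN5 hN6].
set L := Num.truncn (lam * N%:R).
(* The tolerance a is proportional to N, which makes all window errors exponentially small in N,
   while dt = P a / N stays below D. *)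
pose a := Num.truncn (de * N%:R); pose T := (P * a)%N; pose dt : R := T%:R / N%:R.
have a_le : a%:R <= de * N%:R by rewrite truncn_le mulr_ge0 // ltW.
have a0 : (0 < a)%N.
  by rewrite truncn_gt0; have := ler_wpM2l (ltW de0) hN4; rewrite mulfV ?gt_eqF.
have dtD : dt <= D.
  rewrite /dt /T natrM ler_pdivrMr //.
  have -> : D * N%:R = P%:R * (de * N%:R) by rewrite /de; field; rewrite gt_eqF.
  by rewrite ler_pM2l.
have dt0 : 0 <= dt by rewrite divr_ge0.
have MTN : (M * T <= N)%N.
  rewrite -(@ler_nat R) natrM -[T%:R](divfK (lt0r_neq0 Nr0)) -/dt mulrA.
  rewrite ler_piMl // ?(ltW Nr0) //.
  have := ler_wpM2l (ltW Mr0) (le_trans dtD Df); by rewrite mulfV // gt_eqF.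
have T0 : (0 < T)%N by rewrite muln_gt0 a0.
have imp (c : {ffun 'I_N * 'I_L -> coin}) :
    ~~ bad_windows b1 b2 (psi N) (M * T) T a (L %/ T) c -> good_heights e c.
  apply: (@heights_of_windows x e d1 d0 db e3 m M P a n) => //; rewrite -/N -/T -/dt.
  - exact: HN2.
  - have -> : m%:R * (2 / N%:R + db) = 2 * m%:R / N%:R + e3 / 2.
      by rewrite /db; field; rewrite !gt_eqF // nat1r.
    exact: half_split.
  - have km0 : 0 < kappa b1 b2 * m%:R by rewrite mulr_gt0.
    have := ler_wpM2l (ltW km0) (le_trans dtD Dd); rewrite mulfV ?gt_eqF //.
    by rewrite mulrAC.
  - exact: le_lt_trans dtD (le_lt_trans Da (half _ d00)).
  - exact: le_lt_trans dtD (le_lt_trans Db (half _ d10)).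
  - exact: le_trans Dc.
  - rewrite ler_pdivrMr; last by rewrite mulr_gt0.
    have M20 : 0 < M%:R ^+ 2 :> R by rewrite exprn_gt0.
    have := ler_wpM2l (ltW M20) (le_trans dtD De).
    suff -> : M%:R ^+ 2 * (2 * x ^+ 2 / M%:R ^+ 2) = x * (2 * x) by [].
    by field; rewrite gt_eqF.
  - by rewrite ler_pdivrMr // mulrC.
have EFP := EF_expect ('I_N * 'I_L)%type b1_01 b2_01.
have STL : (L %/ T * T <= L)%N by exact: leq_trunc_div.
have BW := bad_windows_prob (psi N) a b1_gt0 b1_lt_b2 b2_lt1 MTN STL s01.
apply: (@le_trans _ _ (EF b1 b2 (fun c : {ffun 'I_N * 'I_L -> coin} =>
   ind R (bad_windows b1 b2 (psi N) (M * T) T a (L %/ T) c)))).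
  apply: (ev_le EFP) => c; rewrite /ind ler_nat; have := imp c.
  by case: (bad_windows _ _ _ _ _ _ _ _) => //=; [case: good_heights|move=> -> ].
apply: (le_trans BW); apply: le_trans (HN1 N hN1).
have re : 2 * rect_error b1 b2 (M * T) T a s <= 2 * (C * a.+1%:R * q ^+ a).
  by rewrite ler_pM2l //; exact: RE.
have cnt0 : 0 <= ((L %/ T) * N * N.+1)%:R :> R by [].
apply: (le_trans (ler_wpM2l cnt0 re)); rewrite !natrM.
apply: (@count_error R _ _ _ _ L%:R) => //.
- by rewrite ler_nat leq_div.
- by rewrite truncn_le mulr_ge0 // ltW.
- exact: ltW.
- by rewrite exprn_ge0 // ltW.
- exact: ltW.
- by rewrite -natr1.
- by rewrite -natr1 lerD2r.
Qed.

End HeightConvergence.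

(** * Rectangles *)

Section RiemannSum.
Variable R : realType.
Notation mu := (@lebesgue_measure R).

Lemma Int_seg_cst (f : R -> R) (a b e : R) : continuous f -> a <= b ->
  (forall t, a <= t <= b -> `|f t - f a| <= e) ->
  `|(b - a) * f a - \int[mu]_(t in `[a, b]) f t| <= (b - a) * e.
Proof.
move=> cf ab fe.
have cc k : continuous (fun _ : R => k : R) by move=> x; exact: cvg_cst.
have mass k : \int[mu]_(t in `[a, b]) k = (b - a) * k.
  rewrite Rintegral_cst //= lebesgue_measure_itv /= lte_fin mulrC; congr (_ * _).
  case: ltP => // ba; have -> : b = a by apply/eqP; rewrite eq_le ab ba.
  by rewrite subrr.
rewrite -(mass (f a)) -(mass e) distrC -RintegralB //; [|exact: continuous_integrable_seg..].
have cd : continuous (fun t => f t - f a) by move=> t; apply: cvgB; [exact: cf|exact: cvg_cst].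
apply: le_trans (le_normr_Rintegral _ _) _ => //; first exact: continuous_integrable_seg.
have cn : continuous (fun t => `|f t - f a|) by move=> t; apply: cvg_norm; exact: cd.
by apply: le_Rintegral => //; [exact: continuous_integrable_seg cn|exact: continuous_integrable_seg].
Qed.

Lemma riemann_sum (f : R -> R) (N Y d : nat) (e : R) : continuous f -> (0 < N)%N ->
  (forall i t, (Y <= i < Y + d)%N -> i%:R / N%:R <= t <= i.+1%:R / N%:R ->
     `|f t - f (i%:R / N%:R)| <= e) ->
  `|N%:R^-1 * \sum_(Y <= i < Y + d) f (i%:R / N%:R)
    - \int[mu]_(t in `[Y%:R / N%:R, (Y + d)%:R / N%:R]) f t| <= d%:R / N%:R * e.
Proof.
move=> cf N0; have Nr0 : 0 < N%:R :> R by rewrite ltr0n.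
have grid (k l : nat) : (k <= l)%N -> k%:R / N%:R <= l%:R / N%:R :> R.
  by move=> kl; rewrite ler_pM2r ?invr_gt0 // ler_nat.
elim: d => [|d IH] fe.
  by rewrite addn0 big_geq // mulr0 set_itv1 Rintegral_set1 subrr normr0 !mul0r.
set A := Y%:R / N%:R; pose B : R := (Y + d)%:R / N%:R; set C := (Y + d.+1)%:R / N%:R.
have AB : A <= B by apply: grid; rewrite leq_addr.
have BC : B <= C by apply: grid; rewrite leq_add2l.
have CB : C - B = N%:R^-1 by rewrite /C /B addnS -[(Y + d).+1%:R]natr1; ring.
have split : \int[mu]_(t in `[A, C]) f t =
    \int[mu]_(t in `[A, B]) f t + \int[mu]_(t in `[B, C]) f t.
  have h := @Rintegral_itvB R f (BLeft A) (BRight C) B (continuous_integrable_seg _ _ cf).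
  rewrite -(Rintegral_itv_obnd_cbnd (r := B)); last first.
    apply: (integrableS _ _ _ (continuous_integrable_seg B C cf)) => //.
    by move=> t /=; rewrite !in_itv /= => /andP[/ltW -> ->].
  by rewrite -h ?bnd_simp // [RHS]addrC subrK.
have S1 : `|N%:R^-1 * \sum_(Y <= i < Y + d) f (i%:R / N%:R) - \int[mu]_(t in `[A, B]) f t| <= d%:R / N%:R * e.
  by apply: IH => i t /andP[h1 h2]; apply: fe; rewrite h1 (leq_trans h2) // leq_add2l.
have S2 : `|N%:R^-1 * f B - \int[mu]_(t in `[B, C]) f t| <= N%:R^-1 * e.
  rewrite -CB; apply: Int_seg_cst => // t tBC; apply: fe; first by rewrite leq_addr ltn_add2l /=.
  by rewrite -addnS.
rewrite split addnS big_nat_recr ?leq_addr //= -/B mulrDr -[d.+1%:R]natr1.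
have -> : (d%:R + 1) / N%:R * e = d%:R / N%:R * e + N%:R^-1 * e by ring.
by apply: le_trans (lerD S1 S2); rewrite opprD addrACA; exact: ler_normD.
Qed.

Lemma sum_ord_range (V : nmodType) (F : nat -> V) (n Y1 Y2 : nat) : (Y2 < n)%N ->
  \sum_(y : 'I_n | (Y1 <= y <= Y2)%N) F y = \sum_(Y1 <= i < Y2.+1) F i.
Proof.
move=> Yn; rewrite (big_nat_widen _ Y2.+1 n) // big_geq_mkord.
by apply: eq_bigl => i; rewrite /= ltnS andbC.
Qed.

Lemma sum_nat_diff (F : nat -> R) (X1 X2 : nat) : (X1 <= X2)%N ->
  \sum_(X1 <= i < X2) F i = \sum_(i < X2) F i - \sum_(i < X1) F i.
Proof.
move=> X12; rewrite -!(big_mkord predT F) (@big_cat_nat _ _ _ X1 0 X2) //=.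
by rewrite [RHS]addrAC subrr add0r.
Qed.

End RiemannSum.

Section RectangleArithmetic.
Variable R : realType.

Lemma rect_arith (S1 S2 S3 I u v w z : R) : `|S1 - S2| <= u -> `|S2 - S3| <= v -> `|S3 - I| <= w ->
  u + v + w <= z -> `|S1 - I| <= z.
Proof.
rewrite !ler_norml => /andP[? ?] /andP[? ?] /andP[? ?] ?.
by apply/andP; split; lra.
Qed.

Lemma increment_arith (a b A B B' e d : R) : `|a - A| <= e -> `|b - B'| <= e -> `|B - B'| <= d ->
  `|(b - a) - (B - A)| <= 2 * e + d.
Proof.
rewrite !ler_norml => /andP[? ?] /andP[? ?] /andP[? ?].
by apply/andP; split; lra.
Qed.

End RectangleArithmetic.

Section Rectangles.
Variables (R : realType) (b1 b2 lam : R) (Psi : R -> R) (G : R -> R -> R) (psi : nat -> nat -> bool).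
Hypothesis lam_gt0 : 0 < lam.
Hypothesis ent : entropy_solution b1 b2 lam Psi G.
Variable n : nat.
Notation N := n.+1.
Notation mu := (@lebesgue_measure R).
Let L := Num.truncn (lam * N%:R).
Let Nr0 : 0 < N%:R :> R. Proof. by rewrite ltr0n. Qed.

Let strip (X1 X2 : nat) (t : R) : R :=
  Int01 (fun x => (step (X2%:R / N%:R) x - step (X1%:R / N%:R) x) * G x t).

Let grid (k l : nat) : (k <= l)%N -> k%:R / N%:R <= l%:R / N%:R :> R.
Proof. by move=> kl; rewrite ler_pM2r ?invr_gt0 // ler_nat. Qed.

Let strip_01 X1 X2 : (X1 <= X2)%N -> forall x : R,
  0 <= x < 1 -> 0 <= step (X2%:R / N%:R) x - step (X1%:R / N%:R) x <= 1.
Proof.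
move=> X12 x _; rewrite subr_ge0 step_le ?grid //=.
have /andP[? ?] := step_01 (X2%:R / N%:R) x; have /andP[? ?] := step_01 (X1%:R / N%:R) x.
by lra.
Qed.

Let bm_strip X1 X2 : bm (fun x : R => step (X2%:R / N%:R) x - step (X1%:R / N%:R) x).
Proof. by apply: bm_sub; exact: bm_step. Qed.

Let strip_L1 X1 X2 t t' : (X1 <= X2)%N -> 0 <= t <= lam -> 0 <= t' <= lam ->
  `|strip X1 X2 t - strip X1 X2 t'| <= dL1 G t t'.
Proof.
move=> X12 ht ht'; apply: Int_weight_L1; [exact: bm_strip|exact: (bm_sol ent)..|].
exact: strip_01.
Qed.

Let strip_le1 X1 X2 t : (X1 <= X2)%N -> 0 <= t <= lam -> `|strip X1 X2 t| <= 1.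
Proof.
move=> X12 ht.
have bb : bm (fun x => (step (X2%:R / N%:R) x - step (X1%:R / N%:R) x) * G x t).
  by apply: bm_mul; [exact: bm_strip|exact: (bm_sol ent)].
apply: (le_trans (Int_norm bb)).
rewrite -[X in _ <= X](Int_cst (1 : R)).
apply: Int_le; [exact: bm_norm|exact: bm_cst|move=> x x01].
have /andP[s0 s1] := strip_01 X12 x01; have /andP[g0 g1] := sol_01 ent x01 ht.
by rewrite ger0_norm; [exact: mulr_ile1|exact: mulr_ge0].
Qed.

(** The sums include column X2 and row Y2 while the integrals stop at X2/N and Y2/N: this costs 1/N
    in each row and once more in time. The number of rows divided by N is at most lam + 1, and the
    remaining Riemann sum in time is controlled by the L^1 modulus. *)
Lemma rect_dev_le (e0 e1 : R) (c : {ffun 'I_N * 'I_L -> coin}) (X1 X2 Y1 Y2 : nat) : 0 <= e0 ->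
  (forall y y', 0 <= y <= lam -> 0 <= y' <= lam -> `|y - y'| <= N%:R^-1 -> dL1 G y y' <= e1) ->
  good_heights G psi e0 c -> (X1 <= X2)%N -> (X2 < N)%N -> (Y1 <= Y2)%N -> (Y2 <= L)%N ->
  `|rect_dev G (emin (psi N) c) X1 X2 Y1 Y2|
  <= (lam + 1) * (2 * e0 + N%:R^-1) + N%:R^-1 + lam * e1.
Proof.
move=> e00 mod good X12 X2N Y12 Y2L.
have LN : L%:R <= lam * N%:R by rewrite truncn_le mulr_ge0 // ltW.
have tm (y : nat) : (y <= L)%N -> 0 <= (y%:R / N%:R : R) <= lam.
  by move=> yL; rewrite divr_ge0 //= ler_pdivrMr //; apply: le_trans LN; rewrite ler_nat.
have e10 : 0 <= e1.
  apply: le_trans (mod 0 0 _ _ _); rewrite ?lexx ?(ltW lam_gt0) ?subrr ?normr0 ?invr_ge0 ?(ltW Nr0) //.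
  exact: Int_ge0.
pose V y i : R := (Vt c (psi N) y i)%:R.
pose S := \sum_(Y1 <= y < Y2.+1) (N%:R^-1 * \sum_(X1 <= i < X2.+1) V y i).
have SE : (N%:R ^+ 2)^-1 * (\sum_(y : 'I_L.+1 | (Y1 <= y <= Y2)%N)
   \sum_(x : 'I_N | (X1 <= x <= X2)%N) (((emin (psi N) c).1 (x, y) : nat)%:R : R)) = N%:R^-1 * S.
  rewrite /S -mulr_sumr mulrA -expr2 exprVn; congr (_ * _).
  rewrite -(@sum_ord_range _ (fun y => \sum_(X1 <= i < X2.+1) V y i) L.+1) //.
  apply: eq_bigr => y _; rewrite -(@sum_ord_range _ (V y) N) //.
  by apply: eq_bigr => x _; rewrite ffunE.
have X1N1 : (X1 < N.+1)%N by rewrite ltnS ltnW // (leq_ltn_trans X12).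
have X2N1 : (X2.+1 < N.+1)%N by [].
have Hy y : (y <= L)%N -> `|N%:R^-1 * (\sum_(X1 <= i < X2.+1) V y i) - strip X1 X2 (y%:R / N%:R)|
    <= 2 * e0 + N%:R^-1.
  move=> yL; have yL' : (y < L.+1)%N by [].
  move/forallP : good => /(_ (Ordinal yL')) /forallP G1.
  have := G1 (Ordinal X1N1); have := G1 (Ordinal X2N1); rewrite /height_dev /= => h2 h1.
  have ht := tm y yL; have bG := bm_sol ent ht.
  rewrite sum_nat_diff ?leqW // mulrBr /strip.
  have -> : Int01 (fun x => (step (X2%:R / N%:R) x - step (X1%:R / N%:R) x) * G x (y%:R / N%:R)) =
    Int01 (fun x => step (X2%:R / N%:R) x * G x (y%:R / N%:R)) -
    Int01 (fun x => step (X1%:R / N%:R) x * G x (y%:R / N%:R)).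
    rewrite -IntB; [|by apply: bm_mul => //; exact: bm_step..].
    by apply: Int_eq => x _; rewrite mulrBl.
  apply: (increment_arith h1 h2).
  apply: le_trans (Int_step_shift bG (fun z hz => sol_01 ent hz ht) (grid (leqnSn X2))) _.
  by rewrite -[X2.+1%:R]natr1 mulrDl mul1r [_ + N%:R^-1]addrC addrK.
pose S' := \sum_(Y1 <= y < Y2.+1) strip X1 X2 (y%:R / N%:R).
have nb : (Y2.+1 - Y1)%:R / N%:R <= lam + 1.
  rewrite ler_pdivrMr // mulrDl mul1r.
  apply: (@le_trans _ _ (L%:R + 1)); first by rewrite natr1 ler_nat (leq_trans (leq_subr _ _)).
  by apply: lerD => //; rewrite ler1n.
have D1 : `|N%:R^-1 * S - N%:R^-1 * S'| <= (lam + 1) * (2 * e0 + N%:R^-1).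
  rewrite -mulrBr normrM normfV (ger0_norm (ltW Nr0)) /S /S' -sumrB.
  have b0 : 0 <= 2 * e0 + N%:R^-1 by rewrite addr_ge0 ?mulr_ge0 // invr_ge0 ltW.
  apply: le_trans (ler_wpM2r b0 nb); rewrite mulrAC [_ / N%:R]mulrC ler_pM2l ?invr_gt0 //.
  apply: (le_trans (ler_norm_sum _ _ _)).
  rewrite big_nat_cond.
  apply: (@le_trans _ _ (\sum_(Y1 <= y < Y2.+1 | (Y1 <= y < Y2.+1)%N && true) (2 * e0 + N%:R^-1))).
    apply: ler_sum => y; rewrite andbT ltnS => /andP[_ yY]; apply: Hy; exact: leq_trans Y2L.
  by rewrite -big_nat_cond sumr_const_nat [X in _ <= X]mulr_natl.
pose S'' := \sum_(Y1 <= y < Y2) strip X1 X2 (y%:R / N%:R).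
have D2 : `|N%:R^-1 * S' - N%:R^-1 * S''| <= N%:R^-1.
  rewrite -mulrBr /S' big_nat_recr //= -/S'' addrAC subrr add0r normrM normfV (ger0_norm (ltW Nr0)).
  by rewrite ler_piMr ?invr_ge0 ?(ltW Nr0) // strip_le1 // tm.
pose f t := strip X1 X2 (clamp lam t).
have cf : continuous f.
  apply: clamp_cont => // e e_gt0; have [d d0 Hd] := dL1_unif ent e_gt0.
  exists d => // y y' hy hy' yy'; exact: le_trans (strip_L1 X12 hy hy') (Hd _ _ hy hy' yy').
have D3 : `|N%:R^-1 * S'' - \int[mu]_(t in `[Y1%:R / N%:R, Y2%:R / N%:R])
    \int[mu]_(s in `[X1%:R / N%:R, X2%:R / N%:R]) G s t| <= lam * e1.
  have -> : \int[mu]_(t in `[Y1%:R / N%:R, Y2%:R / N%:R])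
    \int[mu]_(s in `[X1%:R / N%:R, X2%:R / N%:R]) G s t =
    \int[mu]_(t in `[Y1%:R / N%:R, Y2%:R / N%:R]) f t.
    apply: eq_Rintegral => t; rewrite inE /= in_itv /= => /andP[t1 t2].
    have ht : 0 <= t <= lam.
      have /andP[h0 _] := tm Y1 (leq_trans Y12 Y2L); have /andP[_ hl] := tm Y2 Y2L.
      by rewrite (le_trans h0 t1) (le_trans t2 hl).
    rewrite /f clampE //; apply: Int_closed.
    - exact: (bm_sol ent).
    - by rewrite divr_ge0.
    - exact: grid.
    - by rewrite ler_pdivrMr // mul1r ler_nat ltnW.
  have -> : S'' = \sum_(Y1 <= y < Y2) f (y%:R / N%:R).
    apply: eq_big_nat => y /andP[_ yY]; rewrite /f clampE // tm //.
    exact: leq_trans (ltnW yY) Y2L.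
  have := @riemann_sum R f N Y1 (Y2 - Y1) e1 cf isT; rewrite subnKC // => H.
  apply: (@le_trans _ _ ((Y2 - Y1)%:R / N%:R * e1)).
    apply: H => i t /andP[i1 i2] /andP[t1 t2].
    have hi := tm i (leq_trans (ltnW i2) Y2L); have hi' := tm i.+1 (leq_trans i2 Y2L).
    have ht : 0 <= t <= lam by move: hi hi' => /andP[h _] /andP[_ h']; rewrite (le_trans h t1) (le_trans t2 h').
    rewrite /f !clampE //; apply: (le_trans (strip_L1 X12 ht hi)); apply: mod => //.
    rewrite ger0_norm ?subr_ge0 // lerBlDl; apply: (le_trans t2).
    by rewrite -[i.+1%:R]natr1 mulrDl mul1r.
  apply: ler_wpM2r => //; rewrite ler_pdivrMr //; apply: le_trans LN.
  by rewrite ler_nat (leq_trans (leq_subr _ _)).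
rewrite /rect_dev SE.
exact: (rect_arith D1 D2 D3).
Qed.

End Rectangles.

Lemma truncated_defect (R : realType) (b lam e : R) : 0 < b -> b < 1 -> 0 < lam -> 0 < e ->
  exists N0 : nat, forall N : nat, (N0 <= N)%N ->
    (1 + b ^+ N) ^+ (Num.truncn (lam * N%:R)) - 1 <= e.
Proof.
move=> b_gt0 b_lt1 l0 e0; pose e2 : R := Num.min e (1 / 2).
have e20 : 0 < e2 by rewrite lt_min e0 /=; lra.
have C0 : 0 <= 2 * lam by rewrite mulr_ge0 // ltW.
have [N0 HN0] := poly_geometric_small C0 b_gt0 b_lt1 ltr01 e20.
exists N0 => N hN; have := HN0 N hN; rewrite mul1r natrK => H.
set L := Num.truncn _.
have LN : L%:R <= lam * N%:R by rewrite truncn_le mulr_ge0 // ltW.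
have bN0 : 0 <= b ^+ N by rewrite exprn_ge0 // ltW.
have N5 : N%:R <= N.+1%:R ^+ 5 :> R.
  by rewrite -natrX ler_nat; apply: leq_trans (leqnSn N) _; rewrite -{1}[N.+1]expn1 leq_pexp2l.
move: (N.+1%:R ^+ 5) N5 H => p N5 H.
have LB : 2 * (L%:R * b ^+ N) <= e2.
  apply: le_trans H; rewrite -!mulrA ler_pM2l //; apply: (le_trans (ler_wpM2r bN0 LN)).
  by rewrite -mulrA; apply: ler_wpM2l; [exact: ltW|exact: ler_wpM2r].
have e2a : e2 <= e by rewrite ge_min lexx.
have e2b : e2 <= 1 / 2 by rewrite ge_min lexx orbT.
apply: (le_trans (geometric_defect bN0 _)); last exact: le_trans e2a.
lra.
Qed.

Lemma tolerance_arith (R : realType) (lam eps x mi e0 e1 : R) : 0 < lam ->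
  8 * (lam + 1) * x = eps -> e0 <= x -> mi <= x -> e1 <= x -> 0 <= x ->
  (lam + 1) * (2 * e0 + mi) + mi + lam * e1 <= eps.
Proof.
move=> l0 <- h0 h1 h2 x0.
have a1 : (lam + 1) * (2 * e0 + mi) <= (lam + 1) * (3 * x) by apply: ler_wpM2l; lra.
have a2 := ler_wpM2l (ltW l0) h2; have a3 := mulr_ge0 (ltW l0) x0.
lra.
Qed.

Theorem theorem1p1 (R : realType) (b1 b2 lam eps : R) (Psi : R -> R)
    (G : R -> R -> R) (psi : nat -> nat -> bool) :
  0 < b1 -> b1 < b2 -> b2 < 1 -> 0 < lam -> 0 < eps ->
  measurable_fun (`[0, 1[ : set R) Psi ->
  (forall x, 0 <= x < 1 -> 0 <= Psi x <= 1) ->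
  entropy_solution b1 b2 lam Psi G ->
  boundary_converges Psi psi ->
  (fun N : nat =>
     sv_prob b1 b2 N (Num.truncn (lam * N%:R)) (psi N)
       (dev_event N (Num.truncn (lam * N%:R)) G eps)) @ \oo --> (0 : R).
Proof.
move=> b1_gt0 b1_lt_b2 b2_lt1 lam_gt0 eps_gt0 _ _ ent bconv.
have b1_lt1 := lt_trans b1_lt_b2 b2_lt1; have b2_gt0 := lt_trans b1_gt0 b1_lt_b2.
have b1_01 : 0 <= b1 <= 1 by rewrite !ltW.
have b2_01 : 0 <= b2 <= 1 by rewrite !ltW.
apply/cvgrPdist_le => r r_gt0.
have l1 : 0 < 8 * (lam + 1) by lra.
pose x := eps / (8 * (lam + 1)).
have x0 : 0 < x by rewrite divr_gt0.
have xE : 8 * (lam + 1) * x = eps by rewrite /x mulrC divfK // gt_eqF.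
(* [e] bounds both the deviation of the heights and its probability; the other half of [r] is left
   for the defect of the coin representation. *)
pose e := Num.min x (r / 2).
have e0 : 0 < e by rewrite lt_min x0 divr_gt0.
have ex : e <= x by rewrite ge_min lexx.
have er : e <= r / 2 by rewrite ge_min lexx orbT.
have [N1 HN1] := heights_converge b1_gt0 b1_lt_b2 b2_lt1 lam_gt0 ent bconv e0.
have [d d0 Hd] := dL1_unif ent x0.
have [N2 HN2] := nat_above (Num.max x^-1 (2 / d)).
have beta0 : 0 < beta b1 b2.
  have : 0 <= (1 - b1) * b2 by rewrite mulr_ge0; lra.
  by rewrite /beta; lra.
have beta1 : beta b1 b2 < 1.
  have : 0 < (1 - b1) * (1 - b2) by rewrite mulr_gt0; lra.
  by rewrite /beta; lra.
have r2 : 0 < r / 2 by rewrite divr_gt0.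
have [N3 HN3] := truncated_defect beta0 beta1 lam_gt0 r2.
exists (maxn 1 (maxn N1 (maxn N2 N3))) => //; case=> [|n] /=; first by rewrite geq_max.
rewrite !geq_max => /and4P[_ h1 h2 h3].
have Nr0 : 0 < n.+1%:R :> R by rewrite ltr0n.
have : Num.max x^-1 (2 / d) <= n.+1%:R by apply: (le_trans HN2); rewrite ler_nat.
rewrite ge_max ler_pdivrMr // => /andP[Nx Nd].
have Nx' : n.+1%:R^-1 <= x by rewrite -[x]invrK lef_pV2 ?posrE ?invr_gt0.
have Nd' : n.+1%:R^-1 < d.
  by rewrite -[X in X < _]mul1r ltr_pdivrMr // mulrC; lra.
rewrite sub0r normrN ger0_norm; last exact: sv_prob_ge0.
apply: (le_trans (sv_prob_le b1_01 b2_01 _ _)).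
have := HN3 n.+1 h3.
set L := Num.truncn _; set defect := _ ^+ L - 1 => D.
have EFP := EF_expect ('I_n.+1 * 'I_L)%type b1_01 b2_01.
suff : EF b1 b2 (fun c : {ffun 'I_n.+1 * 'I_L -> coin} =>
    ind R (dev_event n.+1 L G eps (emin (psi n.+1) c))) <= e by lra.
apply: le_trans (HN1 n h1); apply: (ev_le EFP) => c.
rewrite /ind ler_nat; case: (boolP (good_heights G psi e c)) => [good|_]; last first.
  by case: dev_event.
rewrite leqn0 eqb0; apply/negP => /existsP[X1 /existsP[X2 /existsP[Y1 /existsP[Y2]]]].
case/and3P => X12 Y12; rewrite ltNge => /negP; apply.
have mod y y' : 0 <= y <= lam -> 0 <= y' <= lam -> `|y - y'| <= n.+1%:R^-1 -> dL1 G y y' <= x.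
  by move=> hy hy' yy; apply: Hd => //; exact: le_lt_trans Nd'.
have Y2L : (Y2 <= L)%N by rewrite -ltnS.
apply: (le_trans (rect_dev_le lam_gt0 ent (ltW e0) mod good X12 (ltn_ord X2) Y12 Y2L)).
exact: (tolerance_arith lam_gt0 xE ex Nx' (lexx x) (ltW x0)).
Qed.
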